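(* Let $\alpha\ge 0$ and $\gamma_j(h)=\gamma_j h^{-\alpha}$ with $\gamma_j>0$, $j=1,\dots,J$. Then there is a constant $c_\Xi$, independent of the parameter $h\in(0,h_0]$ and of the function $u\in H^1_0(\Xi(h);\Gamma(h))$, such that for every $h\in(0,h_0]$, every $u\in H_0^1(\Xi(h);\Gamma(h))$ and every $j=1,\dots,J$, $$\min\{h^{-\alpha+1},(1+|\ln h|)^{-2}\}\,\bigl\|r^{-1}(1+|\ln r|)^{-1}u_0;L^2(\Omega_0(h))\bigr\|^2+h^{-\alpha}\bigl\|(l_j-z)^{-1}u_j;L^2(\Omega_j(h))\bigr\|^2\le c_\Xi\,a(u,u;\Xi(h)),$$ where $u_0=u|_{\Omega_0(h)}$, $u_j=u|_{\Omega_j(h)}$, and $r=\min\{1,r_1,\dots,r_J\}$ with $r_j=|y-P^j|$.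
   Context: Geometry. $\omega_0,\omega_1,\dots,\omega_J\subset\mathbb R^2$ ($J\ge1$) are bounded domains, each bounded by a smooth simple closed contour; the origin belongs to $\omega_j$ for $j=1,\dots,J$; $P^1,\dots,P^J$ are distinct points of $\omega_0$; $l_1,\dots,l_J>0$ are fixed. Points of $\mathbb R^3$ are written $x=(y,z)$, $y\in\mathbb R^2$, $z\in\mathbb R$. For $h\in(0,h_0]$ put $\omega_j^h=\{y: h^{-1}(y-P^j)\in\omega_j\}$; $h_0>0$ is fixed sufficiently small (in particular the closures of $\omega_1^h,\dots,\omega_J^h$ are disjoint subsets of $\omega_0$ and $h<l_j$ for all $h\le h_0$). The intact plate is $\Omega_0(h)=\omega_0\times(0,h)$, the rods are $\Omega_j(h)=\omega_j^h\times(0,l_j)$, the perforated plate is $\Omega_\bullet(h)=\bigl(\omega_0\setminus\bigcup_j\overline{\omega_j^h}\bigr)\times(0,h)$. The junction is $\Xi(h)=\Omega_0(h)\cup\Omega_1(h)\cup\dots\cup\Omega_J(h)$ (the perforated plate and the rods, glued along $\partial\omega_j^h\times(0,h)$). $\Gamma(h)=\bigcup_j\omega_j^h\times\{l_j\}$, and $H_0^1(\Xi(h);\Gamma(h))$ is the space of functions in $H^1(\Xi(h))$ vanishing on $\Gamma(h)$. The quadratic form is $$a(u,u;\Xi(h))=\|\nabla_x u;L^2(\Omega_\bullet(h))\|^2+\sum_{j=1}^J\gamma_j(h)\|\nabla_x u;L^2(\Omega_j(h))\|^2 .$$ $\|\cdot\,;X\|$ denotes the norm in the space $X$. *)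

(* Defs.v *)
From HB Require Import structures.
From mathcomp Require Import all_boot all_order all_algebra.
From mathcomp Require Import all_classical all_reals all_analysis.

Set Implicit Arguments.
Unset Strict Implicit.
Unset Printing Implicit Defensive.

Import Order.TTheory GRing.Theory Num.Theory.
Import numFieldNormedType.Exports.

Local Open Scope classical_set_scope.
Local Open Scope ring_scope.

(* The plane is R * R and the space is R * R * R, with x = (y, z), y = x.1 and
   z = x.2.  The library norm on products is the sup norm; it is used only
   through the topology it induces, and distances are measured by enorm. *)

(* lebesgue_measure lives on measurableTypeR R, which is convertible to R; the
   aliases keep integrals and measurability over one structure. *)
Notation meas2 R := (measurableTypeR R * measurableTypeR R)%type.
Notation meas3 R :=
  (measurableTypeR R * measurableTypeR R * measurableTypeR R)%type.

Section lebesgue.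
Variable R : realType.

(* The library's sigma-finiteness of a product measure is not found by
   inference in this case (a subprobability instance has the same key). *)
Lemma product_sigma_finite d1 d2 (T1 : measurableType d1)
    (T2 : measurableType d2) (m1 : {sigma_finite_measure set T1 -> \bar R})
    (m2 : {sigma_finite_measure set T2 -> \bar R}) :
  sigma_finite setT (m1 \x m2)%E.
Proof.
have /sigma_finiteP[F [TF ndF Foo]] := sigma_finiteT m1.
have /sigma_finiteP[G [TG ndG Goo]] := sigma_finiteT m2.
exists (fun n => F n `*` G n).
  rewrite -setXTT TF TG predeqE => -[x y]; split.
    move=> [/= [n _ Fnx] [k _ Gky]]; exists (maxn n k) => //; split.
    - by move: x Fnx; exact/subsetPset/ndF/leq_maxl.
    - by move: y Gky; exact/subsetPset/ndG/leq_maxr.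
  by move=> [n _ []/= ? ?]; split; exists n.
move=> k; have [? ?] := Foo k; have [? ?] := Goo k.
split; first exact: measurableX.
by rewrite product_measure1E// lte_mul_pinfty// ge0_fin_numE.
Qed.

Definition leb2 : set (meas2 R) -> \bar R :=
  (@lebesgue_measure R \x @lebesgue_measure R)%E.

HB.instance Definition _ := Measure.on leb2.
HB.instance Definition _ :=
  Measure_isSigmaFinite.Build _ _ _ leb2 (product_sigma_finite _ _).

Definition leb3 : set (meas3 R) -> \bar R :=
  (leb2 \x @lebesgue_measure R)%E.

HB.instance Definition _ := Measure.on leb3.
HB.instance Definition _ :=
  Measure_isSigmaFinite.Build _ _ _ leb3 (product_sigma_finite _ _).

Definition enorm (y : R * R) : R := Num.sqrt (y.1 ^+ 2 + y.2 ^+ 2).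

End lebesgue.

Arguments leb2 : clear implicits.
Arguments leb3 : clear implicits.

Section smoothness.
Variable R : realType.

Definition smooth1 (f : R -> R) : Prop :=
  forall n x, derivable (derive1n n f) x 1.

Definition smooth_closed_contour (g : R -> R * R) : Prop :=
  let g1 := fun t => (g t).1 in let g2 := fun t => (g t).2 in
  [/\ smooth1 g1, smooth1 g2,
      (forall t, (derive1 g1 t, derive1 g2 t) <> (0, 0)),
      (forall t, g (t + 1) = g t)
    & {in `[0, 1[ &, injective g}].

Definition smooth_contour_domain (w : set (R * R)) : Prop :=
  [/\ open w, connected w, bounded_set w
    & exists2 g : R -> R * R, smooth_closed_contour g &
        closure w `\` interior w = range g].

Definition e3 (i : 'I_3) : R * R * R :=
  (((i == 0 :> nat)%N)%:R, ((i == 1 :> nat)%N)%:R, ((i == 2 :> nat)%N)%:R).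

Fixpoint Ck (k : nat) (f : R * R * R -> R) : Prop :=
  if k is k'.+1 then
    continuous f /\
    forall i, (forall x, derivable f x (e3 i)) /\ Ck k' ('D_(e3 i) f)
  else continuous f.

Definition smooth3 (f : R * R * R -> R) : Prop := forall k, Ck k f.

Definition test_function (U : set (R * R * R)) (phi : R * R * R -> R) : Prop :=
  let supp := closure [set x | phi x != 0] in
  [/\ smooth3 phi, compact supp & supp `<=` U].

End smoothness.

Section sobolev.
Variable R : realType.
Implicit Types (U X : set (R * R * R)) (u g : R * R * R -> R).

Definition sqL2 X u : \bar R := (\int[leb3 R]_(x in X) ((u x) ^+ 2)%:E)%E.

Definition inL2 X u : Prop :=
  measurable_fun (X : set (meas3 R)) (u : meas3 R -> R) /\ (sqL2 X u < +oo)%E.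

Definition is_weak_partial U (i : 'I_3) u g : Prop :=
  inL2 U g /\
  forall phi, test_function U phi ->
    \int[leb3 R]_(x in U) (u x * 'D_(e3 R i) phi x) =
    - \int[leb3 R]_(x in U) (g x * phi x).

Definition inH1 U u : Prop :=
  inL2 U u /\ forall i, exists g, is_weak_partial U i u g.

(* A representative of the (almost everywhere unique) weak derivative. *)
Definition weak_partial U (i : 'I_3) u : R * R * R -> R :=
  xget (fun=> 0) [set g | is_weak_partial U i u g].

(* || grad u; L^2(X) ||^2 for X a subset of U, where u is in H^1(U). *)
Definition sqL2_grad U X u : \bar R :=
  (\sum_(i < 3) sqL2 X (weak_partial U i u))%E.

(* v_n -> u in H^1(U), for v_n smooth on the whole space. *)
Definition H1_approx U (v : nat -> R * R * R -> R) u : Prop :=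
  [/\ forall n, smooth3 (v n),
      (fun n => sqL2 U (v n \- u)) @ \oo --> 0%E
    & forall i, (fun n => sqL2 U ('D_(e3 R i) (v n) \- weak_partial U i u))
                  @ \oo --> 0%E].

End sobolev.

Section junction.
Variables (R : realType) (J : nat).
Variables (omega0 : set (R * R)) (omega : 'I_J -> set (R * R)).
Variables (P : 'I_J -> R * R) (l : 'I_J -> R).
Implicit Types (h : R) (j : 'I_J) (u : R * R * R -> R).

Definition omegah h j : set (R * R) :=
  [set y | omega j (h^-1 *: (y - P j))].

Definition plate h : set (R * R * R) :=
  omega0 `*` [set z | 0 < z < h].

Definition rod h j : set (R * R * R) :=
  omegah h j `*` [set z | 0 < z < l j].

Definition perforated_plate h : set (R * R * R) :=
  (omega0 `\` \bigcup_j closure (omegah h j)) `*` [set z | 0 < z < h].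

Definition Xi h : set (R * R * R) :=
  plate h `|` \bigcup_j rod h j.

Definition small_h h : Prop :=
  [/\ forall j, closure (omegah h j) `<=` omega0,
      forall j k, j != k -> closure (omegah h j) `&` closure (omegah h k) = set0
    & forall j, h < l j].

(* || f; L^2(Gamma(h)) ||^2, Gamma(h) being the union of the flat rod ends
   omega_j^h x {l_j}. *)
Definition sqL2_Gamma h (f : R * R * R -> R) : \bar R :=
  (\sum_(j < J) \int[leb2 R]_(y in omegah h j) ((f (y, l j)) ^+ 2)%:E)%E.

(* The trace operator H^1(Xi(h)) -> L^2(Gamma(h)) is the continuous extension
   of the restriction of functions that are smooth up to the boundary. *)
Definition is_trace_Gamma h u (tau : R * R * R -> R) : Prop :=
  exists v : nat -> R * R * R -> R,
    H1_approx (Xi h) v u /\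
    (fun n => sqL2_Gamma h (v n \- tau)) @ \oo --> 0%E.

Definition inH10 h u : Prop :=
  inH1 (Xi h) u /\ is_trace_Gamma h u (fun=> 0).

Definition energy (gammah : 'I_J -> R) h u : \bar R :=
  (sqL2_grad (Xi h) (perforated_plate h) u +
   \sum_(j < J) (gammah j)%:E * sqL2_grad (Xi h) (rod h j) u)%E.

Definition rdist (y : R * R) : R :=
  \big[Num.min/1]_(j < J) enorm (y - P j).

End junction.

(* Main.v *)
(* The estimate is proved for smooth v and then passes to the limit along the
   smooth v_n -> u that realize the zero trace: with the weights cut off near
   the points P^j and near z = l_j, both sides depend continuously on u in
   H^1(Xi(h)), and the cut-offs are removed by monotone convergence.

   In a rod, Hardy's inequality is applied on the vertical lines.  In the plate,
   every slice w = v(., z), 0 < z < h, satisfies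
     || r^-1 (1 + |ln r|)^-1 w; omega_0 ||^2
       <= C (h^-2 || w; omega_j^h ||^2 + (1 + |ln h|)^2 || grad w; omega_0 ||^2).
   As h < l_j, the first norm on the right is controlled by the derivative in z
   on the rod; integrating over 0 < z < h turns h^-2 into h^-1, and the factor
   min {h^(1 - alpha), (1 + |ln h|)^-2} compensates both coefficients.

   The planar inequality comes from comparing w at the two ends of a path and
   averaging.  Dilations y |-> P + e^-t (y - P) in logarithmic time t turn the
   one-dimensional inequality with weight (1 + t)^-1 into the logarithmic Hardy
   inequality near P, and bound a fixed square by the small one contained in
   omega_j^h.  Translations give a Poincare inequality on omega_0: inside by
   connectedness, and near a boundary point because a translation transversal
   to the contour moves points from there into the domain. *)

Require Import Defs.
From HB Require Import structures.
From mathcomp Require Import all_boot all_order all_algebra.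
From mathcomp Require Import all_classical all_reals all_analysis.
From mathcomp Require Import measurable_realfun ring lra.

Set Implicit Arguments.
Unset Strict Implicit.
Unset Printing Implicit Defensive.

Import Order.TTheory GRing.Theory Num.Theory.
Import numFieldNormedType.Exports.

Local Open Scope classical_set_scope.
Local Open Scope ring_scope.

(** * Measurability and affine changes of variables *)

(** The function u is only square integrable with its weak derivatives, the weights are singular,
    and no weighted norm of u is known to be finite at the outset. The integral inequalities are
    therefore stated in the extended reals with sums on both sides, so that no possibly infinite
    integral is subtracted. Two kinds of constants are kept apart. The one in front of the energy is
    independent of h and of the cut-offs. Those in front of the trace on Gamma(h) and of the L^2
    approximation errors may depend on all of them, because these terms tend to 0 while the cut-offs
    are still in place. The planar inequality lives on full slices omega_0, holes included. The part
    of its gradient term inside the holes has to be paid for by the rods, which is possible because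
    gamma_j h^(-alpha) is bounded below for h <= h_0 and the rims of the holes are null sets. The
    Poincare constant comes from compactness and is not explicit, but it concerns only omega_0 and a
    fixed square about P^j. In the planar inequality, h acts only through the duration ln(rho / (e
    h)) of the dilation that shrinks this square. *)

Section measurability.
Variable R : realType.

(** Bridges topology and the product sigma-algebra: with B ranging over rational boxes, an open set
    is the union of the boxes that it contains, and [pickle] turns this into a sequence. *)
Lemma countable_cover_measurable d (M : measurableType d) (I : countType)
    (B : I -> set M) (A : set M) :
  (forall i, measurable (B i)) ->
  (forall x, A x -> exists2 i, B i x & B i `<=` A) -> measurable A.
Proof.
move=> mB AB.
have -> : A = \bigcup_n (if unpickle n is Some i then
    (if `[< B i `<=` A >] then B i else set0) else set0).
  apply/seteqP; split=> [x Ax|x [n _]].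
    have [i Bix BiA] := AB x Ax; exists (pickle i) => //.
    by rewrite pickleK; case: asboolP.
  by case: unpickle => // i; case: asboolP => // + Bix; exact.
apply: bigcupT_measurable => n; case: unpickle => // i.
by case: asboolP.
Qed.

Lemma nbhs_rat_itv (x : R) (U : set R) : nbhs x U ->
  exists p : rat * rat, (ratr p.1 < x < ratr p.2) /\
    (`]ratr p.1, ratr p.2[%classic `<=` U).
Proof.
move=> /nbhs_ballP[e /= e0 xeU].
have [p] := @rat_in_itvoo R (x - e) x ltac:(lra).
have [q] := @rat_in_itvoo R x (x + e) ltac:(lra).
rewrite !in_itv/= => /andP[q1 q2] /andP[p1 p2]; exists (p, q); split.
  by rewrite q1 p2.
move=> y /=; rewrite in_itv/= => /andP[y1 y2]; apply: xeU.
rewrite /ball/= ltr_distl; apply/andP; split; lra.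
Qed.

Lemma open_measurable2 (A : set (R * R)) :
  open A -> measurable (A : set (meas2 R)).
Proof.
move=> oA.
pose B (i : (rat * rat) * (rat * rat)) : set (meas2 R) :=
  `]ratr i.1.1, ratr i.1.2[%classic `*` `]ratr i.2.1, ratr i.2.2[%classic.
apply: (@countable_cover_measurable _ (meas2 R) _ B).
  by move=> i; apply: measurableX; exact: measurable_itv.
move=> [x y] Axy; have := open_nbhs_nbhs (conj oA Axy).
move=> [[U V] /= [/nbhs_rat_itv[p [px pU]] /nbhs_rat_itv[q [qx qV]] UV]].
exists (p, q); first by split.
by move=> [s t] [/= /pU Us /qV Vt]; exact: UV.
Qed.

Lemma open_measurable3 (A : set (R * R * R)) :
  open A -> measurable (A : set (meas3 R)).
Proof.
move=> oA.
pose B (i : (rat * rat) * (rat * rat) * (rat * rat)) : set (meas3 R) :=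
  (`]ratr i.1.1.1, ratr i.1.1.2[%classic
   `*` `]ratr i.1.2.1, ratr i.1.2.2[%classic)
  `*` `]ratr i.2.1, ratr i.2.2[%classic.
apply: (@countable_cover_measurable _ (meas3 R) _ B).
  move=> i; apply: measurableX; last exact: measurable_itv.
  by apply: measurableX; exact: measurable_itv.
move=> [[x y] z] Axy; have := open_nbhs_nbhs (conj oA Axy).
move=> [[W V] /= [[[U1 U2] /= [/nbhs_rat_itv[p [px pU]]
  /nbhs_rat_itv[q [qx qV]]] U12] /nbhs_rat_itv[r [rx rW]]] UV].
exists (p, q, r); first by split => //; split.
move=> [[s s'] t] [[/= /pU Us /qV Vt] /rW Wt]; apply: UV; split => //.
exact: U12.
Qed.

Lemma closed_measurable2 (A : set (R * R)) :
  closed A -> measurable (A : set (meas2 R)).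
Proof.
by move/closed_openC/open_measurable2/measurableC; rewrite setCK.
Qed.

Lemma closed_measurable3 (A : set (R * R * R)) :
  closed A -> measurable (A : set (meas3 R)).
Proof.
by move/closed_openC/open_measurable3/measurableC; rewrite setCK.
Qed.

Lemma continuous_measurable2 (f : R * R -> R) : continuous f ->
  measurable_fun (setT : set (meas2 R)) (f : meas2 R -> R).
Proof.
move=> /continuousP cf; apply: (measurability _ (RGenOpens.measurableE R)).
move=> _ [_ [a [b ->] <-]]; rewrite setTI; apply: open_measurable2.
exact/cf/interval_open.
Qed.

Lemma continuous_measurable3 (f : R * R * R -> R) : continuous f ->
  measurable_fun (setT : set (meas3 R)) (f : meas3 R -> R).
Proof.
move=> /continuousP cf; apply: (measurability _ (RGenOpens.measurableE R)).
move=> _ [_ [a [b ->] <-]]; rewrite setTI; apply: open_measurable3.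
exact/cf/interval_open.
Qed.

End measurability.

Section affine.
Variable R : realType.
Notation leb := (@lebesgue_measure R).
Local Open Scope ereal_scope.

Lemma affine_measurable (a b : R) :
  measurable_fun (setT : set (measurableTypeR R))
    ((fun x => a * x + b)%R : measurableTypeR R -> measurableTypeR R).
Proof.
apply: continuous_measurable_fun => x; apply: cvgD; last exact: cvg_cst.
by apply: cvgM; [exact: cvg_cst|exact: cvg_id].
Qed.

(** Scaling by a the pushforward of Lebesgue measure under x |-> a x + b restores the length of
    every interval ]c, d], so uniqueness of Lebesgue measure identifies the two. *)
Lemma ge0_integral_affine (a b : R) (f : R -> \bar R) : (0 < a)%R ->
  measurable_fun (setT : set (measurableTypeR R))
    (f : measurableTypeR R -> \bar R) ->
  (forall x, 0 <= f x) ->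
  \int[leb]_x f x = a%:E * \int[leb]_x f (a * x + b)%R.
Proof.
move=> a0 mf f0.
pose phi : measurableTypeR R -> measurableTypeR R := (fun x => a * x + b)%R.
have mphi : measurable_fun setT phi by exact: affine_measurable.
have a0' : (0 <= a)%R by exact: ltW.
have [m mmE] : exists m : {measure set (measurableTypeR R) -> \bar R},
    m = pushforward leb phi :> (set (measurableTypeR R) -> \bar R).
  by unshelve eexists (pushforward leb phi : {measure set _ -> \bar R}).
have mE (A : set (measurableTypeR R)) : measurable A ->
    leb A = mscale (NngNum a0') m A.
  apply: lebesgue_measure_unique => _ [[c d]] _ <-.
  rewrite /= /mscale/= mmE /pushforward.
  have -> : phi @^-1` [set` `]c, d]] = `]((c - b) / a)%R, ((d - b) / a)%R]%classic.
    apply/seteqP; split => x /=; rewrite !in_itv/= ltr_pdivrMr// ler_pdivlMr//.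
      by rewrite /phi => /andP[? ?]; apply/andP; split; lra.
    by move=> /andP[? ?]; rewrite /phi; apply/andP; split; lra.
  rewrite !lebesgue_measure_itv/= !lte_fin ltr_pM2r ?invr_gt0// ltrD2r.
  case: ifPn => cd; last by rewrite mule0.
  by rewrite -!EFinB -EFinM; congr EFin; field; rewrite gt_eqF.
rewrite (@eq_measure_integral _ _ _ _ (mscale (NngNum a0') m)); last first.
  by move=> A mA _; exact: mE.
rewrite ge0_integral_mscale//=; congr (_ * _).
rewrite (@eq_measure_integral _ _ _ _ (pushforward leb phi)) => [|A _ _].
  by rewrite ge0_integral_pushforward.
by rewrite mmE.
Qed.

Definition aff (a : R) (b y : R * R) : R * R :=
  (a * y.1 + b.1, a * y.2 + b.2)%R.

Lemma ge0_integral2_affine (a : R) (b : R * R) (f : R * R -> \bar R) :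
  (0 < a)%R ->
  measurable_fun (setT : set (meas2 R)) (f : meas2 R -> \bar R) ->
  (forall x, 0 <= f x) ->
  \int[leb2 R]_x f x = (a ^+ 2)%:E * \int[leb2 R]_x f (aff a b x).
Proof.
move=> a0 mf f0.
have mfst (y : R) : measurable_fun (setT : set (measurableTypeR R))
    (fun x => f (x, y)).
  exact: measurable_fun_pair1.
have mg : measurable_fun (setT : set (meas2 R))
    (fun x : meas2 R => f (aff a b x)).
  apply: (@measurableT_comp _ _ _ _ (meas2 R) _ f _
    (aff a b : meas2 R -> meas2 R) mf).
  apply: measurable_fun_pair => /=.
    exact: (measurableT_comp (affine_measurable a b.1)).
  exact: (measurableT_comp (affine_measurable a b.2)).
rewrite /leb2 fubini_tonelli1//= fubini_tonelli1//=; last first.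
rewrite /fubini_F (@ge0_integral_affine a b.1)//; last 2 first.
- exact: measurable_fun_fubini_tonelli_F.
- by move=> x; exact: integral_ge0.
rewrite expr2 EFinM -muleA; congr (_ * _).
rewrite -ge0_integralZl//.
- apply: eq_integral => x _.
  rewrite (@ge0_integral_affine a b.2)//.
  exact: measurable_fun_pair2.
- have := @measurable_fun_fubini_tonelli_F _ _ _ _ _ leb _ mg (fun=> f0 _).
  exact.
- by move=> x _; exact: integral_ge0.
- by rewrite lee_fin ltW.
Qed.

End affine.

(** * One-dimensional Hardy inequalities *)

Section onedim.
Variable R : realType.
Notation leb := (@lebesgue_measure R).

Lemma ctsM (T : topologicalType) (f g : T -> R) (x : T) :
  continuous_at x f -> continuous_at x g ->
  continuous_at x (fun y => f y * g y).
Proof. exact: continuousM. Qed.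

Lemma ctsD (T : topologicalType) (f g : T -> R) (x : T) :
  continuous_at x f -> continuous_at x g ->
  continuous_at x (fun y => f y + g y).
Proof. exact: continuousD. Qed.

Lemma ctsK (T : topologicalType) (c : R) (x : T) :
  continuous_at x (fun=> c).
Proof. exact: cvg_cst. Qed.

Lemma ctsN (T : topologicalType) (f : T -> R) (x : T) :
  continuous_at x f -> continuous_at x (fun y => - f y).
Proof. exact: continuousN. Qed.

Lemma ctsP (T U V : topologicalType) (f : T -> U) (g : T -> V) (x : T) :
  continuous_at x f -> continuous_at x g ->
  continuous_at x (fun y => (f y, g y)).
Proof.
move=> cf cg A [[B C] /= [fB gC] BCA].
have fx : nbhs x (f @^-1` B) by exact: cf.
have gx : nbhs x (g @^-1` C) by exact: cg.
suff : nbhs x ((fun y => (f y, g y)) @^-1` A) by [].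
by apply: filterS (filterI fx gx) => y [By Cy]; exact: (BCA (f y, g y)).
Qed.

Lemma continuous_sqr (T : topologicalType) (f : T -> R) (x : T) :
  continuous_at x f -> continuous_at x (fun y => f y ^+ 2).
Proof.
by move=> cf; exact: (ctsM cf cf).
Qed.

(** Integrates g <= F' + k by the fundamental theorem of calculus. All the one-dimensional
    inequalities below are instances, with F a well-chosen quadratic expression and k the square of
    a derivative or 0. *)
Lemma derive_le_integral (F F' g k : R -> R) (a b : R) : a <= b ->
  {in `[a, b], forall x : R, is_derive x (1 : R) F (F' x)} ->
  {in `[a, b], continuous F'} -> {in `[a, b], continuous g} ->
  {in `[a, b], continuous k} ->
  {in `[a, b], forall x, 0 <= g x} -> {in `[a, b], forall x, 0 <= k x} ->
  {in `[a, b], forall x, g x <= F' x + k x} ->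
  ((F a)%:E + \int[leb]_(x in `[a, b]) (g x)%:E <=
   (F b)%:E + \int[leb]_(x in `[a, b]) (k x)%:E)%E.
Proof.
move=> ab dF cF' cg ck g0 k0 gFk.
have within (f : R -> R) : {in `[a, b], continuous f} -> {within `[a, b], continuous f}.
  by move=> cf; apply: continuous_in_subspaceT => x; rewrite inE => /cf.
have intg (f : R -> R) : {in `[a, b], continuous f} ->
    leb.-integrable `[a, b] (EFin \o f).
  by move=> cf; apply: continuous_compact_integrable;
    [exact: segment_compact|exact: within].
move: ab; rewrite le_eqVlt => /orP[/eqP ab|ab].
  by rewrite ab set_itv1 !integral_set1.
have FTC : (\int[leb]_(x in `[a, b]) (F' x)%:E = (F b)%:E - (F a)%:E)%E.
  apply: continuous_FTC2 => //; first exact: within.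
    have cF x : x \in `[a, b] -> {for x, continuous F}.
      by move=> /dF dFx; apply/differentiable_continuous/derivable1_diffP.
    split.
    - by move=> x /subset_itv_oo_cc/dF.
    - by apply: cvg_at_right_filter; apply: cF; rewrite in_itv/= lexx ltW.
    - by apply: cvg_at_left_filter; apply: cF; rewrite in_itv/= lexx ltW.
  by move=> x /subset_itv_oo_cc/dF dFx; rewrite derive1E derive_val.
have : (\int[leb]_(x in `[a, b]) (g x)%:E <=
        \int[leb]_(x in `[a, b]) ((F' x)%:E + (k x)%:E))%E.
  apply: le_integral => //.
  - exact: intg.
  - by apply: integrableD => //; exact: intg.
  - by move=> x /[!inE] xab; rewrite -EFinD lee_fin gFk.
rewrite integralD//; [|exact: intg|exact: intg].
rewrite FTC => /(leeD2l (F a)%:E)/le_trans; apply.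
rewrite addeA -EFinB -EFinD (_ : F a + (F b - F a) = F b)//; ring.
Qed.

(* d/dt (2 psi phi^2) = psi^2 phi^2 - 4 phi'^2 + (psi phi + 2 phi')^2
   when psi' = psi^2. *)
Lemma hardy_riccati (psi phi dphi : R -> R) (a b : R) : a <= b ->
  {in `[a, b], forall x : R, is_derive x (1 : R) psi (psi x ^+ 2)} ->
  {in `[a, b], forall x : R, is_derive x (1 : R) phi (dphi x)} ->
  {in `[a, b], continuous dphi} ->
  ((2 * (psi a * phi a ^+ 2))%:E
     + \int[leb]_(x in `[a, b]) ((psi x * phi x) ^+ 2)%:E <=
   (2 * (psi b * phi b ^+ 2))%:E
     + \int[leb]_(x in `[a, b]) (4 * dphi x ^+ 2)%:E)%E.
Proof.
move=> ab dpsi df cdf.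
have cf x : x \in `[a, b] -> {for x, continuous phi}.
  by move=> /df dFx; apply/differentiable_continuous/derivable1_diffP.
have cpsi x : x \in `[a, b] -> {for x, continuous psi}.
  by move=> /dpsi dFx; apply/differentiable_continuous/derivable1_diffP.
pose F x := 2 * (psi x * phi x ^+ 2).
pose F' x := 2 * ((psi x * phi x) ^+ 2 + 2 * (psi x * (phi x * dphi x))).
apply: (@derive_le_integral F F') => //.
- move=> x xab; have := df x xab; have := dpsi x xab => d1 d2.
  apply: is_derive_eq; rewrite /F' /GRing.scale/=; ring.
- move=> x xab; have := cf x xab; have := cpsi x xab; have := cdf x xab => *.
  rewrite /F'; apply: ctsM; first exact: ctsK.
  apply: ctsD.
    by apply: continuous_sqr; apply: ctsM.
  apply: ctsM; first exact: ctsK.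
  by apply: ctsM => //; apply: ctsM.
- move=> x xab; have := cf x xab; have := cpsi x xab => *.
  by apply: continuous_sqr; apply: ctsM.
- move=> x xab; have := cdf x xab => *.
  apply: ctsM; first exact: ctsK.
  exact: continuous_sqr.
- by move=> x _; exact: sqr_ge0.
- by move=> x _; rewrite mulr_ge0// sqr_ge0.
- move=> x _; rewrite /F' -subr_ge0.
  have -> : 2 * ((psi x * phi x) ^+ 2 + 2 * (psi x * (phi x * dphi x)))
    + 4 * dphi x ^+ 2 - (psi x * phi x) ^+ 2 = (psi x * phi x + 2 * dphi x) ^+ 2.
    by ring.
  exact: sqr_ge0.
Qed.

(** The Riccati solution is psi = (l + e - x)^-1. The shift e keeps psi finite at l, where phi need
    not vanish; the price is the boundary term with e^-1, while the one at 0 has a favourable sign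
    and is dropped. *)
Lemma hardy_end (phi dphi : R -> R) (l e : R) : 0 <= l -> 0 < e ->
  (forall x : R, is_derive x (1 : R) phi (dphi x)) -> continuous dphi ->
  (\int[leb]_(x in `[0%R, l]) (((l + e - x)^-1 * phi x) ^+ 2)%:E <=
   (2 * (e^-1 * phi l ^+ 2))%:E
     + \int[leb]_(x in `[0%R, l]) (4 * dphi x ^+ 2)%:E)%E.
Proof.
move=> l0 e0 df cdf.
have := @hardy_riccati (fun x => (l + e - x)^-1) phi dphi 0 l l0.
rewrite (_ : l + e - l = e); last by ring.
move=> H; apply: le_trans (H _ _ _); last 3 first.
- move=> x; rewrite in_itv/= => /andP[x0 xl].
  have lex : l + e - x != 0 by rewrite gt_eqF//; lra.
  have d1 : is_derive x 1 (fun x => l + e - x) (- 1).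
    by apply: is_derive_eq; ring.
  apply: is_derive_eq.
  by rewrite /GRing.scale/= mulrN1 opprK exprVn.
- by move=> x _; exact: df.
- by move=> x _; exact: cdf.
rewrite leeDr// lee_fin subr0 mulr_ge0// mulr_ge0 ?sqr_ge0// invr_ge0; lra.
Qed.

(** Here psi = - (1 + x)^-1. Its negative sign makes the boundary term at T favourable, so that no
    information at the far end is needed and the constants do not depend on T. *)
Lemma hardy_log (phi dphi : R -> R) (T : R) : 0 <= T ->
  (forall x : R, is_derive x (1 : R) phi (dphi x)) -> continuous dphi ->
  (\int[leb]_(x in `[0%R, T]) (((1 + x)^-1 * phi x) ^+ 2)%:E <=
   (2 * phi 0 ^+ 2)%:E
     + \int[leb]_(x in `[0%R, T]) (4 * dphi x ^+ 2)%:E)%E.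
Proof.
move=> T0 df cdf.
have := @hardy_riccati (fun x => - (1 + x)^-1) phi dphi 0 T T0.
rewrite addr0 invr1 => H.
have {H} : ((2 * (-1 * phi 0 ^+ 2))%:E +
       \int[leb]_(x in `[0%R, T]) ((- (1 + x)^-1 * phi x) ^+ 2)%:E <=
       (2 * (- (1 + T)^-1 * phi T ^+ 2))%:E +
       \int[leb]_(x in `[0%R, T]) (4 * dphi x ^+ 2)%:E)%E.
  apply: H.
  - move=> x; rewrite in_itv/= => /andP[x0 xl].
    have lex : 1 + x != 0 by rewrite gt_eqF//; lra.
    have d1 : is_derive x 1 (fun x => 1 + x) 1.
      by apply: is_derive_eq; ring.
    apply: is_derive_eq.
    by rewrite /GRing.scale/= sqrrN exprVn mulr1 opprK.
  - by move=> x _; exact: df.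
  - by move=> x _; exact: cdf.
under eq_integral do rewrite mulNr sqrrN.
move=> /(leeD2l (2 * phi 0 ^+ 2)%:E); rewrite addeA -EFinD mulN1r mulrN subrr.
rewrite add0e => /le_trans; apply; rewrite leeD2l//.
rewrite -[leRHS]add0e leeD2r// lee_fin mulNr mulrN oppr_le0.
by rewrite mulr_ge0// mulr_ge0 ?sqr_ge0// invr_ge0; lra.
Qed.

(* The derivative of (1 + (x - a) / T) phi^2, with T = b - a, is at least
   - 4 T phi'^2. *)
Lemma sqr_le_end (phi dphi : R -> R) (a b : R) : a <= b ->
  (forall x : R, is_derive x (1 : R) phi (dphi x)) -> continuous dphi ->
  ((phi a ^+ 2)%:E <= (2 * phi b ^+ 2)%:E
     + \int[leb]_(x in `[a, b]) (4 * (b - a) * dphi x ^+ 2)%:E)%E.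
Proof.
move=> + df cdf; rewrite le_eqVlt => /orP[/eqP <-|ab].
  by rewrite set_itv1 integral_set1 adde0 lee_fin; have := sqr_ge0 (phi a); lra.
have T0 : 0 < b - a by lra.
pose psi x := 1 + (x - a) * (b - a)^-1.
pose F x := psi x * phi x ^+ 2.
pose F' x := (b - a)^-1 * phi x ^+ 2 + 2 * (psi x * (phi x * dphi x)).
have dpsi (x : R) : is_derive x 1 psi (b - a)^-1.
  by apply: is_derive_eq; rewrite /GRing.scale/=; ring.
have cf : continuous phi.
  by move=> x; have := df x => ?; apply/differentiable_continuous/derivable1_diffP.
have cpsi : continuous psi.
  by move=> x; have := dpsi x => ?; apply/differentiable_continuous/derivable1_diffP.
have := @derive_le_integral F F' (fun=> 0)
  (fun x => 4 * (b - a) * dphi x ^+ 2) a b (ltW ab).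
rewrite integral0_eq// adde0 /F /psi subrr mul0r addr0 mul1r mulfV ?gt_eqF//.
apply.
- move=> x _; have := df x; have := dpsi x => d1 d2.
  by apply: is_derive_eq; rewrite /F' /psi /GRing.scale/=; ring.
- move=> x _; rewrite /F'; apply: ctsD.
    apply: ctsM; first exact: ctsK.
    by apply: continuous_sqr; exact: cf.
  apply: ctsM; first exact: ctsK.
  apply: ctsM; first exact: cpsi.
  by apply: ctsM; [exact: cf|exact: cdf].
- by move=> x _; exact: ctsK.
- move=> x _; apply: ctsM; first exact: ctsK.
  by apply: continuous_sqr; exact: cdf.
- by [].
- by move=> x _; rewrite mulr_ge0 ?sqr_ge0// mulr_ge0// ltW.
- move=> x; rewrite in_itv/= => /andP[ax xb].
  have p1 : 1 <= psi x <= 2.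
    rewrite /psi; apply/andP; split; rewrite ?lerDl ?mulr_ge0 ?invr_ge0; try lra.
    rewrite (_ : 2 = 1 + 1)// lerD2l ler_pdivrMr//; lra.
  (* Completing the square: F' + (b - a) psi^2 phi'^2 is nonnegative, and psi <= 2 replaces psi^2 by
     the factor 4. *)
  have : 0 <= (b - a)^-1 * (phi x + (b - a) * psi x * dphi x) ^+ 2.
    by rewrite mulr_ge0 ?sqr_ge0 ?invr_ge0// ltW.
  have -> : (b - a)^-1 * (phi x + (b - a) * psi x * dphi x) ^+ 2 =
     F' x + (b - a) * (psi x ^+ 2 * dphi x ^+ 2).
    by rewrite /F'; field; rewrite gt_eqF.
  move=> /le_trans; apply; rewrite lerD2l.
  rewrite [leRHS](_ : _ = (b - a) * (4 * dphi x ^+ 2)); last by ring.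
  rewrite ler_pM2l// ler_wpM2r ?sqr_ge0//.
  rewrite (_ : 4 = 2 ^+ 2); last by ring.
  rewrite ler_sqr ?nnegrE; lra.
Qed.

End onedim.

(** * Transport along affine paths in the plane *)

Section plane.
Variable R : realType.
Notation leb := (@lebesgue_measure R).
Implicit Types (w : R * R -> R).

(** The partial derivatives are data, so that slices of a function of three variables fit without
    choosing derivatives. Only coordinate lines occur here; [is_derive_plane] recovers the chain
    rule along curves. *)
Definition C1_plane w (d1 d2 : R * R -> R) : Prop :=
  [/\ continuous w, continuous d1, continuous d2,
      forall y : R * R, is_derive y.1 (1 : R) (fun t => w (t, y.2)) (d1 y) &
      forall y : R * R, is_derive y.2 (1 : R) (fun t => w (y.1, t)) (d2 y)].

Lemma MVT_abs (f df : R -> R) (a b : R) :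
  (forall x : R, is_derive x (1 : R) f (df x)) ->
  exists2 c, `|c - a| <= `|b - a| & f b - f a = df c * (b - a).
Proof.
move=> dfx.
have cf (x : R) : {for x, continuous f}.
  by have := dfx x => ?; apply/differentiable_continuous/derivable1_diffP.
have [ab|ba] := leP a b.
  have [|c + fE] := @MVT_segment _ f df a b ab (fun x _ => dfx x).
    exact: continuous_subspaceT.
  rewrite in_itv/= => /andP[ac cb]; exists c => //.
  by rewrite !ger0_norm ?subr_ge0//; lra.
have [|c + fE] := @MVT_segment _ f df b a (ltW ba) (fun x _ => dfx x).
  exact: continuous_subspaceT.
rewrite in_itv/= => /andP[bc ca].
exists c; last by rewrite -opprB fE -mulrN opprB.
by rewrite !ler0_norm; lra.
Qed.

(** The increment is split at (a t, b s). Its horizontal part is [d1] at a mean value point xi s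
    times a s - a t, and xi s tends to a t because |xi s - a t| <= |a s - a t|. Caratheodory's
    criterion asks for continuity of the slope at t only, so the arbitrary choice of xi elsewhere
    does no harm. *)
Lemma is_derive_plane w (d1 d2 : R * R -> R) (a b : R -> R) (t da db : R) :
  C1_plane w d1 d2 ->
  is_derive t (1 : R) a da -> is_derive t (1 : R) b db ->
  is_derive t (1 : R) (fun s => w (a s, b s))
    (d1 (a t, b t) * da + d2 (a t, b t) * db).
Proof.
move=> [cw cd1 cd2 dw1 dw2] dat dbt.
have ca : {for t, continuous a}.
  exact/differentiable_continuous/derivable1_diffP.
have cb : {for t, continuous b}.
  exact/differentiable_continuous/derivable1_diffP.
have xiP s : {xi | `|xi - a t| <= `|a s - a t| &
    w (a s, b s) - w (a t, b s) = d1 (xi, b s) * (a s - a t)}.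
  apply: cid2.
  exact: (@MVT_abs (fun x => w (x, b s)) (fun x => d1 (x, b s)) (a t) (a s)
    (fun x => dw1 (x, b s))).
pose xi s := s2val (xiP s).
have xi1 s : `|xi s - a t| <= `|a s - a t| by rewrite /xi; case: (xiP s).
have xi2 s : w (a s, b s) - w (a t, b s) = d1 (xi s, b s) * (a s - a t).
  by rewrite /xi; case: (xiP s).
have [ga [gaE cga gat]] := (is_derive1_caratheodory a t da).1 dat.
have dbw : is_derive t (1 : R) (fun s => w (a t, b s)) (d2 (a t, b t) * db).
  have dw2t := dw2 (a t, b t).
  exact: (is_derive1_comp (f := fun x => w (a t, x))).
have [gb [gbE cgb gbt]] := (is_derive1_caratheodory _ t _).1 dbw.
have xit : xi t = a t.
  by apply/eqP; rewrite -subr_eq0 -normr_le0 (le_trans (xi1 t))// subrr normr0.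
apply/is_derive1_caratheodory.
exists (fun s => d1 (xi s, b s) * ga s + gb s); split.
- move=> z; rewrite mulrDl -gbE -mulrA -gaE -xi2; ring.
- apply: ctsD => //; apply: ctsM => //.
  have cxi : continuous_at t xi.
    rewrite /continuous_at xit; apply/cvgrPdist_le => e e0.
    have /cvgrPdist_le/(_ e e0) := ca.
    by apply: filterS => s; rewrite distrC => /(le_trans (xi1 s)); rewrite distrC.
  apply: (@continuous_comp _ _ _ (fun s => (xi s, b s)) d1); last exact: cd1.
  exact: ctsP.
- by rewrite gat gbt xit.
Qed.

Lemma integral_indic_mul d (T : measurableType d)
    (mu : {measure set T -> \bar R}) (D : set T) (f : T -> R) :
  measurable D ->
  (\int[mu]_(x in D) (f x)%:E = \int[mu]_x (f x * \1_D x)%:E)%E.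
Proof.
move=> mD; rewrite integral_mkcond; apply: eq_integral => x _.
by rewrite /patch indicE; case: (x \in D); rewrite ?mulr1 ?mulr0.
Qed.

End plane.

Section transport.
Variable R : realType.
Notation leb := (@lebesgue_measure R).
Local Open Scope ereal_scope.

Lemma aff_measurable (al b1 b2 : R -> R) :
  continuous al -> continuous b1 -> continuous b2 ->
  measurable_fun (setT : set (meas3 R))
    ((fun x => aff (al x.2) (b1 x.2, b2 x.2) x.1) : meas3 R -> meas2 R).
Proof.
move=> ca cb1 cb2.
have c2 (f : R -> R) : continuous f ->
    continuous (fun x : R * R * R => f x.2).
  by move=> cf x; apply: (@continuous_comp _ _ _ snd f); [exact: cvg_snd|exact: cf].
have c1 (f : R * R -> R) : continuous f ->
    continuous (fun x : R * R * R => f x.1).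
  by move=> cf x; apply: (@continuous_comp _ _ _ fst f); [exact: cvg_fst|exact: cf].
apply: measurable_fun_pair; apply: (@continuous_measurable3 R) => /= x.
  apply: ctsD; last exact: c2.
  apply: ctsM; first exact: c2.
  by apply: (c1 fst) => y; exact: cvg_fst.
apply: ctsD; last exact: c2.
apply: ctsM; first exact: c2.
by apply: (c1 snd) => y; exact: cvg_snd.
Qed.

Lemma sqr_dot_le (a b c d : R) :
  ((a * c + b * d) ^+ 2 <= (a ^+ 2 + b ^+ 2) * (c ^+ 2 + d ^+ 2))%R.
Proof.
rewrite -subr_ge0.
have -> : ((a ^+ 2 + b ^+ 2) * (c ^+ 2 + d ^+ 2) - (a * c + b * d) ^+ 2 =
  (a * d - b * c) ^+ 2)%R by ring.
exact: sqr_ge0.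
Qed.

Definition sqgrad (d1 d2 : R * R -> R) (y : R * R) : R :=
  (d1 y ^+ 2 + d2 y ^+ 2)%R.

Lemma sqgrad_ge0 d1 d2 y : (0 <= sqgrad d1 d2 y)%R.
Proof. by rewrite addr_ge0// sqr_ge0. Qed.

Lemma sqgrad_measurable d1 d2 : continuous d1 -> continuous d2 ->
  measurable_fun (setT : set (meas2 R)) (sqgrad d1 d2 : meas2 R -> R).
Proof.
move=> cd1 cd2; apply: continuous_measurable2 => y.
by apply: ctsD; apply: continuous_sqr; [exact: cd1|exact: cd2].
Qed.

(* Cauchy-Schwarz along the paths t |-> al t * y + b t, whose squared speed is at
   most M * al t ^+ 2, then the change of variables from y to the point of the
   path at each fixed time, with Jacobian al t ^+ 2. *)
Lemma le_transport (w d1 d2 : R * R -> R) (al b1 b2 dal db1 db2 : R -> R) (T M : R)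
    (A B U : set (meas2 R)) :
  C1_plane w d1 d2 -> (0 <= T)%R -> (0 <= M)%R ->
  (forall t : R, is_derive t (1%R : R) al (dal t)) ->
  (forall t : R, is_derive t (1%R : R) b1 (db1 t)) ->
  (forall t : R, is_derive t (1%R : R) b2 (db2 t)) ->
  continuous dal -> continuous db1 -> continuous db2 ->
  (forall t, 0 < al t)%R ->
  (al 0 = 1)%R -> (b1 0 = 0)%R -> (b2 0 = 0)%R ->
  measurable A -> measurable B -> measurable U ->
  (forall y t, A y -> (0 <= t <= T)%R -> U (aff (al t) (b1 t, b2 t) y)) ->
  (forall y, A y -> B (aff (al T) (b1 T, b2 T) y)) ->
  (forall y t, A y -> (0 <= t <= T)%R ->
    ((dal t * y.1 + db1 t) ^+ 2 + (dal t * y.2 + db2 t) ^+ 2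
       <= M * al t ^+ 2)%R) ->
  \int[leb2 R]_(y in A) (w y ^+ 2)%:E <=
  (2 * al T ^- 2)%:E * \int[leb2 R]_(y in B) (w y ^+ 2)%:E +
  (4 * T ^+ 2 * M)%:E * \int[leb2 R]_(y in U) (sqgrad d1 d2 y)%:E.
Proof.
move=> C1w T0 M0 dal_ db1_ db2_ cdal cdb1 cdb2 al0 al01 b10 b20 mA mB mU AU AB
  speed.
have [cw cd1 cd2 _ _] := C1w.
have cts (f df : R -> R) : (forall t : R, is_derive t (1%R : R) f (df t)) ->
    continuous f.
  by move=> d x; have := d x => ?; apply/differentiable_continuous/derivable1_diffP.
have cal := cts _ _ dal_; have cb1 := cts _ _ db1_; have cb2 := cts _ _ db2_.
pose g t := aff (al t) (b1 t, b2 t).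
pose gr := sqgrad d1 d2.
have mgr : measurable_fun setT (gr : meas2 R -> R) by exact: sqgrad_measurable.
have mw2 : measurable_fun setT ((fun y => w y ^+ 2)%R : meas2 R -> R).
  apply: continuous_measurable2 => y; apply: continuous_sqr; exact: cw.
have mw2B : measurable_fun setT (fun y : meas2 R => (w y ^+ 2 * \1_B y)%:E).
  by apply/measurable_EFinP; apply: measurable_funM => //; exact: measurable_indic.
have mgrU : measurable_fun setT (fun y : meas2 R => (gr y * \1_U y)%:E).
  by apply/measurable_EFinP; apply: measurable_funM => //; exact: measurable_indic.
have indge0 (X : set (meas2 R)) (f : R * R -> R) : (forall y, 0 <= f y)%R ->
    forall y, 0 <= (f y * \1_X y)%:E.
  by move=> f0 y; rewrite lee_fin mulr_ge0// indicE.
pose I := `[0%R, T]%classic : set (measurableTypeR R).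
have mI : measurable I by exact: measurable_itv.
(* The speed bound M al^2 supplies exactly the Jacobian al^2: after Tonelli, the integral of h(., t)
   over the plane is 4 T M times the gradient integral over U, for every t in [0, T]. *)
pose h (x : meas3 R) : \bar R :=
  (4 * T * M * al x.2 ^+ 2 * \1_I x.2)%:E * (gr (g x.2 x.1) * \1_U (g x.2 x.1))%:E.
have h0 x : 0 <= h x.
  rewrite /h mule_ge0// ?indge0//; last by move=> y; exact: sqgrad_ge0.
  by rewrite lee_fin mulr_ge0 ?indicE// mulr_ge0 ?sqr_ge0// mulr_ge0// mulr_ge0.
have mg := aff_measurable cal cb1 cb2.
have mh : measurable_fun setT h.
  apply: emeasurable_funM.
    apply/measurable_EFinP; apply: measurable_funM; last first.
      apply: (@measurableT_comp _ _ _ _ _ _ (\1_I : _ -> R)).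
        exact: measurable_indic.
      exact: measurable_snd.
    apply: (@continuous_measurable3 R) => x; apply: ctsM; first exact: ctsK.
    apply: continuous_sqr.
    by apply: (@continuous_comp _ _ _ snd al); [exact: cvg_snd|exact: cal].
  exact: (measurableT_comp mgrU mg).
have pointwise y : A y ->
    (w y ^+ 2)%:E <= (2 * w (g T y) ^+ 2)%:E + \int[leb]_t h (y, t).
  move=> Ay.
  pose phi t := w (g t y).
  pose dphi t := (d1 (g t y) * (dal t * y.1 + db1 t) +
    d2 (g t y) * (dal t * y.2 + db2 t))%R.
  have dphiE (t : R) : is_derive t (1%R : R) phi (dphi t).
    have da1 := dal_ t; have da2 := db1_ t; have da3 := db2_ t.
    apply: (is_derive_plane C1w).
      by apply: is_derive_eq; rewrite /GRing.scale/=; ring.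
    by apply: is_derive_eq; rewrite /GRing.scale/=; ring.
  have cg t : continuous_at t (fun t => g t y).
    apply: ctsP; apply: ctsD => //; apply: ctsM => //; exact: ctsK.
  have cdphi : continuous dphi.
    move=> t; apply: ctsD; apply: ctsM.
    - by apply: (@continuous_comp _ _ _ (fun t => g t y) d1); [exact: cg|exact: cd1].
    - by apply: ctsD => //; apply: ctsM => //; exact: ctsK.
    - by apply: (@continuous_comp _ _ _ (fun t => g t y) d2); [exact: cg|exact: cd2].
    - by apply: ctsD => //; apply: ctsM => //; exact: ctsK.
  have := sqr_le_end T0 dphiE cdphi.
  rewrite {1}/phi /g /aff al01 b10 b20 !mul1r !addr0 -surjective_pairing subr0.
  move=> /le_trans; apply; rewrite leeD2l// (integral_indic_mul _ _ mI).
  apply: ge0_le_integral => //.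
  - by move=> t _; rewrite lee_fin mulr_ge0 ?indicE// mulr_ge0 ?sqr_ge0// mulr_ge0.
  - apply/measurable_EFinP; apply: measurable_funM; last exact: measurable_indic.
    apply: continuous_measurable_fun => t; apply: ctsM; first exact: ctsK.
    by apply: continuous_sqr; exact: cdphi.
  - exact: (measurable_fun_pair2 y mh).
  - move=> t _; rewrite /h/= -EFinM lee_fin.
    have [It|It] := pselect (I t); last first.
      by rewrite [in leRHS]indicE [in leLHS]indicE memNset// !mulr0 mul0r.
    have tT : (0 <= t <= T)%R by move: It; rewrite /I/= in_itv.
    rewrite !indicE (mem_set It) !mulr1 mem_set ?mulr1; last exact: AU.
    rewrite -!mulrA ler_pM2l//.
    rewrite ler_wpM2l//.
    apply: (le_trans (sqr_dot_le _ _ _ _)); rewrite [leLHS]mulrC.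
    rewrite [leRHS](_ : _ = M * al t ^+ 2 * gr (g t y))%R; last by ring.
    by apply: ler_wpM2r; [exact: sqgrad_ge0|exact: speed].
have mgT : measurable_fun setT (g T : meas2 R -> meas2 R).
  exact: (measurable_fun_pair1 T mg).
have intE (X : set (meas2 R)) (f : R * R -> R) (t : R) :
    measurable_fun setT (fun y : meas2 R => (f y * \1_X y)%:E) ->
    measurable X -> (forall y, 0 <= f y)%R ->
    (al t ^+ 2)%:E * \int[leb2 R]_y (f (g t y) * \1_X (g t y))%:E =
    \int[leb2 R]_(y in X) (f y)%:E.
  move=> mf mX f0; rewrite (integral_indic_mul _ _ mX).
  by rewrite -(ge0_integral2_affine (b1 t, b2 t) (al0 t) mf (indge0 X f f0)).
have mhA : measurable_fun setT (fun y => \int[leb]_t h (y, t)).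
  have := @measurable_fun_fubini_tonelli_F _ _ _ _ _ leb _ mh (fun=> h0 _).
  exact.
have mwT : measurable_fun setT
    (fun y : meas2 R => (2 * (w (g T y) ^+ 2 * \1_B (g T y)))%:E).
  apply/measurable_EFinP; apply: measurable_funM => //.
  apply/measurable_EFinP; exact: (measurableT_comp mw2B mgT).
apply: (@le_trans _ _ (\int[leb2 R]_y
    ((2 * (w (g T y) ^+ 2 * \1_B (g T y)))%:E + \int[leb]_t h (y, t))%E)).
  rewrite integral_indic_mul//; apply: ge0_le_integral => //.
  - by move=> y _; apply: (indge0 A (fun y => w y ^+ 2)%R) => z; exact: sqr_ge0.
  - by apply/measurable_EFinP; apply: measurable_funM => //.
  - exact: emeasurable_funD.
  - move=> y _; have [Ay|Ay] := pselect (A y); last first.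
      rewrite indicE memNset// mulr0 adde_ge0//.
        by rewrite lee_fin mulr_ge0// mulr_ge0 ?indicE// sqr_ge0.
      exact: integral_ge0.
    rewrite indicE mem_set// mulr1 indicE mem_set ?mulr1; last exact: AB.
    exact: pointwise.
rewrite ge0_integralD//; last 2 first.
- by move=> y _; rewrite lee_fin mulr_ge0// mulr_ge0 ?indicE// sqr_ge0.
- by move=> y _; exact: integral_ge0.
apply: leeD.
  rewrite -(intE B (fun y => w y ^+ 2)%R T)//; last by move=> y; exact: sqr_ge0.
  rewrite muleA -EFinM divfK ?gt_eqF ?exprn_gt0// -ge0_integralZl//.
  - exact: (measurableT_comp mw2B mgT).
  - by move=> y _; apply: (indge0 _ (fun y => w y ^+ 2)%R) => z; exact: sqr_ge0.
rewrite (@fubini_tonelli _ _ _ _ _ _ _ h)//.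
have gr0 y : (0 <= gr y)%R by exact: sqgrad_ge0.
have -> : \int[leb]_t \int[leb2 R]_y h (y, t) =
    \int[leb]_t ((4 * T * M * \1_I t)%:E * \int[leb2 R]_(y in U) (gr y)%:E).
  apply: eq_integral => t _; rewrite -(intE U gr t)//.
  have mgt : measurable_fun setT (g t : meas2 R -> meas2 R).
    exact: (measurable_fun_pair1 t mg).
  rewrite /h/= ge0_integralZl//.
  - by rewrite muleA -EFinM; congr (_%:E * _); rewrite /=; ring.
  - exact: (measurableT_comp mgrU mgt).
  - by move=> y _; exact: (indge0 U gr).
  - by rewrite lee_fin mulr_ge0 ?indicE// mulr_ge0 ?sqr_ge0// mulr_ge0// mulr_ge0.
rewrite ge0_integralZr//; last 3 first.
- apply/measurable_EFinP; apply: measurable_funM => //; exact: measurable_indic.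
- by move=> t _; rewrite lee_fin mulr_ge0 ?indicE// mulr_ge0// mulr_ge0.
- by apply: integral_ge0 => y _; rewrite lee_fin.
(* The length of the time interval gives the second factor T of 4 T^2 M. *)
rewrite -(integral_indic_mul _ (fun=> 4 * T * M)%R mI) integral_cst//.
rewrite /I/= lebesgue_measure_itv/= lte_fin; apply: lee_wpmul2r.
  by apply: integral_ge0 => y _; rewrite lee_fin.
case: ifPn => [_|]; last first.
  by rewrite mule0 lee_fin mulr_ge0// mulr_ge0// sqr_ge0.
by rewrite oppr0 adde0 -EFinM lee_fin expr2 mulrAC mulrA.
Qed.

End transport.

Section dilation.
Variable R : realType.
Notation leb := (@lebesgue_measure R).

Lemma sqr_le_bound (a r : R) : `|a| <= r -> a ^+ 2 <= r ^+ 2.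
Proof.
move=> ar; rewrite -[a ^+ 2]real_normK ?num_real// ler_sqr ?nnegrE//.
exact: le_trans ar.
Qed.

(** The norm on the product is the sup norm, so this is a closed square of half-side rho, that is, a
    product of intervals. *)
Definition sq (p : R * R) (rho : R) : set (R * R) :=
  [set y | `|y - p| <= rho].

Lemma sqP p rho y :
  sq p rho y <-> `|y.1 - p.1| <= rho /\ `|y.2 - p.2| <= rho.
Proof.
rewrite /sq/= prod_normE ge_max; split=> [/andP[]//|[? ?]].
exact/andP.
Qed.

Lemma dist_continuous (p : R * R) : continuous (fun y : R * R => `|y - p|).
Proof.
by move=> y; apply: cvg_norm; apply: cvgB; [exact: cvg_id|exact: cvg_cst].
Qed.

Lemma sq_closed p rho : closed (sq p rho).
Proof.
apply: (@closed_comp _ _ (fun y : R * R => `|y - p|) [set z | z <= rho]).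
  by move=> y _; exact: dist_continuous.
exact: closed_le.
Qed.

Lemma sq_measurable p rho : measurable (sq p rho : set (meas2 R)).
Proof. by apply: closed_measurable2; exact: sq_closed. Qed.

Lemma is_derive_expRN (t : R) :
  is_derive t (1 : R) (fun s => expR (- s)) (- expR (- t)).
Proof. by apply: is_derive_eq; rewrite /GRing.scale/= mulrN1. Qed.

Lemma continuous_expRN : continuous (fun s : R => expR (- s)).
Proof.
move=> t; have := is_derive_expRN t => ?.
exact/differentiable_continuous/derivable1_diffP.
Qed.

Definition dil (p : R * R) (t : R) : R * R -> R * R :=
  aff (expR (- t)) ((1 - expR (- t)) * p.1, (1 - expR (- t)) * p.2).

Lemma dilE p t y : dil p t y - p = expR (- t) *: (y - p).
Proof.
apply: injective_projections; rewrite /dil /aff /= /GRing.scale/=; ring.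
Qed.

Lemma sq_dil p t rho y :
  sq p (expR (- t) * rho) (dil p t y) <-> sq p rho y.
Proof.
by rewrite /sq/= dilE normrZ ger0_norm ?expR_ge0// ler_pM2l ?expR_gt0.
Qed.

Lemma le_translate (w d1 d2 : R * R -> R) (tau : R * R)
    (A B U : set (meas2 R)) : C1_plane w d1 d2 ->
  measurable A -> measurable B -> measurable U ->
  (forall y t, A y -> 0 <= t <= 1 -> U (y.1 + t * tau.1, y.2 + t * tau.2)) ->
  (forall y, A y -> B (y.1 + tau.1, y.2 + tau.2)) ->
  (\int[leb2 R]_(y in A) (w y ^+ 2)%:E <=
   2%:E * \int[leb2 R]_(y in B) (w y ^+ 2)%:E +
   (4 * (tau.1 ^+ 2 + tau.2 ^+ 2))%:E *
     \int[leb2 R]_(y in U) (sqgrad d1 d2 y)%:E)%E.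
Proof.
move=> C1w mA mB mU AU AB.
have := @le_transport R w d1 d2 (fun=> 1) (fun t => t * tau.1)
  (fun t => t * tau.2) (fun=> 0) (fun=> tau.1) (fun=> tau.2) 1
  (tau.1 ^+ 2 + tau.2 ^+ 2) A B U C1w ler01.
rewrite !expr1n invr1 !mulr1; apply => //.
- by rewrite addr_ge0// sqr_ge0.
- by move=> t; apply: is_derive_eq; rewrite /GRing.scale/=; ring.
- by move=> t; apply: is_derive_eq; rewrite /GRing.scale/=; ring.
- by move=> t; exact: cvg_cst.
- by move=> t; exact: cvg_cst.
- by move=> t; exact: cvg_cst.
- by rewrite mul0r.
- by rewrite mul0r.
- by move=> y t Ay tT; rewrite /aff/= !mul1r; exact: AU.
- by move=> y Ay; rewrite /aff/= !mul1r; exact: AB.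
- by move=> y t _ _; rewrite !mul0r !add0r.
Qed.

(** The dilation path of y has squared speed e^(-2t) times the squared Euclidean distance from y to
    p, at most 2 rho^2 e^(-2t) on the square; hence M = 2 rho^2 and 4 T^2 M = 8 (T rho)^2. *)
Lemma le_dilate (w d1 d2 : R * R -> R) p (rho T : R) : C1_plane w d1 d2 ->
  0 <= rho -> 0 <= T ->
  (\int[leb2 R]_(y in sq p rho) (w y ^+ 2)%:E <=
   (2 * expR T ^+ 2)%:E *
     \int[leb2 R]_(y in sq p (expR (- T) * rho)) (w y ^+ 2)%:E +
   (8 * (T * rho) ^+ 2)%:E *
     \int[leb2 R]_(y in sq p rho) (sqgrad d1 d2 y)%:E)%E.
Proof.
move=> C1w rho0 T0.
have sub t y : 0 <= t -> sq p rho y -> sq p rho (dil p t y).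
  move=> t0 /(sq_dil p t rho y).2 /le_trans; apply.
  by rewrite ler_piMl// -expR0 ler_expR oppr_le0.
have dbE (c t : R) : is_derive t (1 : R) (fun s => (1 - expR (- s)) * c)
    (expR (- t) * c).
  have := is_derive_expRN t => d1e.
  by apply: is_derive_eq; rewrite /GRing.scale/=; ring.
have cdb (c : R) : continuous (fun t => expR (- t) * c).
  by move=> t; apply: ctsM; [exact: continuous_expRN|exact: ctsK].
have := @le_transport R w d1 d2 (fun t => expR (- t))
  (fun t => (1 - expR (- t)) * p.1) (fun t => (1 - expR (- t)) * p.2)
  (fun t => - expR (- t)) (fun t => expR (- t) * p.1)
  (fun t => expR (- t) * p.2) T (2 * rho ^+ 2) (sq p rho)
  (sq p (expR (- T) * rho)) (sq p rho) C1w T0.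
rewrite (_ : 4 * T ^+ 2 * (2 * rho ^+ 2) = 8 * (T * rho) ^+ 2); last by ring.
rewrite -exprVn -expRN opprK; apply => //.
- by rewrite mulr_ge0// sqr_ge0.
- exact: is_derive_expRN.
- by move=> t; apply: ctsN; exact: continuous_expRN.
- by move=> t; exact: expR_gt0.
- by rewrite oppr0 expR0.
- by rewrite oppr0 expR0 subrr mul0r.
- by rewrite oppr0 expR0 subrr mul0r.
- exact: sq_measurable.
- exact: sq_measurable.
- exact: sq_measurable.
- by move=> y t Ay /andP[t0 _]; exact: sub.
- by move=> y Ay; exact/sq_dil.
- move=> y t /sqP[y1 y2] _.
  have {}y1 := sqr_le_bound y1; have {}y2 := sqr_le_bound y2.
  have -> : (- expR (- t) * y.1 + expR (- t) * p.1) ^+ 2 +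
     (- expR (- t) * y.2 + expR (- t) * p.2) ^+ 2 =
     ((y.1 - p.1) ^+ 2 + (y.2 - p.2) ^+ 2) * expR (- t) ^+ 2 by ring.
  by rewrite ler_wpM2r ?sqr_ge0//; lra.
Qed.

End dilation.

(** * The logarithmic Hardy inequality on a square *)

Section log_hardy.
Variable R : realType.
Notation leb := (@lebesgue_measure R).

(** Both inequalities come from [derive_le_integral], applied to e^(2t) / 2 and to its opposite. *)
Lemma integral_expR2 (tau : R) : 0 <= tau ->
  (\int[leb]_(t in `[0%R, tau]) (expR t ^+ 2)%:E =
   ((expR tau ^+ 2 - 1) / 2)%:E)%E.
Proof.
move=> tau0.
have dF (x : R) : is_derive x (1 : R) (fun t => expR t ^+ 2 / 2) (expR x ^+ 2).
  by apply: is_derive_eq; rewrite /GRing.scale/=; field.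
have cF : continuous (fun x : R => expR x ^+ 2).
  by move=> x; apply: continuous_sqr; exact: continuous_expR.
have := @derive_le_integral R (fun t => expR t ^+ 2 / 2) (fun t => expR t ^+ 2)
  (fun t => expR t ^+ 2) (fun=> 0) 0 tau tau0.
have := @derive_le_integral R (fun t => - (expR t ^+ 2 / 2))
  (fun t => - expR t ^+ 2) (fun=> 0) (fun t => expR t ^+ 2) 0 tau tau0.
rewrite integral0_eq// !adde0 => H1 H2.
apply/eqP; rewrite eq_le; apply/andP; split.
  have {H1 H2} : ((expR 0 ^+ 2 / 2)%:E +
      \int[leb]_(t in `[0%R, tau]) (expR t ^+ 2)%:E <= (expR tau ^+ 2 / 2)%:E)%E.
    apply: H2 => //.
    - by move=> x _; exact: cvg_cst.
    - by move=> x _; rewrite addr0.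
  move=> /(leeD2l (- (expR 0 ^+ 2 / 2))%:E); rewrite addeA -EFinD addNr add0e.
  by move=> /le_trans; apply; rewrite -EFinD lee_fin expR0 expr1n; lra.
have {H1 H2} : ((- (expR 0 ^+ 2 / 2))%:E <= (- (expR tau ^+ 2 / 2))%:E +
    \int[leb]_(t in `[0%R, tau]) (expR t ^+ 2)%:E)%E.
  apply: H1 => //.
  - move=> x _; have := dF x => dFx.
    exact: (is_deriveN (f := fun t => expR t ^+ 2 / 2)).
  - by move=> x _; apply: ctsN; exact: cF.
  - by move=> x _; exact: cvg_cst.
  - by move=> x _; rewrite addNr.
move=> /(leeD2l (expR tau ^+ 2 / 2)%:E); rewrite addeA -!EFinD subrr add0e.
by apply: le_trans; rewrite lee_fin expR0 expr1n; lra.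
Qed.

Lemma sq_dil_measurable p (rho : R) :
  measurable ([set x | sq p (expR (- x.2) * rho) x.1] : set (meas3 R)).
Proof.
apply: closed_measurable3.
have -> : [set x | sq p (expR (- x.2) * rho) x.1] =
    (fun x : R * R * R => expR (- x.2) * rho - `|x.1 - p|) @^-1` [set z | 0 <= z].
  by apply/seteqP; split=> x /=; rewrite subr_ge0.
apply: closed_comp => [x _|]; last exact: closed_ge.
apply: ctsD; last first.
  apply: ctsN; apply: cvg_norm.
  by apply: cvgB; [exact: cvg_fst|exact: cvg_cst].
apply: ctsM; last exact: ctsK.
apply: (@continuous_comp _ _ _ snd (fun t => expR (- t))); first exact: cvg_snd.
exact: continuous_expRN.
Qed.

Lemma measurable_indic_sq_dil p (rho : R) :
  measurable_fun (setT : set (meas3 R))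
    (fun x : meas3 R => \1_(sq p (expR (- x.2) * rho)) x.1 : R).
Proof.
rewrite (_ : (fun x => _) = \1_[set x | sq p (expR (- x.2) * rho) x.1]).
  by apply: measurable_indic; exact: sq_dil_measurable.
by apply/funext => x; rewrite !indicE.
Qed.

(** At fixed t the substitution x = [dil] p t y shrinks the square by e^(-t) and costs e^(2t);
    Tonelli is used before and after. On the right, x is fixed and the integral runs over the times
    at which a path started in the square can pass through x, namely e^t |x - p| <= rho. *)
Lemma dil_swap p (rho : R) (I : set (measurableTypeR R))
    (H : R * R * R -> \bar R) : measurable I ->
  measurable_fun (setT : set (meas3 R)) (H : meas3 R -> \bar R) ->
  (forall x, 0 <= H x)%E ->
  (\int[leb2 R]_y \int[leb]_t
     ((\1_I t * \1_(sq p rho) y)%:E * H (dil p t y, t)) =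
   \int[leb2 R]_x \int[leb]_t
     ((expR t ^+ 2 * (\1_I t * \1_(sq p (expR (- t) * rho)) x))%:E * H (x, t)))%E.
Proof.
move=> mI mH H0.
pose S : set (meas3 R) := [set x | sq p (expR (- x.2) * rho) x.1].
have mS : measurable S by exact: sq_dil_measurable.
pose K (x : meas3 R) : \bar R := ((\1_I x.2 * \1_S x)%:E * H x)%E.
have K0 x : (0 <= K x)%E by rewrite /K mule_ge0// lee_fin mulr_ge0// indicE.
have mI2 : measurable_fun setT (fun x : meas3 R => \1_I x.2 : R).
  apply: (@measurableT_comp _ _ _ _ _ _ (\1_I : _ -> R)).
    exact: measurable_indic.
  exact: measurable_snd.
have mK : measurable_fun setT K.
  apply: emeasurable_funM => //; apply/measurable_EFinP.
  by apply: measurable_funM => //; exact: measurable_indic.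
have mdil : measurable_fun (setT : set (meas3 R))
    ((fun x => dil p x.2 x.1) : meas3 R -> meas2 R).
  apply: (@aff_measurable R (fun t => expR (- t))
    (fun t => (1 - expR (- t)) * p.1) (fun t => (1 - expR (- t)) * p.2)).
  - exact: continuous_expRN.
  - move=> t; apply: ctsM; last exact: ctsK.
    by apply: ctsD; [exact: ctsK|apply: ctsN; exact: continuous_expRN].
  - move=> t; apply: ctsM; last exact: ctsK.
    by apply: ctsD; [exact: ctsK|apply: ctsN; exact: continuous_expRN].
have mKd : measurable_fun (setT : set (meas3 R))
    (fun x : meas3 R => K (dil p x.2 x.1, x.2)).
  apply: (@measurableT_comp _ _ _ _ (meas3 R) _ K _
    (fun x : meas3 R => (dil p x.2 x.1, x.2) : meas3 R) mK).
  by apply: measurable_fun_pair => //; exact: measurable_snd.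
transitivity (\int[leb2 R]_y \int[leb]_t K (dil p t y, t))%E.
  apply: eq_integral => y _; apply: eq_integral => t _; rewrite /K/=.
  suff -> : \1_S (dil p t y, t) = \1_(sq p rho) y :> R by [].
  rewrite !indicE (_ : ((dil p t y, t) \in S) = (y \in sq p rho))//.
  by apply/idP/idP => /set_mem yS; apply/mem_set;
    exact/(sq_dil p t rho y).
transitivity (\int[leb]_t \int[leb2 R]_y K (dil p t y, t))%E.
  exact: (@fubini_tonelli _ _ _ _ _ (leb2 R) leb
    (fun x : meas3 R => K (dil p x.2 x.1, x.2)) mKd (fun=> K0 _)).
have mKe : measurable_fun setT
    (fun x : meas3 R => ((expR x.2 ^+ 2)%:E * K x)%E).
  apply: emeasurable_funM => //; apply/measurable_EFinP.
  apply: (@continuous_measurable3 R) => x; apply: continuous_sqr.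
  by apply: (@continuous_comp _ _ _ snd expR); [exact: cvg_snd|exact: continuous_expR].
transitivity (\int[leb]_t \int[leb2 R]_x ((expR t ^+ 2)%:E * K (x, t)))%E.
  apply: eq_integral => t _.
  have mKt : measurable_fun setT (fun y : meas2 R => K (y, t)).
    exact: measurable_fun_pair1.
  rewrite ge0_integralZl//.
  rewrite (ge0_integral2_affine ((1 - expR (- t)) * p.1, (1 - expR (- t)) * p.2)
    (expR_gt0 (- t)) mKt)// muleA -EFinM -exprMn -expRD subrr expR0 expr1n mul1e.
  by [].
have Ke0 (x : meas3 R) : (0 <= (expR x.2 ^+ 2)%:E * K x)%E.
  by rewrite mule_ge0// lee_fin sqr_ge0.
transitivity (\int[leb2 R]_x \int[leb]_t ((expR t ^+ 2)%:E * K (x, t)))%E.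
  by rewrite (@fubini_tonelli _ _ _ _ _ (leb2 R) leb _ mKe Ke0).
by apply: eq_integral => x _; apply: eq_integral => t _; rewrite /K/= muleA -EFinM.
Qed.

End log_hardy.

Section log_hardy_sq.
Variable R : realType.
Notation leb := (@lebesgue_measure R).

(** The inverse is seen as the power -1 of [powR], with which it agrees on nonnegative numbers, 0
    included. *)
Lemma measurable_fun_inv d (T : measurableType d) (D : set T) (f : T -> R) :
  measurable D -> measurable_fun D f -> (forall x, D x -> 0 <= f x) ->
  measurable_fun D (fun x => (f x)^-1).
Proof.
move=> mD mf f0.
apply: (@eq_measurable_fun _ _ _ _ D (fun x => f x `^ (- 1))).
  by move=> x /[!inE] Dx; rewrite powR_inv1// f0.
by apply: (@measurableT_comp _ _ _ _ _ _ (fun z : R => z `^ (- 1))) => //;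
  exact: measurable_powR.
Qed.

Lemma indic_le1 (T : Type) (A : set T) (x : T) : \1_A x <= 1 :> R.
Proof. by rewrite indicE; case: (x \in A). Qed.

Lemma measurable_sqr_expR :
  measurable_fun (setT : set (measurableTypeR R)) (fun t => expR t ^+ 2 : R).
Proof.
apply: continuous_measurable_fun => t; apply: continuous_sqr.
exact: continuous_expR.
Qed.

(* On [0, ln (rho / |x - p|)] the integral of expR t ^+ 2 is at most
   rho ^+ 2 / (2 |x - p| ^+ 2), which cancels the squared speed of the dilation. *)
Lemma log_hardy_upper p (rho : R) (I : set (measurableTypeR R)) (g : R)
    (x : R * R) : measurable I -> (forall t, I t -> 0 <= t) -> 0 <= rho ->
  0 <= g ->
  (\int[leb]_t
     ((expR t ^+ 2 * (\1_I t * \1_(sq p (expR (- t) * rho)) x))%:E *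
      (4 * ((x.1 - p.1) ^+ 2 + (x.2 - p.2) ^+ 2) * g)%:E) <=
   (4 * rho ^+ 2 * (g * \1_(sq p rho) x))%:E)%E.
Proof.
move=> mI I0 rho0 g0; set d := `|x - p|.
(* At the centre ln (rho / d) is meaningless, but there the squared speed factor vanishes. *)
have [d0|d0] := eqVneq d 0.
  have -> : (x.1 - p.1) ^+ 2 + (x.2 - p.2) ^+ 2 = 0.
    by move/eqP: d0; rewrite normr_eq0 => /eqP[-> ->]/=; rewrite expr0n/= addr0.
  rewrite integral0_eq ?lee_fin => [|t _]; last by rewrite mulr0 mul0r mule0.
  by rewrite mulr_ge0 ?(mulr_ge0 g0)// mulr_ge0// sqr_ge0.
have {}d0 : 0 < d by rewrite lt0r d0 normr_ge0.
have dxE : (x.1 - p.1) ^+ 2 + (x.2 - p.2) ^+ 2 <= 2 * d ^+ 2.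
  have [/sqr_le_bound ? /sqr_le_bound ?] := (sqP p d x).1 (lexx _); lra.
have [drho|drho] := leP d rho; last first.
  rewrite integral0_eq ?lee_fin => [|t _].
    by rewrite mulr_ge0 ?(mulr_ge0 g0)// mulr_ge0// sqr_ge0.
  have [It|It] := pselect (I t); last first.
    by rewrite [\1_I t]indicE memNset// mul0r mulr0 mul0e.
  rewrite [\1_(sq _ _) x]indicE memNset ?mulr0 ?mul0e// => xs.
  move: drho; rewrite ltNge => /negP; apply; apply: le_trans xs _.
  by rewrite ler_piMl// -expR0 ler_expR oppr_le0 I0.
have rho_gt0 : 0 < rho by exact: lt_le_trans drho.
pose tau := ln (rho / d).
have tauE : expR tau = rho / d by rewrite lnK// posrE divr_gt0.
have tau0 : 0 <= tau by rewrite ln_ge0// ler_pdivlMr// mul1r.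
have g4 : 0 <= 4 * ((x.1 - p.1) ^+ 2 + (x.2 - p.2) ^+ 2) * g.
  by rewrite mulr_ge0// mulr_ge0// addr_ge0// sqr_ge0.
apply: (@le_trans _ _ (\int[leb]_(t in `[0%R, tau]) ((expR t ^+ 2)%:E *
   (4 * ((x.1 - p.1) ^+ 2 + (x.2 - p.2) ^+ 2) * g)%:E)))%E.
  rewrite [leRHS]integral_mkcond; apply: ge0_le_integral => //.
  - by move=> t _; apply: mule_ge0; rewrite lee_fin.
  - apply: emeasurable_funM => //; apply/measurable_EFinP.
    apply: measurable_funM; first exact: measurable_sqr_expR.
    by apply: measurable_funM;
      [exact: measurable_indic|
      exact: (measurable_fun_pair2 x (measurable_indic_sq_dil p rho))].
  - apply/(measurable_restrictT _ _).1 => //; apply: measurable_funTS.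
    apply: emeasurable_funM => //; apply/measurable_EFinP.
    exact: measurable_sqr_expR.
  - move=> t _; have [It|It] := pselect (I t); last first.
      rewrite [\1_I t]indicE memNset// mul0r mulr0 mul0e erestrict_ge0//.
      by move=> s _; rewrite mule_ge0 ?lee_fin// sqr_ge0.
    rewrite patchE; case: ifPn => [_|/negP tn].
      by rewrite lee_wpmul2r ?lee_fin// ler_piMr ?sqr_ge0// mulr_ile1 ?indic_le1.
    rewrite [\1_(sq _ _) x]indicE memNset ?mulr0 ?mul0e// => xs; apply: tn.
    rewrite mem_setE in_itv/= I0//= -ler_expR tauE ler_pdivlMr//.
    by rewrite mulrC -ler_pdivlMr ?expR_gt0// mulrC -expRN.
rewrite ge0_integralZr//; last first.
  by apply/measurable_EFinP; apply: measurable_funTS; exact: measurable_sqr_expR.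
rewrite integral_expR2// tauE -EFinM lee_fin indicE mem_set// mulr1.
apply: (@le_trans _ _ (((rho / d) ^+ 2 - 1) / 2 * (4 * (2 * d ^+ 2) * g))).
  rewrite ler_wpM2l//.
    rewrite divr_ge0// subr_ge0 exprn_ege1// ler_pdivlMr// mul1r//.
  by rewrite ler_wpM2r// ler_wpM2l.
rewrite (_ : _ * _ = 4 * (rho ^+ 2 - d ^+ 2) * g); last first.
  by field; rewrite gt_eqF.
by rewrite ler_wpM2r// ler_wpM2l// gerBl sqr_ge0.
Qed.

(* The integral of expR t ^+ 2 over [0, ln q] is (q ^+ 2 - 1) / 2, which is at
   least 3/8 q ^+ 2 for q = rho / |x - p| >= 2. *)
Lemma log_hardy_lower p (rho T v : R) (x : R * R) : 0 < rho ->
  expR (- T) * rho <= `|x - p| <= rho / 2 ->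
  ((3 / 8 * rho ^+ 2 *
    (`|x - p|^-1 * (1 + ln (rho / `|x - p|))^-1 * v) ^+ 2)%:E <=
  \int[leb]_t
     ((expR t ^+ 2 * (\1_(`[0%R, T]) t * \1_(sq p (expR (- t) * rho)) x))%:E *
      (((1 + `|t|)^-1 * v) ^+ 2)%:E))%E.
Proof.
move=> rho0; set d := `|x - p| => /andP[Td dr].
have d0 : 0 < d by rewrite (lt_le_trans _ Td)// mulr_gt0// expR_gt0.
pose tau := ln (rho / d).
have tauE : expR tau = rho / d by rewrite lnK// posrE divr_gt0.
have rd2 : 2 <= rho / d by rewrite ler_pdivlMr//; lra.
have tau0 : 0 <= tau by rewrite ln_ge0//; lra.
have tauT : tau <= T.
  rewrite -ler_expR tauE ler_pdivrMr//.
  by rewrite mulrC -ler_pdivrMr ?expR_gt0// mulrC -expRN.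
apply: (@le_trans _ _ (\int[leb]_(t in `[0%R, tau]) ((expR t ^+ 2)%:E *
   (((1 + tau)^-1 * v) ^+ 2)%:E)))%E.
  rewrite ge0_integralZr//; last 2 first.
  - by apply/measurable_EFinP; apply: measurable_funTS; exact: measurable_sqr_expR.
  - by rewrite lee_fin sqr_ge0.
  rewrite integral_expR2// tauE -EFinM lee_fin.
  rewrite [leLHS](_ : _ = 3 / 8 * (rho / d) ^+ 2 * ((1 + tau)^-1 * v) ^+ 2);
    last by rewrite /tau; field; rewrite gt_eqF//=; rewrite -/tau; lra.
  rewrite ler_wpM2r ?sqr_ge0//.
  have : 2 ^+ 2 <= (rho / d) ^+ 2 by rewrite ler_sqr ?nnegrE//; lra.
  lra.
rewrite [leLHS]integral_mkcond; apply: ge0_le_integral => //.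
- by move=> t _; apply: erestrict_ge0 => s _; rewrite mule_ge0 ?lee_fin// sqr_ge0.
- apply/(measurable_restrictT _ _).1 => //; apply: measurable_funTS.
  apply: emeasurable_funM => //; apply/measurable_EFinP.
  exact: measurable_sqr_expR.
- apply: emeasurable_funM.
    apply/measurable_EFinP.
    apply: measurable_funM; first exact: measurable_sqr_expR.
    by apply: measurable_funM;
      [exact: measurable_indic|
      exact: (measurable_fun_pair2 x (measurable_indic_sq_dil p rho))].
  apply/measurable_EFinP; apply: measurable_funX; apply: measurable_funM => //.
  apply: measurable_fun_inv => //.
  by apply: measurable_funD => //; exact: normr_measurable.
- move=> t _; rewrite patchE; case: ifPn => [|_]; last first.
    by rewrite mule_ge0 ?lee_fin ?sqr_ge0// mulr_ge0 ?sqr_ge0// mulr_ge0 ?indicE.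
  rewrite mem_setE in_itv/= => /andP[t0 tt].
  rewrite [\1_(`[_, _]) t]indicE mem_set ?mul1r; last first.
    by rewrite /= in_itv/= t0 (le_trans tt).
  rewrite indicE mem_set ?mulr1; last first.
    rewrite /sq/= -/d mulrC expRN ler_pdivlMr ?expR_gt0// mulrC.
    by rewrite -ler_pdivlMr// -tauE ler_expR.
  apply: lee_wpmul2l; first by rewrite lee_fin sqr_ge0.
  rewrite lee_fin !exprMn ler_wpM2r ?sqr_ge0// ler_sqr ?nnegrE ?invr_ge0 ?addr_ge0//.
  by rewrite lef_pV2 ?posrE ?ltr_wpDr ?addr_ge0// lerD2l ger0_norm.
Qed.

End log_hardy_sq.

Section log_hardy_plane.
Variable R : realType.
Notation leb := (@lebesgue_measure R).

(** The inner radius will be e^(-T) rho, as far as paths of duration T lead from the edge of the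
    square. The outer radius will be rho / 2, so that paths spend a definite time before reaching
    the annulus. *)
Definition annulus (p : R * R) (a b : R) : set (R * R) :=
  [set y | a <= `|y - p| <= b].

Lemma annulus_measurable p a b : measurable (annulus p a b : set (meas2 R)).
Proof.
apply: closed_measurable2.
have -> : annulus p a b = (fun y : R * R => `|y - p|) @^-1` [set z | a <= z]
    `&` (fun y : R * R => `|y - p|) @^-1` [set z | z <= b].
  by apply/seteqP; split => y /= => [/andP[]//|[? ?]]; exact/andP.
apply: closedI.
  by apply: closed_comp => [y _|]; [exact: dist_continuous|exact: closed_ge].
by apply: closed_comp => [y _|]; [exact: dist_continuous|exact: closed_le].
Qed.

Lemma dist_measurable p :
  measurable_fun (setT : set (meas2 R)) (fun y : meas2 R => `|(y : R * R) - p|).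
Proof. by apply: continuous_measurable2; exact: dist_continuous. Qed.

(** The weight of the logarithmic Hardy inequality normalized to a square of half-side rho: ln (rho
    / |y - p|) is the time in which a dilation path goes from the edge of the square to y. *)
Definition log_weight (p : R * R) (rho : R) (y : R * R) : R :=
  `|y - p|^-1 * (1 + ln (rho / `|y - p|))^-1.

Lemma log_weight_measurable p rho a : 0 < rho -> 0 < a ->
  measurable_fun (annulus p a (rho / 2) : set (meas2 R))
    (log_weight p rho : meas2 R -> R).
Proof.
move=> rho0 a0; have mE := annulus_measurable p a (rho / 2).
have md : measurable_fun (annulus p a (rho / 2) : set (meas2 R))
    (fun y : meas2 R => `|(y : R * R) - p|^-1).
  apply: measurable_fun_inv => //.
  by apply: measurable_funTS; exact: dist_measurable.
apply: measurable_funM => //; apply: measurable_fun_inv => //.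
  apply: measurable_funD => //.
  apply: (@measurableT_comp _ _ _ _ _ _ (@ln R)); first exact: measurable_ln.
  exact: measurable_funM.
move=> y /andP[ay yb]; have y0 := lt_le_trans a0 ay.
by rewrite addr_ge0// ln_ge0// ler_pdivlMr//; lra.
Qed.

(* [hardy_log] on the paths t |-> dil p t y, integrated over y in the square. *)
Lemma log_hardy_sq (w d1 d2 : R * R -> R) p (rho T : R) : C1_plane w d1 d2 ->
  0 < rho -> 0 <= T ->
  ((3 / 8 * rho ^+ 2)%:E *
     \int[leb2 R]_(y in annulus p (expR (- T) * rho) (rho / 2))
       ((log_weight p rho y * w y) ^+ 2)%:E <=
   2%:E * \int[leb2 R]_(y in sq p rho) (w y ^+ 2)%:E +
   (4 * rho ^+ 2)%:E * \int[leb2 R]_(y in sq p rho) (sqgrad d1 d2 y)%:E)%E.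
Proof.
move=> C1w rho0 T0; have [cw cd1 cd2 _ _] := C1w.
set A := annulus _ _ _.
have mA : measurable (A : set (meas2 R)) by exact: annulus_measurable.
have mQ : measurable (sq p rho : set (meas2 R)) by exact: sq_measurable.
pose I := `[0%R, T]%classic : set (measurableTypeR R).
have mI : measurable I by exact: measurable_itv.
have mlw : measurable_fun (A : set (meas2 R)) (log_weight p rho : meas2 R -> R).
  by apply: log_weight_measurable => //; rewrite mulr_gt0// expR_gt0.
have mw : measurable_fun setT (w : meas2 R -> R) by exact: continuous_measurable2.
have mgr : measurable_fun setT (sqgrad d1 d2 : meas2 R -> R).
  exact: sqgrad_measurable.
have mf1 (f : meas2 R -> R) : measurable_fun setT f ->
    measurable_fun (setT : set (meas3 R)) (fun x : meas3 R => f x.1).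
  by move=> mf; apply: (measurableT_comp mf); exact: measurable_fst.
have mf2 (f : measurableTypeR R -> R) : measurable_fun setT f ->
    measurable_fun (setT : set (meas3 R)) (fun x : meas3 R => f x.2).
  by move=> mf; apply: (measurableT_comp mf); exact: measurable_snd.
(* The absolute value makes the weight positive and measurable for all times; on [0, T] it is that
   of [hardy_log]. *)
pose H1 (x : meas3 R) : \bar R := (((1 + `|x.2|)^-1 * w x.1) ^+ 2)%:E.
pose H2 (x : meas3 R) : \bar R :=
  (4 * ((x.1.1 - p.1) ^+ 2 + (x.1.2 - p.2) ^+ 2) * sqgrad d1 d2 x.1)%:E.
have mH1 : measurable_fun setT H1.
  apply/measurable_EFinP; apply: measurable_funX; apply: measurable_funM;
    last exact: mf1.
  apply: (mf2 (fun t => (1 + `|t|)^-1)); apply: measurable_fun_inv => //.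
  by apply: measurable_funD => //; exact: normr_measurable.
have mH2 : measurable_fun setT H2.
  apply/measurable_EFinP; apply: measurable_funM; last exact: mf1.
  apply: measurable_funM => //; apply: (mf1 (fun y : meas2 R =>
    (y.1 - p.1) ^+ 2 + (y.2 - p.2) ^+ 2)).
  by apply: measurable_funD; apply: measurable_funX; apply: measurable_funB.
have H10 x : (0 <= H1 x)%E by rewrite lee_fin sqr_ge0.
have H20 x : (0 <= H2 x)%E.
  by rewrite lee_fin mulr_ge0 ?sqgrad_ge0// mulr_ge0// addr_ge0 ?sqr_ge0.
pose ind y t : \bar R := (\1_I t * \1_(sq p rho) y)%:E.
have ind0 y t : (0 <= ind y t)%E by rewrite lee_fin mulr_ge0 ?indicE.
have mind : measurable_fun (setT : set (meas3 R)) (fun x => ind x.1 x.2).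
  apply/measurable_EFinP; apply: measurable_funM.
    by apply: (mf2 (\1_I)); exact: measurable_indic.
  by apply: (mf1 (\1_(sq p rho))); exact: measurable_indic.
have mdil : measurable_fun (setT : set (meas3 R))
    ((fun x => dil p x.2 x.1) : meas3 R -> meas2 R).
  apply: (@aff_measurable R (fun t => expR (- t))
    (fun t => (1 - expR (- t)) * p.1) (fun t => (1 - expR (- t)) * p.2)).
  - exact: continuous_expRN.
  - move=> t; apply: ctsM; last exact: ctsK.
    by apply: ctsD; [exact: ctsK|apply: ctsN; exact: continuous_expRN].
  - move=> t; apply: ctsM; last exact: ctsK.
    by apply: ctsD; [exact: ctsK|apply: ctsN; exact: continuous_expRN].
have mHd (H : meas3 R -> \bar R) : measurable_fun setT H ->
    measurable_fun (setT : set (meas3 R))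
      (fun x : meas3 R => H (dil p x.2 x.1, x.2)).
  move=> mH; apply: (@measurableT_comp _ _ _ _ (meas3 R) _ H _
    (fun x : meas3 R => (dil p x.2 x.1, x.2) : meas3 R) mH).
  by apply: measurable_fun_pair => //; exact: measurable_snd.
have mK (K : meas3 R -> \bar R) : measurable_fun setT K ->
    (forall x, 0 <= K x)%E -> measurable_fun setT
    (fun y : meas2 R => \int[leb]_t K (y, t))%E.
  move=> mK K0; have := @measurable_fun_fubini_tonelli_F _ _ _ _ _ leb _ mK K0.
  exact.
have ptw y : (\int[leb]_t (ind y t * H1 (dil p t y, t)) <=
    (2 * (w y ^+ 2 * \1_(sq p rho) y))%:E
      + \int[leb]_t (ind y t * H2 (dil p t y, t)))%E.
  have intE H : (\int[leb]_t (ind y t * H t) =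
      (\1_(sq p rho) y)%:E * \int[leb]_(t in I) H t)%E.
    rewrite [in RHS]integral_mkcond /ind [\1_(sq p rho) y]indicE.
    case: (y \in sq p rho); last first.
      by rewrite mul0e integral0_eq// => t _; rewrite mulr0 mul0e.
    rewrite mul1e; apply: eq_integral => t _; rewrite patchE mulr1 indicE.
    by case: (t \in I); rewrite ?mul1e ?mul0e.
  rewrite !intE; have [Qy|Qy] := pselect (sq p rho y); last first.
    by rewrite !indicE memNset// mulr0 mulr0 !mul0e adde0.
  rewrite !indicE mem_set// mulr1 !mul1e.
  pose phi t := w (dil p t y).
  pose dphi t := d1 (dil p t y) * (- expR (- t) * y.1 + expR (- t) * p.1) +
    d2 (dil p t y) * (- expR (- t) * y.2 + expR (- t) * p.2).
  have dphiE (t : R) : is_derive t (1 : R) phi (dphi t).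
    have d3 := is_derive_expRN t.
    apply: (is_derive_plane C1w).
      by apply: is_derive_eq; rewrite /GRing.scale/=; ring.
    by apply: is_derive_eq; rewrite /GRing.scale/=; ring.
  have cE (c : R) (t : R) : continuous_at t (fun t => expR (- t) * c).
    by apply: ctsM; [exact: continuous_expRN|exact: ctsK].
  have cNE (c : R) (t : R) : continuous_at t (fun t => - expR (- t) * c).
    by apply: ctsM; [apply: ctsN; exact: continuous_expRN|exact: ctsK].
  have cg t : continuous_at t (fun t => dil p t y).
    apply: ctsP; (apply: ctsD; first exact: cE); (apply: ctsM; last exact: ctsK);
      by apply: ctsD; [exact: ctsK|apply: ctsN; exact: continuous_expRN].
  have cdphi : continuous dphi.
    move=> t; apply: ctsD; apply: ctsM.
    - by apply: (@continuous_comp _ _ _ (fun t => dil p t y) d1);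
        [exact: cg|exact: cd1].
    - by apply: ctsD; [exact: cNE|exact: cE].
    - by apply: (@continuous_comp _ _ _ (fun t => dil p t y) d2);
        [exact: cg|exact: cd2].
    - by apply: ctsD; [exact: cNE|exact: cE].
  have := hardy_log T0 dphiE cdphi.
  have -> : phi 0 = w y.
    rewrite /phi; congr w; have := dilE p 0 y; rewrite oppr0 expR0 scale1r.
    by move=> /(congr1 (fun z => z + p)); rewrite !subrK.
  have -> : (\int[leb]_(x in `[0%R, T]) (((1 + x)^-1 * phi x) ^+ 2)%:E =
      \int[leb]_(t in I) H1 (dil p t y, t))%E.
    apply: eq_integral => t; rewrite inE/= in_itv/= => /andP[t0 _].
    by rewrite /H1/= ger0_norm.
  move=> /le_trans; apply; rewrite leeD2l//; apply: ge0_le_integral => //.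
  - by move=> t _; rewrite lee_fin mulr_ge0// sqr_ge0.
  - apply/measurable_EFinP; apply: measurable_funTS.
    apply: continuous_measurable_fun => t; apply: ctsM; first exact: ctsK.
    by apply: continuous_sqr; exact: cdphi.
  - apply: measurable_funTS; exact: (measurable_fun_pair2 y (mHd _ mH2)).
  - move=> t _; rewrite /H2/= lee_fin -mulrA ler_pM2l//.
    apply: (le_trans (sqr_dot_le _ _ _ _)); rewrite mulrC le_eqVlt; apply/orP; left.
    by apply/eqP; congr (_ * _); rewrite /dil /aff/=; ring.
have mind1 := emeasurable_funM mind (mHd _ mH1).
have mind2 := emeasurable_funM mind (mHd _ mH2).
have ind1 x : (0 <= ind x.1 x.2 * H1 (dil p x.2 x.1, x.2))%E by rewrite mule_ge0.
have ind2 x : (0 <= ind x.1 x.2 * H2 (dil p x.2 x.1, x.2))%E by rewrite mule_ge0.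
have mw2 : measurable_fun setT (fun y : meas2 R => 2 * (w y ^+ 2 * \1_(sq p rho) y)).
  apply: measurable_funM => //; apply: measurable_funM; last exact: measurable_indic.
  exact: measurable_funX.
have mg1 : measurable_fun setT (fun y : meas2 R => sqgrad d1 d2 y * \1_(sq p rho) y).
  by apply: measurable_funM => //; exact: measurable_indic.
pose J x t : \bar R := (expR t ^+ 2 * (\1_I t * \1_(sq p (expR (- t) * rho)) x))%:E.
have J0 x t : (0 <= J x t)%E.
  by rewrite lee_fin mulr_ge0 ?sqr_ge0// mulr_ge0 ?indicE.
have mJ (H : meas3 R -> \bar R) : measurable_fun setT H -> (forall x, 0 <= H x)%E ->
    measurable_fun setT (fun x : meas2 R => \int[leb]_t (J x t * H (x, t)))%E.
  move=> mH H0; apply: (mK (fun x => (J x.1 x.2 * H x)%E)) => [|x].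
    apply: emeasurable_funM => //; apply/measurable_EFinP; apply: measurable_funM.
      by apply: (mf2 (fun t => expR t ^+ 2)); exact: measurable_sqr_expR.
    apply: measurable_funM; last exact: measurable_indic_sq_dil.
    by apply: (mf2 (\1_I)); exact: measurable_indic.
  by rewrite mule_ge0//; exact: J0.
(* After the swap, w is evaluated at the fixed point x and leaves the time integral, which
   [log_hardy_lower] compares with the weight. *)
apply: (@le_trans _ _ (\int[leb2 R]_y \int[leb]_t (ind y t * H1 (dil p t y, t)))%E).
  rewrite (dil_swap p rho mI mH1 H10) -ge0_integralZl//; last 3 first.
  - by apply/measurable_EFinP; apply: measurable_funX; apply: measurable_funM => //;
      exact: measurable_funTS.
  - by move=> x _; rewrite lee_fin sqr_ge0.
  - by rewrite lee_fin mulr_ge0// sqr_ge0.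
  rewrite integral_mkcond; apply: ge0_le_integral => //.
  - move=> y _; apply: erestrict_ge0 => x _.
    by rewrite mule_ge0// lee_fin ?sqr_ge0// mulr_ge0// sqr_ge0.
  - apply/(measurable_restrictT _ _).1 => //; apply: emeasurable_funM => //.
    apply/measurable_EFinP; apply: measurable_funX; apply: measurable_funM => //.
    exact: measurable_funTS.
  - exact: mJ.
  - move=> x _; rewrite patchE; case: ifPn => [/set_mem Ax|_]; last first.
      by apply: integral_ge0 => t _; rewrite mule_ge0//; exact: J0.
    by rewrite -EFinM; exact: log_hardy_lower.
apply: (@le_trans _ _ (\int[leb2 R]_y ((2 * (w y ^+ 2 * \1_(sq p rho) y))%:E
      + \int[leb]_t (ind y t * H2 (dil p t y, t)))%E)%E).
  apply: ge0_le_integral => //.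
  - by move=> y _; apply: integral_ge0 => t _; rewrite mule_ge0.
  - exact: (mK _ mind1).
  - apply: emeasurable_funD; first exact/measurable_EFinP.
    exact: (mK _ mind2).
rewrite ge0_integralD//; last 4 first.
- by move=> y _; rewrite lee_fin mulr_ge0// mulr_ge0 ?sqr_ge0// indicE.
- exact/measurable_EFinP.
- by move=> y _; apply: integral_ge0 => t _; rewrite mule_ge0.
- exact: (mK _ mind2).
apply: leeD.
  rewrite (integral_indic_mul _ _ mQ) -ge0_integralZl//.
  - by apply/measurable_EFinP; apply: measurable_funM; [exact: measurable_funX|
      exact: measurable_indic].
  - by move=> y _; rewrite lee_fin mulr_ge0 ?sqr_ge0// indicE.
(* Likewise for the gradient: [log_hardy_upper] bounds the time integral at x by 4 rho^2 times the
   squared gradient, uniformly in T. *)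
rewrite (dil_swap p rho mI mH2 H20) (integral_indic_mul _ _ mQ) -ge0_integralZl//;
  last 3 first.
- exact/measurable_EFinP.
- by move=> y _; rewrite lee_fin mulr_ge0 ?sqgrad_ge0// indicE.
- by rewrite lee_fin mulr_ge0// sqr_ge0.
apply: ge0_le_integral => //.
- by move=> x _; apply: integral_ge0 => t _; rewrite mule_ge0//; exact: J0.
- exact: mJ.
- by apply: emeasurable_funM => //; exact/measurable_EFinP.
- move=> x _; rewrite -EFinM.
  have I0 t : I t -> 0 <= t by rewrite /I/= in_itv/= => /andP[].
  exact: (log_hardy_upper p x mI I0 (ltW rho0) (sqgrad_ge0 d1 d2 x)).
Qed.

End log_hardy_plane.

(** * Poincare inequalities on contour domains *)

Section subadditivity.
Context d (T : measurableType d) (R : realType).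
Variable mu : {measure set T -> \bar R}.
Variable f : T -> \bar R.
Hypothesis mf : measurable_fun setT f.
Hypothesis f0 : forall x, (0 <= f x)%E.
Local Open Scope ereal_scope.

Lemma ge0_integral_setU_le (A B : set T) : measurable A -> measurable B ->
  \int[mu]_(x in A `|` B) f x <= \int[mu]_(x in A) f x + \int[mu]_(x in B) f x.
Proof.
move=> mA mB; have mBA : measurable (B `\` A) by exact: measurableD.
have -> : A `|` B = A `|` (B `\` A).
  apply/seteqP; split=> y; last by case=> [|[]]; [left|right].
  by have [Ay _|nAy [|By]] := pselect (A y); [left|left|right].
rewrite ge0_integral_setU//.
- by apply: leeD => //; apply: ge0_subset_integral => //; exact: measurable_funTS.
- exact: measurable_funTS.
- by apply/disj_setPS => y [? []].
Qed.

Lemma ge0_integral_bigsetU_le (I : Type) (s : seq I) (F : I -> set T) :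
  (forall i, measurable (F i)) ->
  \int[mu]_(x in \big[setU/set0]_(i <- s) F i) f x <=
  \sum_(i <- s) \int[mu]_(x in F i) f x.
Proof.
move=> mF; elim: s => [|i s IHs]; first by rewrite !big_nil integral_set0.
rewrite !big_cons; apply: (le_trans (ge0_integral_setU_le _ _)) => //.
  exact: bigsetU_measurable.
exact: leeD.
Qed.

End subadditivity.

Section control.
Variable R : realType.
Implicit Types A B D U : set (meas2 R).
Local Open Scope ereal_scope.

Definition sqint A (w : R * R -> R) : \bar R := \int[leb2 R]_(y in A) (w y ^+ 2)%:E.
Definition gradint A (d1 d2 : R * R -> R) : \bar R :=
  \int[leb2 R]_(y in A) (sqgrad d1 d2 y)%:E.

(* For fixed U this relation is transitive and stable under finite unions of A,
   so that it can be propagated by connectedness and compactness. *)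
Definition controlled U A B : Prop :=
  exists2 C : R, (0 <= C)%R & forall w d1 d2 : R * R -> R, C1_plane w d1 d2 ->
    sqint A w <= C%:E * (sqint B w + gradint U d1 d2).

Lemma sqint_ge0 A w : 0 <= sqint A w.
Proof. by apply: integral_ge0 => y _; rewrite lee_fin sqr_ge0. Qed.

Lemma gradint_ge0 A d1 d2 : 0 <= gradint A d1 d2.
Proof. by apply: integral_ge0 => y _; rewrite lee_fin sqgrad_ge0. Qed.

Lemma sqr_measurable (w : R * R -> R) : continuous w ->
  measurable_fun (setT : set (meas2 R)) (fun y : meas2 R => (w y ^+ 2)%:E).
Proof.
move=> cw; apply/measurable_EFinP; apply: measurable_funX.
exact: continuous_measurable2.
Qed.

Lemma le_sqint A B w : continuous w -> measurable A -> measurable B ->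
  A `<=` B -> sqint A w <= sqint B w.
Proof.
move=> cw mA mB AB; apply: ge0_subset_integral => //.
  by apply: measurable_funTS; exact: sqr_measurable.
by move=> y _; rewrite lee_fin sqr_ge0.
Qed.

Lemma le_gradint A B d1 d2 : continuous d1 -> continuous d2 -> measurable A ->
  measurable B -> A `<=` B -> gradint A d1 d2 <= gradint B d1 d2.
Proof.
move=> cd1 cd2 mA mB AB; apply: ge0_subset_integral => //.
  by apply: measurable_funTS; apply/measurable_EFinP; exact: sqgrad_measurable.
by move=> y _; rewrite lee_fin sqgrad_ge0.
Qed.

Lemma controlled_sub U A A' B : measurable A -> measurable A' -> A `<=` A' ->
  controlled U A' B -> controlled U A B.
Proof.
move=> mA mA' AA' [C C0 H]; exists C => // w d1 d2 C1w.
apply: le_trans (H _ _ _ C1w); apply: le_sqint => //; by case: C1w.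
Qed.

Lemma controlled_trans U A B D :
  controlled U A B -> controlled U B D -> controlled U A D.
Proof.
move=> [C C0 H] [C' C'0 H']; exists (C * (C' + 1))%R.
  by rewrite mulr_ge0// addr_ge0.
move=> w d1 d2 C1w; apply: (le_trans (H _ _ _ C1w)).
rewrite EFinM -muleA lee_wpmul2l ?lee_fin//.
rewrite EFinD ge0_muleDl ?lee_fin// mul1e; apply: leeD; first exact: H'.
by rewrite leeDr// sqint_ge0.
Qed.

Lemma controlled_setU U A A' B : measurable A -> measurable A' ->
  controlled U A B -> controlled U A' B -> controlled U (A `|` A') B.
Proof.
move=> mA mA' [C C0 H] [C' C'0 H']; exists (C + C')%R; first by rewrite addr_ge0.
move=> w d1 d2 C1w; have [cw _ _ _ _] := C1w.
rewrite EFinD ge0_muleDl ?lee_fin//.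
apply: le_trans (leeD (H _ _ _ C1w) (H' _ _ _ C1w)).
apply: ge0_integral_setU_le => //; first exact: sqr_measurable.
by move=> y; rewrite lee_fin sqr_ge0.
Qed.

Lemma controlled0 U B : controlled U set0 B.
Proof.
exists 0%R => // w d1 d2 _.
by rewrite mul0e /sqint integral_set0.
Qed.

Lemma controlled_translate U A B (tau : R * R) :
  measurable A -> measurable B -> measurable U ->
  (forall y t, A y -> (0 <= t <= 1)%R -> U (y.1 + t * tau.1, y.2 + t * tau.2)%R) ->
  (forall y, A y -> B (y.1 + tau.1, y.2 + tau.2)%R) ->
  controlled U A B.
Proof.
move=> mA mB mU AU AB; set K := (4 * (tau.1 ^+ 2 + tau.2 ^+ 2))%R.
have K0 : (0 <= K)%R by rewrite mulr_ge0// addr_ge0 ?sqr_ge0.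
exists (2 + K)%R; first by rewrite addr_ge0.
move=> w d1 d2 C1w; have := le_translate C1w mA mB mU AU AB.
move=> /le_trans; apply; rewrite [leRHS]ge0_muleDr ?sqint_ge0 ?gradint_ge0//.
apply: leeD; apply: lee_wpmul2r; rewrite ?sqint_ge0 ?gradint_ge0// lee_fin.
  by rewrite lerDl.
by rewrite lerDr.
Qed.

End control.

(** * Propagation of control inside a domain and up to its boundary *)

Section local_control.
Variable R : realType.
Implicit Types p q tau : R * R.
Variables (U B : set (R * R)).
Hypothesis oU : open U.

Let mU : measurable (U : set (meas2 R)).
Proof. exact: open_measurable2. Qed.

Let mUsq p e : measurable (U `&` sq p e : set (meas2 R)).
Proof. by apply: measurableI => //; exact: sq_measurable. Qed.

(** Because of the intersection with U, the notion makes sense at boundary points too, so that a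
    compactness argument on the closure of U is possible. *)
Definition locally_controlled p : Prop :=
  exists2 e : R, 0 < e & controlled U (U `&` sq p e : set (meas2 R)) B.

Lemma sq_mono p (e e' : R) : e <= e' -> sq p e `<=` sq p e'.
Proof. by move=> ee' y /le_trans; exact. Qed.

Lemma nbhs_sq p (e : R) (S : set (R * R)) : 0 < e -> sq p e `<=` S -> nbhs p S.
Proof.
move=> e0 eS; apply/nbhs_ballP; exists e => // y [b1 b2]; apply: eS.
by apply/sqP; split; rewrite distrC ltW.
Qed.

Lemma open_sq p : U p -> exists2 e : R, 0 < e & sq p e `<=` U.
Proof.
move=> Up; have := open_nbhs_nbhs (conj oU Up).
move=> /nbhs_normP[e /= e0 eU]; exists (e / 2); first by rewrite divr_gt0.
move=> y; rewrite /sq/= => ye; apply: eU; rewrite /ball_/= distrC.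
by apply: le_lt_trans ye _; lra.
Qed.

Lemma controlled_shift p tau : locally_controlled (p + tau) ->
  exists2 e : R, 0 < e & forall A : set (meas2 R), measurable A ->
    A `<=` sq p e -> (forall y t, A y -> 0 <= t <= 1 -> U (y + t *: tau)) ->
    controlled U A B.
Proof.
move=> [e e0 cB]; exists e => // A mA Ae AU.
apply: controlled_trans cB.
have addE (y : R * R) (t : R) :
    y + t *: tau = (y.1 + t * tau.1, y.2 + t * tau.2) by [].
apply: (@controlled_translate _ _ _ _ tau) => //.
- move=> y Ay; have := addE y 1; rewrite !mul1r scale1r => <-; split.
    by rewrite -(scale1r tau); apply: AU => //; rewrite lexx ler01.
  have -> : sq (p + tau) e (y + tau) = sq p e y.
    by rewrite /sq/= opprD addrACA subrr addr0.
  exact: Ae.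
Qed.

(** Points close to p are translated by q - p; the segments stay in the larger square about p, hence
    in U. *)
Lemma locally_controlled_near p q (e : R) : sq p (e + e) `<=` U -> 0 < e ->
  sq p e q -> locally_controlled q -> locally_controlled p.
Proof.
move=> pU e0 pq cq; have := @controlled_shift p (q - p).
rewrite addrC subrK => /(_ cq)[e' e'0 H]; exists (Num.min e e').
  by rewrite lt_min e0.
apply: H => //.
  by move=> y [_]; apply: sq_mono; rewrite ge_min lexx orbT.
move=> y t [_ ye] /andP[t0 t1]; apply: pU; rewrite /sq/= addrAC.
apply: (le_trans (ler_normD _ _)); apply: lerD.
  by apply: le_trans ye _; rewrite ge_min lexx.
rewrite normrZ ger0_norm//; apply: le_trans pq.
by rewrite ler_piMl.
Qed.

(** The controlled points of U form a relatively clopen set. Openness is immediate by shrinking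
    squares; for closedness, a point of U having a controlled point nearby is itself controlled, by
    [locally_controlled_near]. *)
Lemma locally_controlled_connected p0 p : connected U -> U p0 -> U p ->
  locally_controlled p0 -> locally_controlled p.
Proof.
move=> conU Up0 Up cp0.
pose S := [set q | U q /\ locally_controlled q].
suff SU : S = U by have := Up; rewrite -SU => -[].
apply: conU.
- by exists p0.
- exists S; last first.
    by apply/seteqP; split=> q; [move=> Sq; split=> //; case: Sq|case].
  rewrite openE => q [Uq [e e0 cq]]; have [e' e'0 qU] := open_sq Uq.
  pose d := Num.min e e' / 2.
  have d0 : 0 < d by rewrite divr_gt0// lt_min e0.
  have de : d + d <= e by rewrite /d -splitr ge_min lexx.
  have de' : d <= e'.
    rewrite (@le_trans _ _ (d + d)) ?lerDl ?(ltW d0)// /d -splitr.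
    by rewrite ge_min lexx orbT.
  apply: (nbhs_sq d0) => y qy; split.
    by apply: qU; exact: sq_mono de' _ _.
  exists d => //; apply: controlled_sub cq => // z [Uz yz]; split => //.
  rewrite /sq/=; have -> : z - q = (z - y) + (y - q) by rewrite addrA subrK.
  by apply: (le_trans (ler_normD _ _)); apply: le_trans de; exact: lerD.
- exists (~` [set q | U q /\ ~ locally_controlled q]).
    apply: open_closedC; rewrite openE => q [Uq cq]; have [e e0 qU] := open_sq Uq.
    have e20 : 0 < e / 2 by rewrite divr_gt0.
    apply: (nbhs_sq e20) => y qy; split.
      by apply: qU; apply: (@sq_mono q (e / 2)) => //; lra.
    move=> cy; apply: cq; apply: (@locally_controlled_near q y (e / 2)) => //.
    by rewrite -splitr.
  apply/seteqP; split=> q; first by move=> [Uq cq]; split => // -[].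
  by move=> [Uq /= cq]; split => //; apply: contrapT => ncq; apply: cq.
Qed.

(** A tube lemma: for each t in [0, 1] the condition is open in (y, t), and the segment is compact.
    It serves to make [escape] measurable. *)
Lemma open_segments (tau : R * R) :
  open [set y | forall t : R, 0 <= t <= 1 -> U (y + t *: tau)].
Proof.
rewrite openE => y yU.
have cK : compact `[0 : R, 1]%classic by exact: segment_compact.
have := (compact_near_coveringP _).1 cK _ (nbhs y)
  (fun z t => U (z + t *: tau)) _.
move=> H; have {H} : \forall z \near y,
    `[0 : R, 1]%classic `<=` (fun t => U (z + t *: tau)).
  apply: H => t /=; rewrite in_itv/= => t01.
  have cf : continuous_at (y, t) (fun x : R * R * R => x.1 + x.2 *: tau).
    apply: cvgD; first exact: cvg_fst.
    apply: cvgZr_tmp; exact: cvg_snd.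
  have Uyt : nbhs (y + t *: tau) U.
    by apply: open_nbhs_nbhs; split => //; exact: yU.
  have [[A A'] /= [yA tA'] AU] : nbhs (y, t) ((fun x : R * R * R =>
      x.1 + x.2 *: tau) @^-1` U) by exact: cf.
  by exists (A', A) => //= -[t' z] [/= At' Az]; exact: (AU (z, t')).
apply: filterS => z zU t t01; by apply: zU; rewrite /= in_itv.
Qed.

(** Without a boundary point on the segment, the parameters mapped into U would be both open and
    closed in the connected interval [0, t]. *)
Lemma segment_exit (y tau : R * R) (t : R) : U y -> 0 <= t ->
  ~ U (y + t *: tau) ->
  exists2 s, 0 < s <= t & (closure U `\` U) (y + s *: tau).
Proof.
move=> Uy t0 Uyt; apply: contrapT => noexit; apply: Uyt.
pose ga s := y + s *: tau.
have cga : continuous ga.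
  by move=> s; apply: cvgD; [exact: cvg_cst|apply: cvgZr_tmp; exact: cvg_id].
suff AE : `[0, t]%classic `&` ga @^-1` U = `[0, t]%classic.
  have : `[0, t]%classic t by rewrite /= in_itv/= lexx t0.
  by rewrite -AE => -[].
have := @segment_connected R 0 t; apply.
- by exists 0; split; rewrite /ga/= ?in_itv/= ?lexx// scale0r addr0.
- by exists (ga @^-1` U) => //; apply: open_comp => // s _; exact: cga.
- exists (ga @^-1` closure U).
    by apply: closed_comp => [s _|]; [exact: cga|exact: closed_closure].
  apply/seteqP; split=> s [/= st]; first by move/subset_closure.
  rewrite in_itv/= in st; move: st => /andP[s0 st] cs; split.
    by rewrite in_itv/= s0.
  have [s0'|s0'] := eqVneq s 0; first by rewrite s0' /ga scale0r addr0.
  apply: contrapT => nU; apply: noexit; exists s => //.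
  by rewrite lt0r s0' s0.
Qed.

Definition escape (p tau : R * R) (e : R) : set (R * R) :=
  [set y | U y /\ sq p e y /\ forall t : R, 0 <= t <= 1 -> U (y + t *: tau)].

Lemma escape_measurable p tau e : measurable (escape p tau e : set (meas2 R)).
Proof.
have -> : escape p tau e = (U `&` sq p e) `&`
    [set y | forall t : R, 0 <= t <= 1 -> U (y + t *: tau)].
  by apply/seteqP; split=> y; [case=> ? []|case=> -[]].
by apply: measurableI => //; apply: open_measurable2; exact: open_segments.
Qed.

(** Either no point close to p escapes along tau, and there is nothing to control, or p + tau is a
    limit of points of U. In the second case p + tau is not on the boundary, so it is an interior
    point, and its control is carried back along the segments. *)
Lemma escape_controlled p tau : tau != 0 -> closure U p -> ~ U p ->
  (forall q, U q -> locally_controlled q) ->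
  ((closure U `\` U) (p + tau) -> p + tau = p) ->
  exists2 e, 0 < e & forall e', e' <= e -> controlled U (escape p tau e') B.
Proof.
move=> tau0 cp nUp Uc inj.
have [[e e0 ex]|nex] := pselect (exists2 e : R, 0 < e & escape p tau e = set0).
  exists e => // e' ee'; rewrite (_ : escape _ _ _ = set0).
    exact: controlled0.
  rewrite -subset0 -ex => y [Uy [ye H]]; split => //; split => //.
  exact: sq_mono ee' _ _.
have cpt : closure U (p + tau).
  move=> V /nbhs_ballP[e /= e0 eV].
  have [y [Uy [ye yU]]] : escape p tau (e / 2) !=set0.
    apply/set0P/eqP => e20; apply: nex; exists (e / 2) => //.
    by rewrite divr_gt0.
  exists (y + tau); split.
    by rewrite -(scale1r tau); apply: yU; rewrite lexx ler01.
  apply: eV; have : sq (p + tau) (e / 2) (y + tau).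
    by rewrite /sq/= opprD addrACA subrr addr0.
  by case/sqP => y1 y2; split; rewrite /ball/= distrC;
    [apply: le_lt_trans y1 _|apply: le_lt_trans y2 _]; lra.
have Upt : U (p + tau).
  apply: contrapT => nU; move/eqP : tau0; apply.
  by have := inj (conj cpt nU); rewrite -[RHS]addr0 => /addrI.
have [e e0 H] := controlled_shift (Uc _ Upt); exists e => // e' ee'.
apply: H => //; first exact: escape_measurable.
  by move=> y [_ [ye _]]; exact: sq_mono ee' _ _.
by move=> y t [_ [_ yU]]; exact: yU.
Qed.

(* Each line parallel to tau meets the boundary at most once near p, so for y in
   U near p one of the segments [y, y + tau] and [y, y - tau] stays in U. *)
Lemma boundary_controlled p tau (delta : R) : 0 < delta -> tau != 0 ->
  `|tau| + `|tau| <= delta ->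
  (closure U `\` U) p ->
  (forall q, U q -> locally_controlled q) ->
  (forall a s, sq p delta a -> sq p delta (a + s *: tau) ->
    (closure U `\` U) a -> (closure U `\` U) (a + s *: tau) ->
    a + s *: tau = a) ->
  locally_controlled p.
Proof.
move=> delta0 tau0 taud [cp nUp] Uc inj.
have tau_gt0 : 0 < `|tau| by rewrite normr_gt0.
have sqpp e : 0 <= e -> sq p e p by rewrite /sq/= subrr normr0.
have shifted (sg : R) : `|sg| = 1 -> exists2 e, 0 < e &
    forall e', e' <= e -> controlled U (escape p (sg *: tau) e') B.
  move=> sg1; apply: escape_controlled => //.
    by rewrite -normr_gt0 normrZ sg1 mul1r.
  move=> cpt; apply: inj => //; first by apply: sqpp; exact: ltW.
  rewrite /sq/= addrC addKr normrZ sg1 mul1r.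
  by apply: le_trans taud; rewrite lerDl.
have [e1 e10 H1] := shifted 1 (normr1 R).
have [e2 e20 H2] := shifted (-1) (normrN1 R).
(* The bound by the norm of tau keeps both segments issued from y in the square of half-side delta,
   where [inj] applies. *)
pose e := Num.min (Num.min e1 e2) `|tau|.
exists e; first by rewrite !lt_min e10 e20.
have ee1 : e <= e1 by rewrite !ge_min lexx.
have ee2 : e <= e2 by rewrite !ge_min lexx orbT.
apply: (controlled_sub _ _ _ (controlled_setU _ _ (H1 _ ee1) (H2 _ ee2))) => //;
  try (by apply: measurableU; exact: escape_measurable);
  try exact: escape_measurable.
move=> y [Uy ye].
have [|n1] := pselect (escape p (1 *: tau) e y); first by left.
have [|n2] := pselect (escape p (-1 *: tau) e y); first by right.
exfalso.
have ex (sg : R) : `|sg| = 1 -> ~ escape p (sg *: tau) e y ->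
    exists2 s, 0 < s & sq p delta (y + s *: (sg *: tau)) /\
      (closure U `\` U) (y + s *: (sg *: tau)).
  move=> sg1 nesc.
  have [t [t01 nU]] : exists t : R, 0 <= t <= 1 /\ ~ U (y + t *: (sg *: tau)).
    apply: contrapT => H; apply: nesc; split => //; split => // t t01.
    by apply: contrapT => nU; apply: H; exists t.
  have [t0 t1] := andP t01.
  have [s /andP[s0 st] bd] := segment_exit Uy t0 nU.
  exists s => //; split => //; rewrite /sq/= addrAC.
  apply: (le_trans (ler_normD _ _)); apply: le_trans taud; apply: lerD.
    by apply: le_trans ye _; rewrite !ge_min lexx orbT.
  rewrite !normrZ sg1 mul1r gtr0_norm// ler_piMl//.
  exact: le_trans t1.
(* If both segments left U, they would give two boundary points of one line, on either side of y and
   at parameter distance s + s' > 0. *)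
have [s s0 [sqa bda]] := ex 1 (normr1 R) n1.
have [s' s'0 [sqb bdb]] := ex (-1) (normrN1 R) n2.
have E : y + s' *: (-1 *: tau) = (y + s *: (1 *: tau)) + (- (s + s')) *: tau.
  by rewrite !scalerA mulr1 mulrN1 -addrA -scalerDl; congr (_ + _ *: _); ring.
rewrite E in sqb bdb.
have := inj _ _ sqa sqb bda bdb; rewrite -[RHS]addr0 => /addrI /eqP.
by rewrite scaler_eq0 (negbTE tau0) orbF oppr_eq0 gt_eqF// addr_gt0.
Qed.

End local_control.

(** * Smooth contours are locally graphs *)

Section contour.
Variable R : realType.

Lemma smooth1_continuous (f : R -> R) : smooth1 f -> continuous f.
Proof.
by move=> sf x; apply/differentiable_continuous/derivable1_diffP; exact: (sf 0%N).
Qed.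

Lemma smooth1_derive (f : R -> R) (x : R) : smooth1 f ->
  is_derive x (1 : R) f (derive1 f x).
Proof.
by move=> sf; rewrite derive1E; apply: DeriveDef => //; exact: (sf 0%N).
Qed.

Lemma smooth1_continuous_derive (f : R -> R) :
  smooth1 f -> continuous (derive1 f).
Proof.
by move=> sf x; apply/differentiable_continuous/derivable1_diffP; exact: (sf 1%N).
Qed.

Lemma periodic_int (T : Type) (g : R -> T) : (forall t, g (t + 1) = g t) ->
  forall (k : int) (t : R), g (t + k%:~R) = g t.
Proof.
move=> g1; have gn (n : nat) (t : R) : g (t + n%:R) = g t.
  elim: n t => [|n IHn] t; first by rewrite addr0.
  by rewrite -natr1 addrA g1.
case=> n t; first exact: gn.
by rewrite NegzE mulrNz -(gn n.+1 (t - _)) subrK.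
Qed.

Lemma frac_bounds (x : R) : 0 <= x - (Num.floor x)%:~R < 1.
Proof.
have /andP[fx xf] := floor_itv x; rewrite subr_ge0 fx ltrBlDr.
by rewrite intrD addrC in xf.
Qed.

Lemma contour_inj (g : R -> R * R) (s t : R) :
  (forall t, g (t + 1) = g t) -> {in `[0, 1[ &, injective g} ->
  g s = g t -> exists k : int, s - t = k%:~R.
Proof.
move=> g1 ginj gst.
have fr (x : R) : g (x - (Num.floor x)%:~R) = g x.
  by rewrite -mulrNz periodic_int.
have : s - (Num.floor s)%:~R = t - (Num.floor t)%:~R.
  by apply: ginj; rewrite ?in_itv/= ?frac_bounds// !fr.
move=> E; exists (Num.floor s - Num.floor t); rewrite intrB; lra.
Qed.

(* By compactness g is close to g t0 only at parameters close to t0 modulo 1,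
   where f is injective. *)
Lemma contour_locally_graph (g : R -> R * R) (f : R -> R) (t0 : R) :
  continuous g -> (forall t, g (t + 1) = g t) -> {in `[0, 1[ &, injective g} ->
  smooth1 f -> (forall t, f (t + 1) = f t) -> derive1 f t0 != 0 ->
  exists2 delta : R, 0 < delta & forall s t,
    sq (g t0) delta (g s) -> sq (g t0) delta (g t) -> f s = f t -> g s = g t.
Proof.
move=> cg g1 ginj sf f1 dft0.
have [e0 e00 He0] : exists2 e : R, 0 < e &
    forall x, `|t0 - x| < e -> derive1 f x != 0.
  have : nbhs t0 (derive1 f @^-1` [set y | y != 0]).
    by apply: (smooth1_continuous_derive sf); apply: open_nbhs_nbhs; split => //.
  by move=> /nbhs_ballP[e /= e_gt0 He]; exists e => // x xe; exact: He.
(* The mean value point between two parameters within eta of t0 lies within 3 eta < e0 of t0, where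
   the derivative of f does not vanish; eta <= 1/4 makes the complementary parameter interval
   nonempty. *)
pose eta := Num.min (e0 / 4) (1 / 4).
have eta0 : 0 < eta by rewrite lt_min !divr_gt0.
have etae : 4 * eta <= e0.
  have : eta <= e0 / 4 by rewrite ge_min lexx.
  lra.
have eta4 : eta <= 1 / 4 by rewrite ge_min lexx orbT.
have finj s t : `|s - t0| <= eta -> `|t - t0| <= eta -> f s = f t -> s = t.
  move=> s1 t1 fst_.
  have [c ct] := @MVT_abs _ f (derive1 f) s t (fun x => smooth1_derive x sf).
  rewrite fst_ subrr => /esym/eqP; rewrite mulf_eq0 => /orP[|]; last first.
    by rewrite subr_eq0 => /eqP.
  rewrite (negbTE (He0 c _))//.
  have st : `|t - s| <= eta + eta.
    rewrite (_ : t - s = (t - t0) - (s - t0)); last by ring.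
    by apply: (le_trans (ler_normB _ _)); exact: lerD.
  rewrite (_ : t0 - c = - ((c - s) + (s - t0))); last by ring.
  rewrite normrN; apply: (le_lt_trans (ler_normD _ _)); lra.
(* The rest of the contour stays at a positive distance from g t0: a coincidence would yield an
   integer strictly between 0 and 1. *)
have [c cI cmin] : exists2 c, c \in `[t0 + eta, t0 + 1 - eta] &
    forall t, t \in `[t0 + eta, t0 + 1 - eta] -> `|g c - g t0| <= `|g t - g t0|.
  apply: (@EVT_min _ (fun t => `|g t - g t0|)); first by lra.
  apply: continuous_subspaceT => t; apply: cvg_norm.
  by apply: cvgB; [exact: cg|exact: cvg_cst].
have dc : 0 < `|g c - g t0|.
  rewrite normr_gt0 subr_eq0; apply/eqP => gc.
  have [k kE] := contour_inj g1 ginj gc.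
  move: cI; rewrite in_itv/= => /andP[c1 c2].
  have k0 : (0 < k)%R by rewrite -(ltr0z R) -kE; lra.
  have k1 : (k < 1)%R by rewrite -(ltrz1 R) -kE; lra.
  by move: k0 k1; case: k {kE} => // -[|[]].
exists (`|g c - g t0| / 2); first by rewrite divr_gt0.
(* An integer translation brings s into [t0 - eta, t0 + 1 - eta[. Parameters beyond t0 + eta are
   excluded, since there g is at least twice too far from g t0. *)
have red s : sq (g t0) (`|g c - g t0| / 2) (g s) -> exists2 s',
    `|s' - t0| <= eta & g s' = g s /\ f s' = f s.
  move=> gs; pose k := Num.floor (s - t0 + eta).
  have := frac_bounds (s - t0 + eta); rewrite -/k => /andP[k1 k2].
  have gsk : g (s - k%:~R) = g s by rewrite -mulrNz periodic_int.
  exists (s - k%:~R).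
    rewrite ler_norml; apply/andP; split; first lra.
    rewrite leNgt; apply/negP => ks.
    have := cmin (s - k%:~R); rewrite in_itv/= gsk.
    rewrite (_ : _ && _ = true); last by apply/andP; split; lra.
    move=> /(_ isT); have := gs; rewrite /sq/=; lra.
  by split => //; rewrite -mulrNz periodic_int.
move=> s t /red[s' s1 [<- fs]] /red[t' t1 [<- ft]] fst_.
by congr g; apply: finj => //; rewrite fs ft.
Qed.

End contour.

(* Without this, [compact_cover] does not apply to subsets of R * R. *)
HB.saturate prod.

Section poincare.
Variable R : realType.

Lemma compact_closure_bounded (U : set (R * R)) :
  bounded_set U -> compact (closure U).
Proof.
move=> [M0 [_ M0U]]; pose M := M0 + 1.
have UM : U `<=` sq (0, 0) M.
  move=> y Uy; rewrite /sq/= (_ : y - (0, 0) = y); last by rewrite subr0.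
  by apply: (M0U M) => //; rewrite ltrDl.
apply: (@subclosed_compact _ _ (`[- M, M]%classic `*` `[- M, M]%classic)).
- exact: closed_closure.
- by apply: compact_setX; exact: segment_compact.
- move=> y yU; have : sq (0, 0) M y.
    have <- : closure (sq (0, 0) M) = sq (0, 0) M.
      by apply/esym/closure_id; exact: sq_closed.
    exact: closure_subset UM _ yU.
  by move=> /sqP[/=]; rewrite !subr0 !ler_norml => y1 y2; split;
    rewrite /= in_itv.
Qed.

Lemma controlled_bigcup (U B : set (R * R)) (e : R * R -> R) (s : seq (R * R)) :
  open U ->
  (forall p, p \in s -> controlled U (U `&` sq p (e p) : set (meas2 R)) B) ->
  controlled U (\bigcup_(p in [set` s]) (U `&` sq p (e p)) : set (meas2 R)) B.
Proof.
move=> oU; have mUs p : measurable (U `&` sq p (e p) : set (meas2 R)).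
  by apply: measurableI; [exact: open_measurable2|exact: sq_measurable].
rewrite bigcup_seq; elim: s => [|p s IHs] H.
  by rewrite big_nil; exact: controlled0.
rewrite big_cons; apply: controlled_setU => //.
- exact: bigsetU_measurable.
- by apply: H; rewrite mem_head.
- by apply: IHs => q qs; apply: H; rewrite in_cons qs orbT.
Qed.

(** A radius is chosen at each point of the compact closure, and a finite subcover adds up finitely
    many constants. *)
Lemma local_to_global (U B : set (R * R)) : open U -> bounded_set U ->
  (forall p, closure U p -> locally_controlled U B p) -> controlled U U B.
Proof.
move=> oU bU cU.
have /choice[e eP] : forall p, exists e : R, closure U p ->
    0 < e /\ controlled U (U `&` sq p e : set (meas2 R)) B.
  move=> p; have [cp|ncp] := pselect (closure U p); last by exists 0.
  by have [e e0 ce] := cU p cp; exists e.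
have := compact_closure_bounded bU; rewrite compact_cover.
move=> /(_ _ (closure U) (fun p => (sq p (e p))°)) [].
- by move=> p _; exact: open_interior.
- move=> p cp; exists p => //; have [e0 _] := eP p cp.
  by apply: (nbhs_sq e0).
move=> D DU UD.
apply: (@controlled_sub _ _ _
  (\bigcup_(p in [set` finmap.enum_fset D]) (U `&` sq p (e p)))).
- exact: open_measurable2.
- rewrite bigcup_seq; apply: bigsetU_measurable => p _.
  by apply: measurableI; [exact: open_measurable2|exact: sq_measurable].
- move=> y Uy; have [p pD yp] := UD _ (subset_closure Uy).
  by exists p => //; split => //; exact: interior_subset yp.
- by apply: controlled_bigcup => // p /DU; rewrite inE => /eP[].
Qed.

Lemma contour_domain_control (U : set (R * R)) (p : R * R) (r : R) :
  smooth_contour_domain U -> U p -> 0 < r -> sq p r `<=` U ->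
  controlled U U (sq p r).
Proof.
move=> [oU conU bU [g [sg1 sg2 dg g1 ginj] gU]] Up r0 rU.
have cp : locally_controlled U (sq p r) p.
  (* The seed of the propagation: the square trivially controls itself. *)
  exists r => //; exists 1 => // w d1 d2 C1w; rewrite mul1e.
  have [cw _ _ _ _] := C1w.
  apply: (@le_trans _ _ (sqint (sq p r) w)).
    apply: le_sqint => //.
    - by apply: measurableI; [exact: open_measurable2|exact: sq_measurable].
    - exact: sq_measurable.
  by rewrite leeDl// gradint_ge0.
have Uc q : U q -> locally_controlled U (sq p r) q.
  by move=> Uq; exact: (locally_controlled_connected oU conU Up).
apply: local_to_global => // q cq.
have [/Uc //|nUq] := pselect (U q).
have bdE : closure U `\` U = range g.
  by rewrite -gU; congr (_ `\` _); apply/esym; exact/interior_id.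
have [t0 _ gt0] : range g q by rewrite -bdE.
have cg : continuous g.
  move=> t; have := ctsP (smooth1_continuous sg1 (x := t))
    (smooth1_continuous sg2 (x := t)).
  by under eq_fun do rewrite -surjective_pairing.
(* A coordinate direction transversal to the contour at q. If the first component has zero
   derivative at t0, the second one has not; a move along (1, 0) preserves the second component,
   which determines the point of the contour near q. Otherwise the roles are exchanged. *)
have [tau [tau1 tauP]] : exists tau : R * R, `|tau| = 1 /\
    exists2 delta : R, 0 < delta & forall s t (c : R), sq q delta (g s) ->
      sq q delta (g t) -> g t = g s + c *: tau -> g t = g s.
  have [d1|d1] := eqVneq (derive1 (fun t => (g t).1) t0) 0.
    have d2 : derive1 (fun t => (g t).2) t0 != 0.
      by apply/eqP => d2; apply: (dg t0); rewrite d1 d2.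
    exists (1, 0); split.
      by rewrite prod_normE/= normr1 normr0 max_l.
    have [] := contour_locally_graph cg g1 ginj sg2 _ d2.
      by move=> t; rewrite g1.
    rewrite gt0 => delta delta0 H; exists delta => // s t c gs gt gst.
    by apply: H => //; rewrite gst/= /GRing.scale/= mulr0 addr0.
  exists (0, 1); split.
    by rewrite prod_normE/= normr1 normr0 max_r.
  have [] := contour_locally_graph cg g1 ginj sg1 _ d1.
    by move=> t; rewrite g1.
  rewrite gt0 => delta delta0 H; exists delta => // s t c gs gt gst.
  by apply: H => //; rewrite gst/= /GRing.scale/= mulr0 addr0.
have [delta delta0 H] := tauP.
apply: (@boundary_controlled _ _ _ oU q ((delta / 2) *: tau) delta) => //.
- by rewrite -normr_gt0 normrZ tau1 mulr1 gtr0_norm divr_gt0.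
- by rewrite normrZ tau1 mulr1 gtr0_norm ?divr_gt0// -splitr.
move=> a s sqa sqb; rewrite bdE => -[sa _ aE] [sb _ bE].
rewrite -bE -aE; rewrite -aE in sqa; rewrite -bE in sqb.
by apply: (H sa sb (s * (delta / 2)) sqa sqb); rewrite bE aE scalerA.
Qed.

End poincare.

(** * Contours are null sets *)

Section null_curve.
Variable R : realType.

Lemma leb2_sq (p : R * R) (r : R) : 0 <= r ->
  leb2 R (sq p r) = ((2 * r) ^+ 2)%:E.
Proof.
move=> r0; have -> : sq p r = `[p.1 - r, p.1 + r]%classic `*`
    `[p.2 - r, p.2 + r]%classic.
  by apply/seteqP; split=> y; rewrite sqP /= !in_itv/= !ler_distl.
rewrite /leb2 product_measure1E//= !lebesgue_measure_itv/= !lte_fin.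
have E (x : R) : (if x - r < x + r then ((x + r)%:E - (x - r)%:E)%E else 0%E) =
    (2 * r)%:E.
  case: ifPn => [_|]; first by rewrite -EFinB; congr EFin; ring.
  by rewrite -leNgt => H; congr EFin; lra.
by rewrite !E -EFinM.
Qed.

(* The curve is covered by O(n) squares with sides O(1 / n). *)
Lemma lipschitz_curve_null (ga : R -> R * R) (L : R) : 0 <= L ->
  (forall s t, 0 <= s <= 1 -> 0 <= t <= 1 -> `|ga s - ga t| <= L * `|s - t|) ->
  continuous ga -> leb2 R (ga @` `[0, 1]%classic) = 0%E.
Proof.
move=> L0 lip cga; set G := ga @` _.
have mG : measurable (G : set (meas2 R)).
  apply: closed_measurable2; apply: compact_closed; first exact: norm_hausdorff.
  by apply: continuous_compact;
    [exact: continuous_subspaceT|exact: segment_compact].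
(* There are n + 2 squares of area (2 L / (n + 1))^2, centred at the images of i / (n + 1), and n +
   2 <= 2 (n + 1). *)
have bound (n : nat) : (leb2 R G <= (8 * L ^+ 2 / n.+1%:R)%:E)%E.
  pose A (i : nat) : set (meas2 R) := sq (ga (i%:R / n.+1%:R)) (L / n.+1%:R).
  have n0 : 0 < n.+1%:R :> R by rewrite ltr0n.
  have mA i : measurable (A i) by exact: sq_measurable.
  have sub : G `<=` \big[setU/set0]_(i < n.+2) A i.
    move=> _ [t /= + <-]; rewrite in_itv/= => /andP[t0 t1].
    have tn0 : 0 <= t * n.+1%:R by rewrite mulr_ge0// ltW.
    have /andP[i1 i2] := truncn_itv tn0; set i := Num.trunc _ in i1 i2 *.
    have iN : i%:R <= n.+1%:R :> R by rewrite (le_trans i1)// ler_piMl// ltW.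
    rewrite -(big_mkord xpredT A) -bigcup_seq; exists i => /=.
      by rewrite mem_index_iota/= ltnS -(ler_nat R).
    rewrite /A /sq/=; apply: (le_trans (lip _ _ _ _)).
    - by rewrite t0 t1.
    - by rewrite divr_ge0 ?(ltW n0)//= ler_pdivrMr// mul1r.
    - apply: ler_wpM2l => //; rewrite ger0_norm.
        rewrite lerBlDr -[X in X + _]mul1r -mulrDl ler_pdivlMr// addrC natr1.
        exact: ltW.
      by rewrite subr_ge0 ler_pdivrMr.
  apply: (le_trans (@content_subadditive _ _ _ (leb2 R) G A n.+2
    (fun k _ => mA k) mG sub)).
  rewrite (eq_bigr (fun=> ((2 * (L / n.+1%:R)) ^+ 2)%:E)); last first.
    by move=> i _; apply: leb2_sq; rewrite divr_ge0 ?(ltW n0).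
  rewrite sumEFin sumr_const card_ord lee_fin -[leLHS]mulr_natr.
  rewrite [leLHS](_ : _ * _ = (4 * L ^+ 2 / n.+1%:R) * (n.+2%:R / n.+1%:R)); last first.
    by field; rewrite gt_eqF.
  rewrite (_ : 8 * L ^+ 2 / n.+1%:R = (4 * L ^+ 2 / n.+1%:R) * 2); last by ring.
  apply: ler_wpM2l; first by rewrite divr_ge0 ?(ltW n0)// mulr_ge0// sqr_ge0.
  rewrite ler_pdivrMr// -natrM ler_nat mulnC muln2 -addnn addnS ltnS leq_addr.
  by [].
apply/eqP; rewrite eq_le measure_ge0 andbT; apply/lee_addgt0Pr => e e0.
rewrite add0e; have L8 : 0 <= 8 * L ^+ 2 by rewrite mulr_ge0// sqr_ge0.
apply: (le_trans (bound (Num.trunc (8 * L ^+ 2 / e)))); rewrite lee_fin.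
have x0 : 0 <= 8 * L ^+ 2 / e by rewrite divr_ge0// ltW.
have /andP[_ i2] := truncn_itv x0.
by rewrite ler_pdivrMr ?ltr0n// [e * _]mulrC -ler_pdivrMr// ltW.
Qed.

Lemma contour_null (g : R -> R * R) (p : R * R) (h : R) :
  smooth_closed_contour g ->
  exists2 N : set (meas2 R), measurable N &
    leb2 R N = 0%E /\ range (fun t => p + h *: g t) `<=` N.
Proof.
move=> [sg1 sg2 _ g1 _].
pose ga t := p + h *: g t.
have cg : continuous g.
  move=> t; have := ctsP (smooth1_continuous sg1 (x := t))
    (smooth1_continuous sg2 (x := t)).
  by under eq_fun do rewrite -surjective_pairing.
have cga : continuous ga.
  by move=> t; apply: cvgD; [exact: cvg_cst|apply: cvgZl_tmp; exact: cg].
have dbound (f : R -> R) : smooth1 f -> exists2 L : R, 0 <= L &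
    forall s t : R, 0 <= s <= 1 -> 0 <= t <= 1 -> `|f s - f t| <= L * `|s - t|.
  move=> sf.
  (* [MVT_abs] locates its point only within |s - t| <= 1 of t, hence in [-1, 2] rather than in
     [0, 1]. *)
  have [||c _ cmax] := @EVT_max _ (fun t => `|derive1 f t|) (-1) 2.
  - lra.
  - apply: continuous_subspaceT => t; apply: cvg_norm.
    exact: (smooth1_continuous_derive sf).
  exists `|derive1 f c| => // s t /andP[s0 s1] /andP[t0 t1].
  have [x xt ->] := @MVT_abs _ f (derive1 f) t s (fun x => smooth1_derive x sf).
  rewrite normrM ler_wpM2r//; apply: cmax; rewrite in_itv/=.
  have st1 : `|s - t| <= 1 by rewrite ler_norml; apply/andP; split; lra.
  have := le_trans xt st1; rewrite ler_norml => /andP[? ?].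
  by apply/andP; split; lra.
have [L1 L10 H1] := dbound _ sg1; have [L2 L20 H2] := dbound _ sg2.
have gaE : range ga = ga @` `[0, 1]%classic.
  apply/seteqP; split=> [_ [t _ <-]|_ [t _ <-]]; last by exists t.
  have /andP[k0 k1] := frac_bounds t.
  exists (t - (Num.floor t)%:~R); first by rewrite /= in_itv/= k0 ltW.
  by rewrite /ga -mulrNz periodic_int.
exists (range ga : set (meas2 R)); last split => //.
  apply: closed_measurable2; rewrite gaE; apply: compact_closed.
    exact: norm_hausdorff.
  by apply: continuous_compact;
    [exact: continuous_subspaceT|exact: segment_compact].
rewrite gaE; apply: (@lipschitz_curve_null ga (`|h| * (L1 + L2))) => //.
  by rewrite mulr_ge0// addr_ge0.
move=> s t s01 t01.
rewrite (_ : ga s - ga t = h *: (g s - g t)); last first.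
  by rewrite /ga opprD addrACA subrr add0r scalerBr.
rewrite normrZ -mulrA ler_wpM2l// prod_normE ge_max; apply/andP; split.
  apply: (le_trans (H1 _ _ s01 t01)); rewrite ler_wpM2r// lerDl//.
by apply: (le_trans (H2 _ _ s01 t01)); rewrite ler_wpM2r// lerDr.
Qed.

End null_curve.

(** * The weighted inequality in the plane *)

Section weight.
Variable R : realType.
Variables (J : nat) (P : 'I_J -> R * R).

Lemma enorm_ge (y : R * R) : `|y| <= enorm y.
Proof.
rewrite prod_normE ge_max /enorm -(sqrtr_sqr y.1) -(sqrtr_sqr y.2).
by rewrite !ler_wsqrtr// ?lerDl ?lerDr sqr_ge0.
Qed.

Lemma enorm_le (y : R * R) : enorm y <= 2 * `|y|.
Proof.
rewrite -[leRHS]ger0_norm ?mulr_ge0// -sqrtr_sqr ler_wsqrtr//.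
have : `|y.1| <= `|y| by rewrite prod_normE le_max lexx.
have : `|y.2| <= `|y| by rewrite prod_normE le_max lexx orbT.
by move=> /sqr_le_bound + /sqr_le_bound; rewrite exprMn; have := sqr_ge0 `|y|; lra.
Qed.

Lemma rdist_cases (y : R * R) :
  rdist P y = 1 \/ exists k, rdist P y = enorm (y - P k).
Proof.
rewrite /rdist; elim/big_ind: _ => [|a b Ha Hb|k _].
- by left.
- by rewrite minEle; case: ifP.
- by right; exists k.
Qed.

Lemma rdist_ge0 (y : R * R) : 0 <= rdist P y.
Proof. by case: (rdist_cases y) => [|[k]] ->//; exact: sqrtr_ge0. Qed.

Lemma rdist_measurable : measurable_fun (setT : set (meas2 R)) (rdist P : meas2 R -> R).
Proof.
rewrite /rdist; elim: (index_enum _) => [|k s IHs].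
  by under eq_fun do rewrite big_nil; exact: measurable_cst.
under eq_fun do rewrite big_cons.
apply: measurable_minr => //; apply: continuous_measurable2 => y.
apply: (@continuous_comp _ _ _ (fun y : R * R =>
  (y - P k).1 ^+ 2 + (y - P k).2 ^+ 2) Num.sqrt); last exact: sqrt_continuous.
apply: ctsD; apply: continuous_sqr; apply: ctsD; try exact: ctsK.
- exact: cvg_fst.
- exact: cvg_snd.
Qed.

Definition rweight (y : R * R) : R :=
  (rdist P y)^-1 * (1 + `|ln (rdist P y)|)^-1.

Lemma rweight_ge0 y : 0 <= rweight y.
Proof. by rewrite mulr_ge0 ?invr_ge0 ?rdist_ge0// addr_ge0. Qed.

Lemma rweight_measurable :
  measurable_fun (setT : set (meas2 R)) (rweight : meas2 R -> R).
Proof.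
have mr := rdist_measurable.
apply: measurable_funM.
  by apply: measurable_fun_inv => // y _; exact: rdist_ge0.
apply: measurable_fun_inv => //.
apply: measurable_funD => //.
apply: (@measurableT_comp _ _ _ _ _ _ (Num.norm : R -> R)).
  exact: normr_measurable.
by apply: (@measurableT_comp _ _ _ _ _ _ (@ln R)) => //; exact: measurable_ln.
Qed.

Lemma rweight_le_inv y (a : R) : 0 < a -> a <= rdist P y -> rweight y <= a^-1.
Proof.
move=> a0 ar; have r0 := lt_le_trans a0 ar.
apply: (@le_trans _ _ (rdist P y)^-1); last by rewrite lef_pV2.
apply: ler_piMr; first by rewrite invr_ge0 ltW.
by rewrite invf_le1 ?lerDl// ltr_wpDr.
Qed.

(** The cases are: [rdist] equal to 1; nearest centre P k, but farther than rho k / 2; close to P k.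
    The Euclidean distance r in [rdist] and the sup-norm distance d in [log_weight] satisfy d <= r
    <= 2 d, which costs the factors 2. *)
Lemma rweight_bound (rho : 'I_J -> R) (n : R) (y : R * R) : 0 <= n ->
  (forall k, 0 < rho k <= 1) -> expR (- n) <= rdist P y ->
  rweight y <= 1 \/ exists k,
    rweight y <= 2 / rho k \/
    (annulus (P k) (expR (- (n + 1)) * rho k) (rho k / 2) y /\
     rweight y <= 2 * log_weight (P k) (rho k) y).
Proof.
move=> n0 rho01 nr; have r0 : 0 < rdist P y by rewrite (lt_le_trans _ nr)// expR_gt0.
have [r1|[k rk]] := rdist_cases y.
  left; rewrite -(invr1 R); apply: rweight_le_inv; by rewrite ?r1.
right; exists k; have /andP[rho0 rho1] := rho01 k.
pose d := `|y - P k|.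
have dr : d <= rdist P y by rewrite rk enorm_ge.
have rd : rdist P y <= 2 * d by rewrite rk enorm_le.
have d0 : 0 < d by lra.
have [drho|drho] := leP d (rho k / 2); last first.
  left; rewrite -[2 / _]invrK invf_div; apply: rweight_le_inv.
    by rewrite divr_gt0.
  by rewrite (le_trans _ dr)// ltW.
right; split.
  apply/andP; split=> //; rewrite -/d.
  (* From e^(-n) <= r <= 2 d one gets e^(-(n + 1)) <= d since e >= 2; this is why the inner radius
     involves n + 1. *)
  have e2 : 2 <= expR 1 :> R by have := @expR_ge1Dx R 1; lra.
  apply: (@le_trans _ _ (expR (- (n + 1)))).
    by rewrite ler_piMr// expR_ge0.
  rewrite opprD expRD expRN (expRN 1) -expRN ler_pdivrMr ?expR_gt0//.
  rewrite (le_trans nr)// (le_trans rd)// mulrC ler_wpM2l// ltW//.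
pose tau := ln (rho k / d).
have tau0 : 0 <= tau by rewrite ln_ge0// ler_pdivlMr//; lra.
(* Since rho k <= 1 and ln 2 <= 1, the normalization and the change of norm cost at most 1, so 1 +
   tau <= 2 (1 + |ln r|). *)
have tauE : tau <= 1 + `|ln (rdist P y)|.
  have -> : tau = ln (rho k) - ln d by rewrite /tau ln_div// posrE.
  have l1 : ln (rho k) <= 0 by rewrite ln_le0.
  have l2 : ln (rdist P y) <= ln 2 + ln d.
    by rewrite -lnM ?posrE// ler_ln ?posrE// mulr_gt0.
  have l3 : ln 2 <= 1 :> R by rewrite (_ : 2 = 1 + 1)//; apply: le_ln1Dx; lra.
  have := ler_norm (- ln (rdist P y)); rewrite normrN; lra.
rewrite /log_weight -/d -/tau mulrCA /rweight.
apply: ler_pM; rewrite ?invr_ge0 ?(ltW r0)//.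
- by rewrite lef_pV2.
- rewrite -[2]invrK -invfM lef_pV2 ?posrE; last 2 first.
  + by rewrite ltr_wpDr.
  + by rewrite mulr_gt0// ltr_wpDr.
  by have := normr_ge0 (ln (rdist P y)); lra.
Qed.

End weight.

Section plane_inequality.
Variable R : realType.
Variables (J : nat) (P : 'I_J -> R * R) (U : set (R * R)).

Lemma measurable_mul_indic d (T : measurableType d) (A : set T) (f : T -> R) :
  measurable A -> measurable_fun A f ->
  measurable_fun setT (fun x => f x * \1_A x).
Proof.
move=> mA /(measurable_restrictT _ mA).1; congr (measurable_fun _ _).
apply/funext => x; rewrite patchE indicE.
by case: (x \in A); rewrite ?mulr1 ?mulr0.
Qed.

(** The three cases are replaced by the sum of all their nonnegative bounds, which can be integrated
    term by term without partitioning the plane. *)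
Lemma rweight_sqr_bound (rho : 'I_J -> R) (n : R) (y : R * R) (v : R) : 0 <= n ->
  (forall k, 0 < rho k <= 1) -> expR (- n) <= rdist P y ->
  (rweight P y * v) ^+ 2 <=
    v ^+ 2 * (1 + \sum_(k < J) (2 / rho k) ^+ 2) +
    \sum_(k < J) 4 * ((log_weight (P k) (rho k) y * v) ^+ 2 *
      \1_(annulus (P k) (expR (- (n + 1)) * rho k) (rho k / 2)) y).
Proof.
move=> n0 rho01 nr; set S1 := \sum_(k < J) (2 / rho k) ^+ 2.
pose F k := 4 * ((log_weight (P k) (rho k) y * v) ^+ 2 *
  \1_(annulus (P k) (expR (- (n + 1)) * rho k) (rho k / 2)) y).
rewrite -/(\sum_(k < J) F k); set S2 := \sum_(k < J) F k.
have S10 : 0 <= S1 by apply: sumr_ge0 => k _; exact: sqr_ge0.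
have F0 k : 0 <= F k.
  by rewrite /F mulr_ge0// mulr_ge0 ?sqr_ge0// indicE.
have S20 : 0 <= S2 by exact: sumr_ge0.
have v0 := sqr_ge0 v; have w0 := rweight_ge0 P y.
have vS : 0 <= v ^+ 2 * S1 by rewrite mulr_ge0.
rewrite mulrDr mulr1 exprMn.
have [w1|[k [w1|[ann w1]]]] := rweight_bound n0 rho01 nr.
- have : rweight P y ^+ 2 * v ^+ 2 <= v ^+ 2.
    by rewrite ler_piMl// expr_le1.
  lra.
- have : rweight P y ^+ 2 * v ^+ 2 <= v ^+ 2 * S1.
    rewrite mulrC ler_wpM2l// /S1 (bigD1 k)//=.
    apply: (@le_trans _ _ ((2 / rho k) ^+ 2)).
      by rewrite ler_sqr ?nnegrE// (le_trans w0 w1).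
    by rewrite lerDl sumr_ge0// => i _; exact: sqr_ge0.
  lra.
- have : rweight P y ^+ 2 * v ^+ 2 <= S2.
    rewrite /S2 (bigD1 k)//=; apply: (@le_trans _ _ (F k)).
      rewrite /F indicE mem_set// mulr1.
      rewrite [leRHS](_ : _ = (2 * log_weight (P k) (rho k) y) ^+ 2 * v ^+ 2);
        last by ring.
      by apply: ler_wpM2r => //; rewrite ler_sqr ?nnegrE// (le_trans w0 w1).
    by rewrite lerDl sumr_ge0.
  lra.
Qed.

Definition far (n : R) : set (R * R) := [set y | expR (- n) <= rdist P y].

Lemma far_measurable n : measurable (far n : set (meas2 R)).
Proof.
rewrite (_ : far n = setT `&` (rdist P : meas2 R -> R) @^-1` `[expR (- n), +oo[).
  by apply: rdist_measurable => //; exact: measurable_itv.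
by rewrite setTI; apply/seteqP; split=> y; rewrite /far/= in_itv/= andbT.
Qed.

(** The constant precedes T: the bound is uniform in the inner radius, as needed to remove the
    cut-off around p. *)
Lemma annulus_control p (rho : R) : 0 < rho -> sq p rho `<=` U ->
  measurable (U : set (meas2 R)) ->
  exists2 C : R, 0 <= C & forall (T : R) (w d1 d2 : R * R -> R), 0 <= T ->
    C1_plane w d1 d2 ->
    (\int[leb2 R]_(y in annulus p (expR (- T) * rho) (rho / 2))
       ((log_weight p rho y * w y) ^+ 2)%:E <=
     C%:E * (sqint U w + gradint U d1 d2))%E.
Proof.
move=> rho0 pU mU; have r2 : 0 < 3 / 8 * rho ^+ 2 by rewrite mulr_gt0// exprn_gt0.
have r4 : 0 <= 4 * rho ^+ 2 by rewrite mulr_ge0// sqr_ge0.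
exists ((3 / 8 * rho ^+ 2)^-1 * (2 + 4 * rho ^+ 2)).
  by rewrite mulr_ge0 ?invr_ge0 ?(ltW r2)// addr_ge0.
move=> T w d1 d2 T0 C1w; have [cw cd1 cd2 _ _] := C1w.
have := log_hardy_sq p C1w rho0 T0.
set X := (\int[_]_(_ in _) _)%E => H.
rewrite EFinM -muleA -lee_pdivrMl// ; last by rewrite invr_gt0.
rewrite invrK; apply: (le_trans H).
have mQ : measurable (sq p rho : set (meas2 R)) by exact: sq_measurable.
have S1 : (sqint (sq p rho) w <= sqint U w)%E by exact: le_sqint.
have G1 : (gradint (sq p rho) d1 d2 <= gradint U d1 d2)%E by exact: le_gradint.
rewrite [leRHS]ge0_muleDr ?sqint_ge0 ?gradint_ge0//; apply: leeD.
  apply: (@le_trans _ _ (2%:E * sqint U w)%E); first exact: lee_wpmul2l.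
  by apply: lee_wpmul2r; rewrite ?sqint_ge0// lee_fin lerDl.
apply: (@le_trans _ _ ((4 * rho ^+ 2)%:E * gradint U d1 d2)%E).
  by apply: lee_wpmul2l; rewrite ?lee_fin.
by apply: lee_wpmul2r; rewrite ?gradint_ge0// lee_fin lerDr.
Qed.

Lemma rweight_control : open U -> (forall k, U (P k)) ->
  exists2 C : R, 0 <= C & forall (n : R) (w d1 d2 : R * R -> R), 0 <= n ->
    C1_plane w d1 d2 ->
    (\int[leb2 R]_(y in U `&` far n) ((rweight P y * w y) ^+ 2)%:E <=
     C%:E * (sqint U w + gradint U d1 d2))%E.
Proof.
move=> oU PU; have mU : measurable (U : set (meas2 R)) by exact: open_measurable2.
have /choice[rho rhoP] : forall k, exists rho : R, 0 < rho <= 1 /\ sq (P k) rho `<=` U.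
  move=> k; have [e e0 eU] := open_sq oU (PU k); exists (Num.min e 1); split.
    by rewrite lt_min e0 ltr01 ge_min lexx orbT.
  by apply: subset_trans eU; apply: sq_mono; rewrite ge_min lexx.
have rho01 k : 0 < rho k <= 1 by have [] := rhoP k.
have /choice[A AP] : forall k, exists A : R, 0 <= A /\
    forall (T : R) (w d1 d2 : R * R -> R), 0 <= T -> C1_plane w d1 d2 ->
    (\int[leb2 R]_(y in annulus (P k) (expR (- T) * rho k) (rho k / 2))
       ((log_weight (P k) (rho k) y * w y) ^+ 2)%:E <=
     A%:E * (sqint U w + gradint U d1 d2))%E.
  move=> k; have /andP[r0 _] := rho01 k; have [_ rU] := rhoP k.
  by have [C C0 H] := annulus_control r0 rU mU; exists C.
pose K := 1 + \sum_(k < J) (2 / rho k) ^+ 2.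
have K0 : 0 <= K by rewrite addr_ge0// sumr_ge0// => k _; exact: sqr_ge0.
exists (K + \sum_(k < J) 4 * A k).
  by rewrite addr_ge0// sumr_ge0// => k _; rewrite mulr_ge0//; have [] := AP k.
move=> n w d1 d2 n0 C1w; have [cw cd1 cd2 _ _] := C1w.
have mw : measurable_fun setT (w : meas2 R -> R) by exact: continuous_measurable2.
have n1 : 0 <= n + 1 by rewrite addr_ge0.
set Y := (sqint U w + gradint U d1 d2)%E.
have Y0 : (0 <= Y)%E by rewrite adde_ge0 ?sqint_ge0 ?gradint_ge0.
pose ann k := annulus (P k) (expR (- (n + 1)) * rho k) (rho k / 2).
have mann k : measurable (ann k : set (meas2 R)) by exact: annulus_measurable.
pose F k y := 4 * ((log_weight (P k) (rho k) y * w y) ^+ 2 * \1_(ann k) y).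
have F0 k y : 0 <= F k y by rewrite mulr_ge0// mulr_ge0 ?sqr_ge0// indicE.
have mF k : measurable_fun setT (F k : meas2 R -> R).
  apply: measurable_funM => //; apply: measurable_mul_indic => //.
  apply: measurable_funX; apply: measurable_funM; last exact: measurable_funTS.
  have /andP[r0 _] := rho01 k.
  by apply: log_weight_measurable => //; rewrite mulr_gt0// expR_gt0.
have mwK : measurable_fun setT (fun y : meas2 R => w y ^+ 2 * K * \1_U y).
  apply: measurable_funM; last exact: measurable_indic.
  by apply: measurable_funM => //; exact: measurable_funX.
have mfar := far_measurable n.
apply: (@le_trans _ _ (\int[leb2 R]_y ((w y ^+ 2 * K * \1_U y)%:E +
    \sum_(k < J) (F k y)%:E))%E).
  rewrite integral_mkcond; apply: ge0_le_integral => //.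
  - by move=> y _; apply: erestrict_ge0 => z _; rewrite lee_fin sqr_ge0.
  - apply/(measurable_restrictT _ _).1; first exact: measurableI.
    apply/measurable_EFinP; apply: measurable_funTS; apply: measurable_funX.
    by apply: measurable_funM => //; exact: rweight_measurable.
  - apply: emeasurable_funD; first exact/measurable_EFinP.
    by apply: emeasurable_sum => k; exact/measurable_EFinP.
  - move=> y _; rewrite sumEFin -EFinD patchE; case: ifPn => [|_]; last first.
      rewrite lee_fin addr_ge0// ?sumr_ge0//.
      by rewrite mulr_ge0 ?indicE// mulr_ge0// sqr_ge0.
    move=> /set_mem[Uy fy]; rewrite lee_fin indicE mem_set// mulr1.
    exact: rweight_sqr_bound.
rewrite ge0_integralD//; last 4 first.
- by move=> y _; rewrite lee_fin mulr_ge0 ?indicE// mulr_ge0// sqr_ge0.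
- exact/measurable_EFinP.
- by move=> y _; apply: sume_ge0 => k _; rewrite lee_fin.
- by apply: emeasurable_sum => k; exact/measurable_EFinP.
rewrite ge0_integral_sum//; last 2 first.
- by move=> k; exact/measurable_EFinP.
- by move=> k y _; rewrite lee_fin.
rewrite EFinD [leRHS]ge0_muleDl ?lee_fin ?sumr_ge0//; last first.
  by move=> k _; rewrite mulr_ge0//; have [] := AP k.
apply: leeD.
  rewrite -(integral_indic_mul _ _ mU).
  under eq_integral do rewrite mulrC EFinM.
  rewrite ge0_integralZl//; last 2 first.
  - by apply: measurable_funTS; exact: sqr_measurable.
  - by move=> y _; rewrite lee_fin sqr_ge0.
  by apply: lee_wpmul2l; rewrite ?lee_fin// /Y leeDl// gradint_ge0.
rewrite -sumEFin ge0_sume_distrl; last first.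
  by move=> k _; rewrite lee_fin mulr_ge0//; have [] := AP k.
apply: lee_sum => k _; have [Ak0 HA] := AP k.
rewrite EFinM -muleA; apply: le_trans (lee_wpmul2l _ (HA _ _ _ _ n1 C1w)) => //.
rewrite (integral_indic_mul _ _ (mann k)) -ge0_integralZl//.
  apply/measurable_EFinP; apply: measurable_mul_indic => //.
  apply: measurable_funX; apply: measurable_funM; last exact: measurable_funTS.
  have /andP[r0 _] := rho01 k.
  by apply: log_weight_measurable => //; rewrite mulr_gt0// expR_gt0.
by move=> y _; rewrite lee_fin mulr_ge0 ?sqr_ge0// indicE.
Qed.

End plane_inequality.

Section junction_plane.
Variable R : realType.
Variables (J : nat) (P : 'I_J -> R * R) (omega0 : set (R * R)).
Variable omega : 'I_J -> set (R * R).

Lemma open_omegah h j : open (omega j) -> open (omegah omega P h j).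
Proof.
move=> oj; apply: (@open_comp _ _ (fun y : R * R => h^-1 *: (y - P j)) (omega j)) => //.
move=> y _; apply: cvgZl_tmp; apply: cvgB; [exact: cvg_id|exact: cvg_cst].
Qed.

Lemma sq_omegah h j e : 0 < h -> sq (0, 0) e `<=` omega j ->
  sq (P j) (e * h) `<=` omegah omega P h j.
Proof.
move=> h0 ej y; rewrite /sq/= => ye; apply: ej.
rewrite /sq/= (_ : _ - (0, 0) = h^-1 *: (y - P j)); last by rewrite subr0.
by rewrite normrZ gtr0_norm ?invr_gt0// ler_pdivrMl// mulrC.
Qed.

(* Dilating a fixed square about [P j] down to size [h] takes time of order
   [1 + |ln h|], and squares the area factor [h^-1]. *)
Lemma plane_inequality j h0 : smooth_contour_domain omega0 ->
  (forall k, omega0 (P k)) -> open (omega j) -> omega j (0, 0) -> 0 < h0 ->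
  exists2 C : R, 0 <= C & forall (h n : R) (w d1 d2 : R * R -> R),
    0 < h <= h0 -> 0 <= n -> C1_plane w d1 d2 ->
    (\int[leb2 R]_(y in omega0 `&` far P n) ((rweight P y * w y) ^+ 2)%:E <=
     C%:E * ((h ^- 2)%:E * sqint (omegah omega P h j) w +
       ((1 + `|ln h|) ^+ 2)%:E * gradint omega0 d1 d2))%E.
Proof.
move=> dom0 P0 oj j00 h0_gt0; have [oo0 _ _ _] := dom0.
have m0 : measurable (omega0 : set (meas2 R)) by exact: open_measurable2.
have [C1 C10 H1] := rweight_control oo0 P0.
have [rho rho0 rhoU] := open_sq oo0 (P0 j).
have [C2 C20 H2] := contour_domain_control dom0 (P0 j) rho0 rhoU.
have [e' e'0 e'j] := open_sq oj j00.
(* The second bound gives e h <= rho for all h <= h0, so that the dilation time T is nonnegative. *)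
pose e := Num.min e' (rho / h0).
have e0 : 0 < e by rewrite lt_min e'0 divr_gt0.
have ej : sq (0, 0) e `<=` omega j.
  by apply: subset_trans e'j; apply: sq_mono; rewrite ge_min lexx.
(* With e^T = rho / (e h), the first coefficient 2 e^(2T) of [le_dilate] is a h^-2. The second, 8 (T
   rho)^2, is at most b (1 + |ln h|)^2, because T = ln (rho / e) - ln h <= (1 + |ln (rho / e)|) (1 +
   |ln h|). *)
pose a := 2 * (rho / e) ^+ 2.
pose b := 8 * ((1 + `|ln (rho / e)|) * rho) ^+ 2.
have a0 : 0 <= a by rewrite mulr_ge0// sqr_ge0.
have b0 : 0 <= b by rewrite mulr_ge0// sqr_ge0.
exists (C1 * (C2 * ((a + b) + 1) + 1)).
  by rewrite mulr_ge0// addr_ge0// mulr_ge0// !addr_ge0.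
move=> h n w d1 d2 /andP[h_gt0 hh0] n0 C1w; have [cw cd1 cd2 _ _] := C1w.
have mh : measurable (omegah omega P h j : set (meas2 R)).
  by apply: open_measurable2; exact: open_omegah.
set L := (1 + `|ln h|) ^+ 2.
have L1 : 1 <= L by rewrite exprn_ege1// lerDl.
have L0 : 0 <= L by exact: le_trans ler01 L1.
set S := sqint (omegah _ _ _ _) w; set G := gradint omega0 d1 d2.
set Y := (_ * S + _ * G)%E.
have S0 : (0 <= S)%E by exact: sqint_ge0.
have G0 : (0 <= G)%E by exact: gradint_ge0.
have h20 : 0 <= h ^- 2 by rewrite invr_ge0 sqr_ge0.
have Y0 : (0 <= Y)%E by rewrite adde_ge0// mule_ge0// lee_fin.
have GY : (G <= Y)%E.
  apply: (@le_trans _ _ (L%:E * G)%E).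
    by rewrite -{1}(mul1e G) lee_wpmul2r// lee_fin.
  by rewrite leeDr// mule_ge0// lee_fin.
have SqY : (sqint (sq (P j) rho) w <= (a + b)%:E * Y)%E.
  have eh0 : 0 < e * h by rewrite mulr_gt0.
  pose T := ln (rho / (e * h)).
  have TE : expR T = rho / (e * h) by rewrite lnK// posrE divr_gt0.
  have T0 : 0 <= T.
    rewrite ln_ge0// ler_pdivlMr// mul1r (@le_trans _ _ (rho / h0 * h))//.
      by rewrite ler_wpM2r ?(ltW h_gt0)// ge_min lexx orbT.
    by rewrite -mulrA ler_piMr ?(ltW rho0)// mulrC ler_pdivrMr// mul1r.
  have := le_dilate (P j) C1w (ltW rho0) T0.
  have -> : expR (- T) * rho = e * h.
    by rewrite expRN TE; field; rewrite !gt_eqF.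
  move=> /le_trans; apply.
  rewrite EFinD ge0_muleDl ?lee_fin//; apply: leeD.
    have -> : 2 * expR T ^+ 2 = a * h ^- 2.
      by rewrite TE /a; field; rewrite !gt_eqF.
    rewrite EFinM -muleA lee_wpmul2l ?lee_fin//.
    apply: (@le_trans _ _ ((h ^- 2)%:E * S)%E); last first.
      by rewrite leeDl// mule_ge0// lee_fin.
    rewrite lee_wpmul2l ?lee_fin//; apply: le_sqint => //.
      exact: sq_measurable.
    exact: sq_omegah.
  apply: (@le_trans _ _ (b%:E * (L%:E * G))%E); last first.
    by rewrite lee_wpmul2l ?lee_fin// leeDr// mule_ge0// lee_fin.
  rewrite muleA -EFinM; apply: (@le_trans _ _ ((b * L)%:E *
      gradint (sq (P j) rho) d1 d2)%E); last first.
    apply: lee_wpmul2l; first by rewrite lee_fin mulr_ge0.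
    by apply: le_gradint => //; exact: sq_measurable.
  rewrite lee_wpmul2r ?gradint_ge0// lee_fin /b /L -mulrA ler_pM2l//.
  rewrite -exprMn ler_sqr ?nnegrE ?mulr_ge0 ?addr_ge0 ?(ltW rho0)//.
  rewrite mulrAC ler_wpM2r ?(ltW rho0)//.
  have -> : T = ln (rho / e) - ln h.
    by rewrite /T -ln_div ?posrE ?divr_gt0//; congr ln; field; rewrite !gt_eqF.
  have := ler_norm (ln (rho / e)); have := ler_norm (- ln h); rewrite normrN.
  have : 0 <= `|ln (rho / e)| * `|ln h| by rewrite mulr_ge0.
  lra.
have S0Y : (sqint omega0 w <= (C2 * ((a + b) + 1))%:E * Y)%E.
  apply: (le_trans (H2 _ _ _ C1w)); rewrite EFinM -muleA lee_wpmul2l ?lee_fin//.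
  rewrite EFinD ge0_muleDl ?lee_fin ?addr_ge0// mul1e.
  exact: leeD.
apply: (le_trans (H1 _ _ _ _ n0 C1w)).
rewrite EFinM -muleA lee_wpmul2l ?lee_fin//.
rewrite [(_ + 1)%:E]EFinD ge0_muleDl ?lee_fin ?mulr_ge0 ?addr_ge0// mul1e.
exact: leeD.
Qed.

End junction_plane.

(** * Smooth functions on plates and rods *)

Section tonelli.
Variable R : realType.
Notation leb := (@lebesgue_measure R).

Lemma ge0_tonelli_setX (A : set (meas2 R)) (I : set (measurableTypeR R))
    (f : meas3 R -> R) : measurable A -> measurable I ->
  measurable_fun (A `*` I) f -> (forall x, 0 <= f x) ->
  (\int[leb3 R]_(x in A `*` I) (f x)%:E =
     \int[leb2 R]_(y in A) \int[leb]_(z in I) (f (y, z))%:E)%E /\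
  (\int[leb3 R]_(x in A `*` I) (f x)%:E =
     \int[leb]_(z in I) \int[leb2 R]_(y in A) (f (y, z))%:E)%E.
Proof.
move=> mA mI mf f0; have mAI : measurable (A `*` I) by exact: measurableX.
pose F (x : meas3 R) := (f x * \1_(A `*` I) x)%:E.
have mF : measurable_fun setT F.
  by apply/measurable_EFinP; exact: measurable_mul_indic.
have F0 x : (0 <= F x)%E by rewrite lee_fin mulr_ge0 ?indicE.
have indX (y : meas2 R) (z : measurableTypeR R) :
    \1_(A `*` I) (y, z) = \1_A y * \1_I z :> R.
  by rewrite !indicE in_setX/=; case: (y \in A); case: (z \in I);
    rewrite /= ?mulr1 ?mulr0.
rewrite (integral_indic_mul _ _ mAI); split.
  rewrite /leb3 fubini_tonelli1// [RHS]integral_mkcond.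
  apply: eq_integral => y _; rewrite patchE /fubini_F/=.
  case: ifPn => yA.
    rewrite (integral_indic_mul _ _ mI); apply: eq_integral => z _.
    by rewrite /F indX indicE yA mul1r.
  by rewrite integral0_eq// => z _; rewrite /F indX indicE (negbTE yA) mul0r mulr0.
rewrite /leb3 fubini_tonelli2// [RHS]integral_mkcond.
apply: eq_integral => z _; rewrite patchE /fubini_G/=.
case: ifPn => zI.
  rewrite (integral_indic_mul _ _ mA); apply: eq_integral => y _.
  by rewrite /F indX [\1_I z]indicE zI mulr1.
rewrite integral0_eq// => y _.
by rewrite /F indX [\1_I z]indicE (negbTE zI) mulr0 mulr0.
Qed.

End tonelli.

Definition ax0 : 'I_3 := @Ordinal 3 0 isT.
Definition ax1 : 'I_3 := @Ordinal 3 1 isT.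
Definition ax2 : 'I_3 := @Ordinal 3 2 isT.

Section slices.
Variable R : realType.
Notation leb := (@lebesgue_measure R).
Variable v : R * R * R -> R.
Hypothesis sv : smooth3 v.

Let dv (i : 'I_3) := 'D_(e3 R i) v.

Lemma smooth3_continuous : continuous v.
Proof. exact: (sv 0%N). Qed.

Lemma smooth3_derivable i x : derivable v x (e3 R i).
Proof. by have [_ /(_ i)[]] := sv 1%N. Qed.

Lemma smooth3_continuous_derive i : continuous (dv i).
Proof. by have [_ /(_ i)[]] := sv 1%N. Qed.

Lemma is_derive_line (i : 'I_3) (x : R * R * R) (ga : R -> R * R * R) (t : R) :
  ga t = x -> (forall s, ga (s + t) = s *: e3 R i + x) ->
  is_derive t (1 : R) (v \o ga) (dv i x).
Proof.
move=> gat gas.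
have E : (fun h : R => h^-1 *: (((v \o ga) \o shift t) (h *: 1) - (v \o ga) t)) =
         (fun h : R => h^-1 *: ((v \o shift x) (h *: e3 R i) - v x)).
  by apply/funext => h; rewrite /= gat /GRing.scale/= mulr1 gas.
apply: DeriveDef.
  by rewrite /derivable E; exact: smooth3_derivable.
by rewrite /derive E.
Qed.

Lemma slice_plane (z : R) :
  C1_plane (fun y => v (y, z)) (fun y => dv ax0 (y, z)) (fun y => dv ax1 (y, z)).
Proof.
have cs (f : R * R * R -> R) : continuous f -> continuous (fun y => f (y, z)).
  move=> cf y; apply: (@continuous_comp _ _ _ (fun y => (y, z)) f); last exact: cf.
  by apply: ctsP; [exact: cvg_id|exact: cvg_cst].
split.
- exact: (cs _ smooth3_continuous).
- exact: (cs (dv ax0) (@smooth3_continuous_derive ax0)).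
- exact: (cs (dv ax1) (@smooth3_continuous_derive ax1)).
- move=> y; apply: (@is_derive_line ax0 (y, z) (fun t => (t, y.2, z))).
    by rewrite -surjective_pairing.
  move=> s; apply: injective_projections => /=; [apply: injective_projections|];
    by rewrite /= /GRing.scale/= ?mulr1 ?mulr0 ?add0r.
- move=> y; apply: (@is_derive_line ax1 (y, z) (fun t => (y.1, t, z))).
    by rewrite -surjective_pairing.
  move=> s; apply: injective_projections => /=; [apply: injective_projections|];
    by rewrite /= /GRing.scale/= ?mulr1 ?mulr0 ?add0r.
Qed.

Lemma slice_line (y : R * R) (z : R) :
  is_derive z (1 : R) (fun t => v (y, t)) (dv ax2 (y, z)).
Proof.
apply: (@is_derive_line ax2 (y, z) (fun t => (y, t))) => // s.
apply: injective_projections => /=; [apply: injective_projections|];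
  by rewrite /= /GRing.scale/= ?mulr1 ?mulr0 ?add0r.
Qed.

Lemma slice_line_continuous (y : R * R) : continuous (fun t => dv ax2 (y, t)).
Proof.
move=> t; apply: (@continuous_comp _ _ _ (fun t => (y, t)) (dv ax2)).
  by apply: ctsP; [exact: cvg_cst|exact: cvg_id].
exact: smooth3_continuous_derive.
Qed.

End slices.

Section smooth_estimates.
Variable R : realType.
Notation leb := (@lebesgue_measure R).
Variable v : R * R * R -> R.
Hypothesis sv : smooth3 v.
Notation dv i := ('D_(e3 R i) v).
Local Open Scope ereal_scope.

Let mv : measurable_fun setT (v : meas3 R -> R).
Proof. by apply: continuous_measurable3; exact: smooth3_continuous. Qed.

Let mdv i : measurable_fun setT (dv i : meas3 R -> R).
Proof. by apply: continuous_measurable3; exact: smooth3_continuous_derive. Qed.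

Let msq (f : meas3 R -> R) (X : set (meas3 R)) : measurable_fun setT f ->
  measurable_fun X (fun x => (f x ^+ 2)%R).
Proof. by move=> mf; apply: measurable_funTS; exact: measurable_funX. Qed.

Let msl (f : meas3 R -> R) (X : set (meas2 R)) (z : R) : measurable_fun setT f ->
  measurable_fun X (fun y => ((f (y, z)) ^+ 2)%R).
Proof.
move=> mf; apply: measurable_funTS; apply: measurable_funX.
exact: measurable_fun_pair1.
Qed.

Lemma measurable_line_int (f : meas3 R -> R) (I : set (measurableTypeR R)) :
  measurable I -> measurable_fun setT f -> (forall x, 0 <= f x)%R ->
  measurable_fun (setT : set (meas2 R)) (fun y => \int[leb]_(z in I) (f (y, z))%:E).
Proof.
move=> mI mf f0.
rewrite (_ : (fun y => _) = (fun y => \int[leb]_z (f (y, z) * \1_I z)%:E)).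
  have mF : measurable_fun setT (fun x : meas3 R => (f x * \1_I x.2)%:E).
    apply/measurable_EFinP; apply: measurable_funM => //.
    apply: (@measurableT_comp _ _ _ _ _ _ (\1_I : _ -> R)).
      exact: measurable_indic.
    exact: measurable_snd.
  have := @measurable_fun_fubini_tonelli_F _ _ _ _ _ leb _ mF.
  by apply => x; rewrite lee_fin mulr_ge0 ?indicE.
by apply/funext => y; rewrite (integral_indic_mul _ _ mI).
Qed.

Lemma measurable_slice_int (A : set (meas2 R)) (f : meas3 R -> R) :
  measurable A -> measurable_fun setT f -> (forall x, 0 <= f x)%R ->
  measurable_fun (setT : set (measurableTypeR R))
    (fun z => \int[leb2 R]_(y in A) (f (y, z))%:E).
Proof.
move=> mA mf f0.
rewrite (_ : (fun z => _) = (fun z => \int[leb2 R]_y (f (y, z) * \1_A y)%:E)).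
  have mF : measurable_fun setT (fun x : meas3 R => (f x * \1_A x.1)%:E).
    apply/measurable_EFinP; apply: measurable_funM => //.
    apply: (@measurableT_comp _ _ _ _ _ _ (\1_A : _ -> R)).
      exact: measurable_indic.
    exact: measurable_fst.
  have := @measurable_fun_fubini_tonelli_G _ _ _ _ _ (leb2 R) _ mF.
  by apply => x; rewrite lee_fin mulr_ge0 ?indicE.
by apply/funext => z; rewrite (integral_indic_mul _ _ mA).
Qed.

Lemma rod_tonelli (A : set (meas2 R)) (l c : R) : (0 <= c)%R -> measurable A ->
  \int[leb2 R]_(y in A) \int[leb]_(z in `[0%R, l]) (c * dv ax2 (y, z) ^+ 2)%:E =
  c%:E * sqL2 (A `*` `]0%R, l[) (dv ax2).
Proof.
move=> c0 mA; have mI : measurable (`]0%R, l[%classic : set (measurableTypeR R)).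
  exact: measurable_itv.
have mf : measurable_fun setT (fun x : meas3 R => (c * dv ax2 x ^+ 2)%R).
  by apply: measurable_funM => //; exact: measurable_funX.
have [E _] := @ge0_tonelli_setX R A _ (fun x => (c * dv ax2 x ^+ 2)%R) mA mI
  (measurable_funTS mf) (fun x => mulr_ge0 c0 (sqr_ge0 _)).
transitivity (\int[leb3 R]_(x in A `*` `]0%R, l[) (c * dv ax2 x ^+ 2)%:E).
  rewrite E; apply: eq_integral => y _; apply: integral_itv_bndoo.
  apply/measurable_EFinP; apply: measurable_funTS.
  exact: (measurable_fun_pair2 y mf).
under eq_integral do rewrite EFinM.
rewrite ge0_integralZl//.
- exact: measurableX.
- by apply/measurable_EFinP; exact: msq.
- by move=> x _; rewrite lee_fin sqr_ge0.
Qed.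

(** [hardy_end] carries the shifted weight (l + e - z)^-1. Below the cut, l - z >= e, hence (l -
    z)^-1 <= 2 (l + e - z)^-1; squaring multiplies its constants 2 and 4 by 4. *)
Lemma rod_hardy (A : set (meas2 R)) (l e : R) : measurable A ->
  (0 < e)%R -> (0 <= l)%R ->
  \int[leb3 R]_(x in A `*` `]0%R, (l - e)%R[) (((l - x.2)^-1 * v x) ^+ 2)%:E <=
  (8 * e^-1)%:E * \int[leb2 R]_(y in A) (v (y, l) ^+ 2)%:E +
  16%:E * sqL2 (A `*` `]0%R, l[) (dv ax2).
Proof.
move=> mA e0 l0.
have mI : measurable (`]0%R, (l - e)%R[%classic : set (measurableTypeR R)).
  exact: measurable_itv.
have mAI : measurable (A `*` `]0%R, (l - e)%R[) by exact: measurableX.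
(* The truncation at 0 makes the weight measurable on the whole space; it changes nothing where z <=
   c. *)
pose g (c : R) (x : meas3 R) := (((Num.max 0 (c - x.2))^-1 * v x) ^+ 2)%R.
have mg c : measurable_fun setT (g c).
  apply: measurable_funX; apply: measurable_funM => //.
  apply: measurable_fun_inv => // [|x _]; last by rewrite le_max lexx.
  by apply: measurable_maxr => //; apply: measurable_funB.
have g0 c x : (0 <= g c x)%R by exact: sqr_ge0.
have gE c (x : R * R * R) : (x.2 <= c)%R ->
    g c x = (((c - x.2)^-1 * v x) ^+ 2)%R.
  by move=> xc; rewrite /g max_r// subr_ge0.
have -> : \int[leb3 R]_(x in A `*` `]0%R, (l - e)%R[)
    (((l - x.2)^-1 * v x) ^+ 2)%:E =
    \int[leb3 R]_(x in A `*` `]0%R, (l - e)%R[) (g l x)%:E.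
  apply: eq_integral => -[y z] /set_mem[_ /=]; rewrite in_itv/= => /andP[_ zl].
  by rewrite gE//=; lra.
have [-> _] := ge0_tonelli_setX mA mI (measurable_funTS (mg l)) (g0 l).
have md : measurable_fun setT (fun x : meas3 R => (16 * dv ax2 x ^+ 2)%R).
  by apply: measurable_funM => //; exact: measurable_funX.
have md0 x : (0 <= 16 * dv ax2 x ^+ 2)%R by rewrite mulr_ge0// sqr_ge0.
have mint : measurable_fun A
    (fun y => \int[leb]_(z in `[0%R, l]) (16 * dv ax2 (y, z) ^+ 2)%:E).
  by apply: measurable_funTS; apply: (measurable_line_int _ md md0).
have int0 y : 0 <= \int[leb]_(z in `[0%R, l]) (16 * dv ax2 (y, z) ^+ 2)%:E.
  by apply: integral_ge0 => z _; rewrite lee_fin.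
have mvl : measurable_fun A (fun y => (8 * e^-1 * v (y, l) ^+ 2)%:E).
  by apply/measurable_EFinP; apply: measurable_funM => //; exact: msl.
have vl0 y : 0 <= (8 * e^-1 * v (y, l) ^+ 2)%:E.
  by rewrite lee_fin mulr_ge0 ?sqr_ge0// mulr_ge0// invr_ge0 ltW.
rewrite -rod_tonelli// -ge0_integralZl//; last 3 first.
- by apply/measurable_EFinP; exact: msl.
- by move=> y _; rewrite lee_fin sqr_ge0.
- by rewrite lee_fin mulr_ge0// invr_ge0 ltW.
rewrite -ge0_integralD//; last by move=> y _; rewrite -EFinM.
apply: ge0_le_integral => //.
- by move=> y _; apply: integral_ge0 => z _; rewrite lee_fin.
- by apply: measurable_funTS; apply: (measurable_line_int _ (mg l) (g0 l)).
- by apply: emeasurable_funD.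
move=> y _.
have H := hardy_end l0 e0 (slice_line sv y) (@slice_line_continuous R v sv y).
have mgy c : measurable_fun setT (fun z : measurableTypeR R => (g c (y, z))%:E).
  by apply/measurable_EFinP; exact: (measurable_fun_pair2 y (mg c)).
apply: (@le_trans _ _ (4%:E * \int[leb]_(z in `[0%R, l]) (g (l + e) (y, z))%:E)%E).
  rewrite -ge0_integralZl//; last 2 first.
  - exact: measurable_funTS.
  - by move=> z _; rewrite lee_fin.
  apply: (@le_trans _ _ (\int[leb]_(z in `]0%R, (l - e)%R[)
      (4%:E * (g (l + e) (y, z))%:E)%E)).
    apply: ge0_le_integral => //.
    - by move=> z _; rewrite lee_fin.
    - exact: measurable_funTS.
    - by apply: emeasurable_funM => //; exact: measurable_funTS.
    - move=> z /=; rewrite in_itv/= => /andP[z0 zl]; rewrite -EFinM lee_fin.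
      rewrite !gE/=; [|lra|lra].
      rewrite [leRHS](_ : _ = (2 * (l + e - z)^-1 * v (y, z)) ^+ 2)%R;
        last by ring.
      rewrite !(exprMn _ _ (v (y, z))) ler_wpM2r ?sqr_ge0// ler_sqr ?nnegrE;
        last 2 first.
      + by rewrite invr_ge0; lra.
      + by rewrite mulr_ge0// invr_ge0; lra.
      rewrite -[X in (X * _)%R]invrK -invfM lef_pV2 ?posrE; lra.
  apply: ge0_subset_integral => //.
  - by apply: emeasurable_funM => //; exact: measurable_funTS.
  - by move=> z _; rewrite -EFinM lee_fin mulr_ge0.
  - by move=> z /=; rewrite !in_itv/= => /andP[z0 zl]; apply/andP; split; lra.
have -> : \int[leb]_(z in `[0%R, l]) (g (l + e) (y, z))%:E =
    \int[leb]_(z in `[0%R, l]) (((l + e - z)^-1 * v (y, z)) ^+ 2)%:E.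
  apply: eq_integral => z; rewrite inE/= in_itv/= => /andP[_ zl].
  by rewrite gE//=; lra.
apply: (le_trans (lee_wpmul2l _ H)) => //.
rewrite ge0_muleDr//; last 2 first.
- by rewrite lee_fin mulr_ge0// mulr_ge0 ?sqr_ge0// invr_ge0 ltW.
- by apply: integral_ge0 => z _; rewrite lee_fin mulr_ge0// sqr_ge0.
apply: leeD; first by rewrite -EFinM lee_fin; lra.
rewrite -ge0_integralZl//; last 2 first.
- apply/measurable_EFinP; apply: measurable_funTS; apply: measurable_funM => //.
  by apply: measurable_funX; exact: (measurable_fun_pair2 y (mdv ax2)).
- by move=> z _; rewrite lee_fin mulr_ge0// sqr_ge0.
by under eq_integral do rewrite -EFinM mulrA -natrM.
Qed.

Lemma rod_slice (A : set (meas2 R)) (l z : R) : measurable A ->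
  (0 <= z <= l)%R ->
  \int[leb2 R]_(y in A) (v (y, z) ^+ 2)%:E <=
  2%:E * \int[leb2 R]_(y in A) (v (y, l) ^+ 2)%:E +
  (4 * l)%:E * sqL2 (A `*` `]0%R, l[) (dv ax2).
Proof.
move=> mA /andP[z0 zl]; have l0 : (0 <= l)%R by exact: le_trans zl.
have l40 : (0 <= 4 * l)%R by rewrite mulr_ge0.
have md : measurable_fun setT (fun x : meas3 R => (4 * l * dv ax2 x ^+ 2)%R).
  by apply: measurable_funM => //; exact: measurable_funX.
have md0 x : (0 <= 4 * l * dv ax2 x ^+ 2)%R by rewrite mulr_ge0// sqr_ge0.
rewrite -rod_tonelli// -ge0_integralZl//; last 2 first.
- by apply/measurable_EFinP; exact: msl.
- by move=> y _; rewrite lee_fin sqr_ge0.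
rewrite -ge0_integralD//; last 4 first.
- by move=> y _; rewrite -EFinM lee_fin mulr_ge0// sqr_ge0.
- by apply: emeasurable_funM => //; apply/measurable_EFinP; exact: msl.
- by move=> y _; apply: integral_ge0 => t _; rewrite lee_fin.
- by apply: measurable_funTS; apply: (measurable_line_int _ md md0).
apply: ge0_le_integral => //.
- by move=> y _; rewrite lee_fin sqr_ge0.
- by apply/measurable_EFinP; exact: msl.
- apply: emeasurable_funD.
    by apply: emeasurable_funM => //; apply/measurable_EFinP; exact: msl.
  by apply: measurable_funTS; apply: (measurable_line_int _ md md0).
move=> y _; have := sqr_le_end zl (slice_line sv y) (@slice_line_continuous R v sv y).
move=> /le_trans; apply; rewrite -EFinM leeD2l//.
have mdy (c : R) (I : set (measurableTypeR R)) :
    measurable_fun I (fun t => (c * dv ax2 (y, t) ^+ 2)%:E).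
  apply/measurable_EFinP; apply: measurable_funTS; apply: measurable_funM => //.
  by apply: measurable_funX; exact: (measurable_fun_pair2 y (mdv ax2)).
apply: (@le_trans _ _ (\int[leb]_(t in `[z, l]) (4 * l * dv ax2 (y, t) ^+ 2)%:E)).
  apply: ge0_le_integral => //.
  - by move=> t _; rewrite lee_fin mulr_ge0 ?sqr_ge0// mulr_ge0// subr_ge0.
  - by move=> t _; rewrite lee_fin ler_wpM2r ?sqr_ge0// ler_wpM2l// gerBl.
apply: ge0_subset_integral => //.
- by move=> t _; rewrite lee_fin.
- by move=> t /=; rewrite !in_itv/= => /andP[zt tl]; rewrite (le_trans z0 zt).
Qed.

(** The planar inequality enters as the hypothesis on all C^1 functions. The bound of [rod_slice]
    does not depend on z, so integrating it over the thickness only multiplies it by h. *)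
Lemma plate_slices (U F A : set (meas2 R)) (W : meas2 R -> R) (h l a b c : R) :
  measurable U -> measurable F -> measurable A -> measurable_fun setT W ->
  (0 < h)%R -> (h <= l)%R -> (0 <= a)%R -> (0 <= b)%R -> (0 <= c)%R ->
  (forall w d1 d2, C1_plane w d1 d2 ->
    \int[leb2 R]_(y in U `&` F) ((W y * w y) ^+ 2)%:E <=
    c%:E * (a%:E * sqint A w + b%:E * gradint U d1 d2)) ->
  \int[leb3 R]_(x in (U `&` F) `*` `]0%R, h[) ((W x.1 * v x) ^+ 2)%:E <=
  c%:E * ((a * h)%:E * (2%:E * \int[leb2 R]_(y in A) (v (y, l) ^+ 2)%:E +
                        (4 * l)%:E * sqL2 (A `*` `]0%R, l[) (dv ax2)) +
    b%:E * (sqL2 (U `*` `]0%R, h[) (dv ax0) + sqL2 (U `*` `]0%R, h[) (dv ax1))).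
Proof.
move=> mU mF mA mW h0 hl a0 b0 c0 H.
have mUF : measurable (U `&` F) by exact: measurableI.
have mI : measurable (`]0%R, h[%classic : set (measurableTypeR R)).
  exact: measurable_itv.
set B := 2%:E * _ + _.
have B0 : 0 <= B.
  apply: adde_ge0; apply: mule_ge0 => //.
  - by apply: integral_ge0 => y _; rewrite lee_fin sqr_ge0.
  - by rewrite lee_fin mulr_ge0// (le_trans (ltW h0)).
  - by apply: integral_ge0 => y _; rewrite lee_fin sqr_ge0.
have mWv : measurable_fun setT (fun x : meas3 R => ((W x.1 * v x) ^+ 2)%R).
  apply: measurable_funX; apply: measurable_funM => //.
  by apply: (measurableT_comp mW); exact: measurable_fst.
have Wv0 (x : meas3 R) : (0 <= (W x.1 * v x) ^+ 2)%R by exact: sqr_ge0.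
have [_ ->] := ge0_tonelli_setX mUF mI (measurable_funTS mWv) Wv0.
pose G (x : meas3 R) := (dv ax0 x ^+ 2 + dv ax1 x ^+ 2)%R.
have mG : measurable_fun setT G.
  by apply: measurable_funD; exact: measurable_funX.
have G0 x : (0 <= G x)%R by rewrite addr_ge0// sqr_ge0.
pose Gz z := \int[leb2 R]_(y in U) (G (y, z))%:E.
have Gz0 z : 0 <= Gz z by apply: integral_ge0 => y _; rewrite lee_fin.
have mGz : measurable_fun (`]0%R, h[%classic : set (measurableTypeR R)) Gz.
  by apply: measurable_funTS; exact: measurable_slice_int.
have bGz0 z : 0 <= b%:E * Gz z by rewrite mule_ge0.
have mbGz : measurable_fun (`]0%R, h[%classic : set (measurableTypeR R))
    (fun z => b%:E * Gz z) by exact: emeasurable_funM.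
apply: (@le_trans _ _ (\int[leb]_(z in `]0%R, h[)
    (c%:E * (a%:E * B + b%:E * Gz z)))).
  apply: ge0_le_integral => //.
  - by move=> z _; apply: integral_ge0 => y _; rewrite lee_fin.
  - by apply: measurable_funTS; exact: (measurable_slice_int mUF mWv Wv0).
  - by apply: emeasurable_funM => //; apply: emeasurable_funD.
  move=> z /=; rewrite in_itv/= => /andP[z0 zh].
  apply: (le_trans (H _ _ _ (slice_plane sv z))).
  rewrite lee_wpmul2l ?lee_fin// leeD2r// lee_wpmul2l ?lee_fin//.
  by apply: rod_slice => //; rewrite (ltW z0) (le_trans (ltW zh)).
rewrite ge0_integralZl//; last 2 first.
- by apply: emeasurable_funD.
- by move=> z _; rewrite adde_ge0// mule_ge0.
rewrite lee_wpmul2l ?lee_fin// ge0_integralD//; last by move=> z _; rewrite mule_ge0.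
apply: leeD.
  rewrite integral_cst//= lebesgue_measure_itv/= lte_fin h0 sube0.
  by rewrite muleAC EFinM.
rewrite ge0_integralZl// lee_wpmul2l ?lee_fin//.
have mUI : measurable (U `*` `]0%R, h[) by exact: measurableX.
have [_ <-] := ge0_tonelli_setX mU mI (measurable_funTS mG) G0.
rewrite /G; under eq_integral do rewrite EFinD.
rewrite ge0_integralD//.
- by move=> x _; rewrite lee_fin sqr_ge0.
- by apply/measurable_EFinP; exact: msq.
- by move=> x _; rewrite lee_fin sqr_ge0.
- by apply/measurable_EFinP; exact: msq.
Qed.

End smooth_estimates.

(** * The junction and its energy *)

Section junction.
Variables (R : realType) (J : nat).
Variables (omega0 : set (R * R)) (omega : 'I_J -> set (R * R)).
Variables (P : 'I_J -> R * R) (l : 'I_J -> R) (h : R).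
Hypothesis dom0 : smooth_contour_domain omega0.
Hypothesis dom : forall j, smooth_contour_domain (omega j).
Hypothesis h_gt0 : 0 < h.
Hypothesis h_small : small_h omega0 omega P l h.
Local Open Scope ereal_scope.
Notation meas := (measurable : set (set (meas3 R))).
Notation pla := (plate omega0 h).
Notation perf := (perforated_plate omega0 omega P h).
Notation rd := (rod omega P l h).
Notation XI := (Xi omega0 omega P l h).

Lemma itv_ooE (a b : R) : [set z | (a < z < b)%R] = `]a, b[%classic.
Proof. by apply/seteqP; split=> z /=; rewrite in_itv. Qed.

Lemma plate_measurable : meas pla.
Proof.
rewrite /plate itv_ooE; apply: measurableX; last exact: measurable_itv.
by apply: open_measurable2; case: dom0.
Qed.

Lemma omegah_measurable j : measurable (omegah omega P h j : set (meas2 R)).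
Proof.
by apply: open_measurable2; apply: open_omegah; case: (dom j).
Qed.

Lemma rod_measurable j : meas (rd j).
Proof.
rewrite /rod itv_ooE; apply: measurableX; last exact: measurable_itv.
exact: omegah_measurable.
Qed.

Lemma perforated_plate_measurable : meas perf.
Proof.
rewrite /perforated_plate itv_ooE; apply: measurableX; last exact: measurable_itv.
apply: measurableD; first by apply: open_measurable2; case: dom0.
apply: closed_measurable2; apply: closed_bigcup => //; first exact: finite_finset.
by move=> j _; exact: closed_closure.
Qed.

Lemma Xi_measurable : meas XI.
Proof.
apply: measurableU; first exact: plate_measurable.
by apply: fin_bigcup_measurable => [|j _]; [exact: finite_finset|exact: rod_measurable].
Qed.

Lemma rod_sub_Xi j : rd j `<=` XI.
Proof. by move=> x rx; right; exists j. Qed.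

Lemma plate_sub_Xi : pla `<=` XI.
Proof. by move=> x; left. Qed.

Lemma perforated_sub_Xi : perf `<=` XI.
Proof. by move=> x [[ox _] xz]; left. Qed.

Lemma omegah_boundary_null j : exists2 N : set (meas2 R), measurable N &
  leb2 R N = 0 /\ closure (omegah omega P h j) `\` omegah omega P h j `<=` N.
Proof.
have [oj _ _ [g sg gE]] := dom j.
have [N mN [N0 gN]] := contour_null (P j) h sg.
exists N => //; split => // y [cy ncy]; apply: gN.
pose f (y : R * R) := (h^-1 *: (y - P j))%R.
have cf : continuous f.
  by move=> z; apply: cvgZl_tmp; apply: cvgB; [exact: cvg_id|exact: cvg_cst].
have clf : closed (f @^-1` closure (omega j)).
  by apply: closed_comp; [move=> z _; exact: cf|exact: closed_closure].
have sub : closure (omegah omega P h j) `<=` f @^-1` closure (omega j).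
  rewrite [X in _ `<=` X]((closure_id _).1 clf); apply: closure_subset => z oz.
  exact: subset_closure.
have : range g (f y).
  by rewrite -gE; split; [exact: sub|move=> /interior_subset].
move=> [t _ gt]; exists t => //; rewrite gt /f scalerA mulfV ?gt_eqF// scale1r.
by rewrite addrC subrK.
Qed.

(** The perforated plate omits the closed holes, the rods only contain the open ones. What remains
    is a cylinder over the scaled contours, of measure 0; h < l_j puts the inside of a hole into its
    rod. *)
Lemma plate_cover (f : meas3 R -> \bar R) : measurable_fun setT f ->
  (forall x, 0 <= f x) ->
  \int[leb3 R]_(x in pla) f x <=
  \int[leb3 R]_(x in perf) f x + \sum_(j < J) \int[leb3 R]_(x in rd j) f x.
Proof.
move=> mf f0.
have /choice[N HN] : forall j, exists N : set (meas2 R), measurable N /\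
    leb2 R N = 0 /\ closure (omegah omega P h j) `\` omegah omega P h j `<=` N.
  by move=> j; have [N mN [N0 sN]] := omegah_boundary_null j; exists N.
have mN j : measurable (N j) by have [] := HN j.
pose N3 : set (meas3 R) := (\big[setU/set0]_(j < J) N j) `*` `]0%R, h[.
have mN2 : measurable (\big[setU/set0]_(j < J) N j) by exact: bigsetU_measurable.
have mN3 : measurable N3 by exact: measurableX.
have N30 : leb3 R N3 = 0.
  suff lN : leb2 R (\big[setU/set0]_(j < J) N j) = 0.
    have -> : leb3 R N3 = leb2 R (\big[setU/set0]_(j < J) N j) *
        lebesgue_measure (`]0%R, h[ : set (measurableTypeR R)).
      by apply: product_measure1E => //; exact: measurable_itv.
    by rewrite lN mul0e.
  apply/eqP; rewrite eq_le measure_ge0 andbT.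
  pose F (x : meas2 R) := 1 : \bar R.
  have F0 x : 0 <= F x by rewrite lee_fin.
  have mF : measurable_fun setT F by exact: measurable_cst.
  have := @ge0_integral_bigsetU_le _ _ R (leb2 R) F mF F0 _ (index_enum 'I_J) N mN.
  rewrite integral_cst// mul1e => /le_trans; apply.
  rewrite big1// => j _; rewrite integral_cst// mul1e; by have [_ []] := HN j.
rewrite (ge0_negligible_integral mN3 plate_measurable)//; last exact: measurable_funTS.
pose rods : set (meas3 R) := \big[setU/set0]_(j < J) rd j.
have mrods : measurable rods by apply: bigsetU_measurable => j _; exact: rod_measurable.
apply: (@le_trans _ _ (\int[leb3 R]_(x in perf `|` rods) f x)).
  apply: ge0_subset_integral => //.
  - by apply: measurableD => //; exact: plate_measurable.
  - by apply: measurableU => //; exact: perforated_plate_measurable.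
  - exact: measurable_funTS.
  move=> [y z] [[/= oy zh] nN].
  have [[j _ cy]|nc] :=
    pselect ((\bigcup_j closure (omegah omega P h j)) y); last first.
    by left.
  right; rewrite /rods -bigcup_seq; exists j => /=; first by rewrite mem_index_enum.
  split => /=; last first.
    by have /andP[-> zl] := zh; rewrite (lt_trans zl)//; case: h_small.
  apply: contrapT => noy; apply: nN; split => //=.
  rewrite -bigcup_seq; exists j => /=; first by rewrite mem_index_enum.
  by have [_ [_]] := HN j; apply.
apply: (le_trans (ge0_integral_setU_le (leb3 R) mf f0
  perforated_plate_measurable mrods)).
by rewrite leeD2l//; apply: ge0_integral_bigsetU_le => //; exact: rod_measurable.
Qed.

End junction.

(** * Comparison and limits of squared L^2 norms *)

Section sqL2_lemmas.
Variable R : realType.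
Implicit Types X Y : set (meas3 R).
Local Open Scope ereal_scope.

Lemma sqL2_ge0 X (f : R * R * R -> R) : 0 <= sqL2 X f.
Proof. by apply: integral_ge0 => x _; rewrite lee_fin sqr_ge0. Qed.

Lemma sqr_EFin_measurable X (f : meas3 R -> R) : measurable_fun X f ->
  measurable_fun X (fun x => (f x ^+ 2)%:E).
Proof. by move=> mf; apply/measurable_EFinP; exact: measurable_funX. Qed.

Lemma le_sqL2 X Y (f : meas3 R -> R) : measurable X -> measurable Y -> X `<=` Y ->
  measurable_fun Y f -> sqL2 X f <= sqL2 Y f.
Proof.
move=> mX mY XY mf; apply: ge0_subset_integral => //.
  exact: sqr_EFin_measurable.
by move=> x _; rewrite lee_fin sqr_ge0.
Qed.

Lemma sqL2_le_sub X (f g : meas3 R -> R) : measurable X ->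
  measurable_fun X f -> measurable_fun X g ->
  sqL2 X f <= 2%:E * sqL2 X g + 2%:E * sqL2 X (g \- f)%R.
Proof.
move=> mX mf mg; have mgf : measurable_fun X (g \- f)%R by exact: measurable_funB.
have pos (k : meas3 R -> R) x : 0 <= (k x ^+ 2)%:E by rewrite lee_fin sqr_ge0.
rewrite -!ge0_integralZl//; try exact: sqr_EFin_measurable.
rewrite -ge0_integralD//; try (by move=> x _; rewrite mule_ge0);
  try (by apply: emeasurable_funM => //; exact: sqr_EFin_measurable).
apply: ge0_le_integral => //; first exact: sqr_EFin_measurable.
  by apply: emeasurable_funD; apply: emeasurable_funM => //;
    exact: sqr_EFin_measurable.
move=> x _; rewrite -!EFinM -EFinD lee_fin /=.
have := sqr_ge0 (2 * g x - f x); rewrite !expr2; lra.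
Qed.

Lemma sqL2_weight_le X Y (W f : meas3 R -> R) (M : R) : measurable X ->
  measurable Y -> X `<=` Y -> measurable_fun X W -> measurable_fun Y f ->
  (0 <= M)%R -> (forall x, X x -> 0 <= W x <= M)%R ->
  sqL2 X (fun x => W x * f x)%R <= (M ^+ 2)%:E * sqL2 Y f.
Proof.
move=> mX mY XY mW mf M0 WM; have mfX : measurable_fun X f.
  exact: measurable_funS mf.
apply: (@le_trans _ _ ((M ^+ 2)%:E * sqL2 X f)); last first.
  by apply: lee_wpmul2l; [rewrite lee_fin sqr_ge0|exact: le_sqL2].
rewrite -ge0_integralZl//; last 3 first.
- exact: sqr_EFin_measurable.
- by move=> x _; rewrite lee_fin sqr_ge0.
- by rewrite lee_fin sqr_ge0.
apply: ge0_le_integral => //.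
- by move=> x _; rewrite lee_fin sqr_ge0.
- by apply: sqr_EFin_measurable; exact: measurable_funM.
- by apply: emeasurable_funM => //; exact: sqr_EFin_measurable.
move=> x Xx; have /andP[W0 W1] := WM x Xx.
by rewrite -EFinM lee_fin exprMn ler_wpM2r ?sqr_ge0// ler_sqr ?nnegrE// (le_trans W0).
Qed.

Lemma cvg0_mul (a : R) (s : nat -> \bar R) : s @ \oo --> 0 ->
  (fun n => a%:E * s n) @ \oo --> 0.
Proof. by move=> s0; rewrite -(mule0 a%:E); exact: cvgeZl. Qed.

Lemma cvg0_add (s t : nat -> \bar R) : s @ \oo --> 0 -> t @ \oo --> 0 ->
  (fun n => s n + t n) @ \oo --> 0.
Proof. by move=> s0 t0; rewrite -(adde0 0); exact: cvgeD. Qed.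

Lemma cvg0_sum (I : Type) (r : seq I) (s : I -> nat -> \bar R) :
  (forall i, s i @ \oo --> 0) -> (fun n => \sum_(i <- r) s i n) @ \oo --> 0.
Proof.
move=> s0; elim: r => [|i r IHr].
  rewrite (_ : (fun n => _) = fun=> 0); first exact: cvg_cst.
  by apply/funext => n; rewrite big_nil.
rewrite (_ : (fun n => _) = fun n => s i n + \sum_(i <- r) s i n).
  exact: cvg0_add.
by apply/funext => n; rewrite big_cons.
Qed.

Lemma lee_limit (x y : \bar R) (s : nat -> \bar R) : s @ \oo --> 0 ->
  (forall n, x <= y + s n) -> x <= y.
Proof.
move=> s0 H; have cy : (fun n => y + s n) @ \oo --> y.
  rewrite -[X in _ --> X](adde0 y); apply: cvgeD => //; last exact: cvg_cst.
  by case: (y).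
by apply: (cvge_ge _ cy); exact: nearW.
Qed.

End sqL2_lemmas.

Section energy_bounds.
Variables (R : realType) (J : nat).
Variables (perf : set (meas3 R)) (rd : 'I_J -> set (meas3 R)) (X : set (meas3 R)).
Variable c : 'I_J -> R.
Hypothesis c0 : forall j, 0 <= c j.
Hypothesis mperf : measurable perf.
Hypothesis mrd : forall j, measurable (rd j).
Hypothesis mX : measurable X.
Hypothesis perfX : perf `<=` X.
Hypothesis rdX : forall j, rd j `<=` X.
Local Open Scope ereal_scope.
Implicit Types g : 'I_3 -> R * R * R -> R.

(** The gradient is an arbitrary triple g, so that the same expression serves for the classical
    gradients of the approximations and for the weak gradient of u. *)
Definition split_energy g : \bar R :=
  \sum_(i < 3) sqL2 perf (g i) + \sum_(j < J) (c j)%:E * \sum_(i < 3) sqL2 (rd j) (g i).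

Lemma sum_sqL2_ge0 Y g : 0 <= \sum_(i < 3) sqL2 Y (g i).
Proof. by apply: sume_ge0 => i _; exact: sqL2_ge0. Qed.

Lemma rods_energy_ge0 g : 0 <= \sum_(j < J) (c j)%:E * \sum_(i < 3) sqL2 (rd j) (g i).
Proof. by apply: sume_ge0 => j _; rewrite mule_ge0 ?lee_fin ?sum_sqL2_ge0. Qed.

Lemma split_energy_ge0 g : 0 <= split_energy g.
Proof. by rewrite adde_ge0 ?sum_sqL2_ge0 ?rods_energy_ge0. Qed.

Lemma rod_le_split_energy g j i : (c j)%:E * sqL2 (rd j) (g i) <= split_energy g.
Proof.
apply: (@le_trans _ _ (\sum_(j < J) (c j)%:E * \sum_(i < 3) sqL2 (rd j) (g i)));
  last by rewrite leeDr// sum_sqL2_ge0.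
rewrite (bigD1 j)//=.
apply: (@le_trans _ _ ((c j)%:E * \sum_(i < 3) sqL2 (rd j) (g i))).
  rewrite lee_wpmul2l ?lee_fin// (bigD1 i)//= leeDl// sume_ge0// => k _.
  exact: sqL2_ge0.
rewrite leeDl// sume_ge0// => k _.
by rewrite mule_ge0 ?lee_fin ?sum_sqL2_ge0.
Qed.

Lemma sum_le_split_energy g (D : R) : (0 <= D)%R -> (1 <= D)%R ->
  (forall j, 1 <= D * c j)%R ->
  \sum_(i < 3) sqL2 perf (g i) + \sum_(j < J) \sum_(i < 3) sqL2 (rd j) (g i) <=
  D%:E * split_energy g.
Proof.
move=> D0 D1 Dc.
rewrite /split_energy ge0_muleDr ?sum_sqL2_ge0 ?rods_energy_ge0//; apply: leeD.
  by rewrite -{1}[leLHS]mul1e lee_wpmul2r ?sum_sqL2_ge0 ?lee_fin.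
rewrite ge0_sume_distrr; last first.
  by move=> j _; rewrite mule_ge0 ?lee_fin ?sum_sqL2_ge0.
apply: lee_sum => j _; rewrite muleA -EFinM -{1}[leLHS]mul1e.
by rewrite lee_wpmul2r ?sum_sqL2_ge0 ?lee_fin.
Qed.

Lemma split_energy_le_sub f g : (forall i, measurable_fun X (f i : meas3 R -> R)) ->
  (forall i, measurable_fun X (g i : meas3 R -> R)) ->
  split_energy f <= 2%:E * split_energy g + (2 * (1 + \sum_(j < J) c j))%:E *
    \sum_(i < 3) sqL2 X (f i \- g i)%R.
Proof.
move=> mf mg; set S := \sum_(i < 3) sqL2 X _.
have S0 : 0 <= S by apply: sume_ge0 => i _; exact: sqL2_ge0.
have part (Y : set (meas3 R)) : measurable Y -> Y `<=` X ->
    \sum_(i < 3) sqL2 Y (f i) <= 2%:E * (\sum_(i < 3) sqL2 Y (g i)) + 2%:E * S.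
  move=> mY YX; rewrite !ge0_sume_distrr; [|by move=> i _; exact: sqL2_ge0
    |by move=> i _; exact: sqL2_ge0].
  rewrite -big_split/=; apply: lee_sum => i _.
  have mfY : measurable_fun Y (f i : meas3 R -> R) by exact: measurable_funS (mf i).
  have mgY : measurable_fun Y (g i : meas3 R -> R) by exact: measurable_funS (mg i).
  apply: (le_trans (sqL2_le_sub mY mfY mgY)); rewrite leeD2l// lee_wpmul2l//.
  have -> : sqL2 Y (g i \- f i)%R = sqL2 Y (f i \- g i)%R.
    by apply: eq_integral => x _; congr EFin; rewrite /= -sqrrN opprB.
  by apply: le_sqL2 => //; exact: measurable_funB.
apply: (@le_trans _ _ ((2%:E * (\sum_(i < 3) sqL2 perf (g i)) + 2%:E * S) +
   \sum_(j < J) ((c j)%:E * (2%:E * (\sum_(i < 3) sqL2 (rd j) (g i)) + 2%:E * S)))).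
  apply: leeD; first exact: part.
  by apply: lee_sum => j _; rewrite lee_wpmul2l ?lee_fin//; exact: part.
rewrite /split_energy [2%:E * (_ + _)]ge0_muleDr ?sum_sqL2_ge0 ?rods_energy_ge0//.
have -> : \sum_(j < J) ((c j)%:E * (2%:E * (\sum_(i < 3) sqL2 (rd j) (g i)) + 2%:E * S))
  = 2%:E * (\sum_(j < J) (c j)%:E * \sum_(i < 3) sqL2 (rd j) (g i)) +
    (2 * \sum_(j < J) c j)%:E * S.
  pose T j := \sum_(i < 3) sqL2 (rd j) (g i).
  have T0 j : 0 <= T j by exact: sum_sqL2_ge0.
  rewrite [2%:E * _ in RHS](_ : _ = \sum_(j < J) 2%:E * ((c j)%:E * T j)); last first.
    by rewrite -ge0_sume_distrr// => j _; rewrite mule_ge0 ?lee_fin ?T0.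
  rewrite mulr_sumr -sumEFin ge0_sume_distrl; last first.
    by move=> j _; rewrite lee_fin mulr_ge0.
  rewrite -big_split/=; apply: eq_bigr => j _.
  rewrite ge0_muleDr ?mule_ge0 ?sum_sqL2_ge0//.
  by congr (_ + _); rewrite !muleA; congr (_ * _); rewrite -EFinM mulrC.
have -> : (2 * (1 + \sum_(j < J) c j))%:E * S =
    2%:E * S + (2 * \sum_(j < J) c j)%:E * S.
  rewrite -ge0_muleDl ?lee_fin ?mulr_ge0 ?sumr_ge0// -EFinD.
  by congr (_%:E * _); ring.
by rewrite addeACA.
Qed.

End energy_bounds.

(** * The estimate for smooth functions *)

Section smooth_bound.
Variables (R : realType) (J : nat).
Variables (omega0 : set (R * R)) (omega : 'I_J -> set (R * R)).
Variables (P : 'I_J -> R * R) (l gam : 'I_J -> R) (alpha h0 : R).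
Hypothesis dom0 : smooth_contour_domain omega0.
Hypothesis dom : forall j, smooth_contour_domain (omega j).
Hypothesis omega_origin : forall j, omega j (0, 0).
Hypothesis P_omega0 : forall j, omega0 (P j).
Hypothesis l_gt0 : forall j, 0 < l j.
Hypothesis h0_gt0 : 0 < h0.
Hypothesis h0_small : forall h : R, 0 < h <= h0 -> small_h omega0 omega P l h.
Hypothesis alpha_ge0 : 0 <= alpha.
Hypothesis gam_gt0 : forall j, 0 < gam j.
Local Open Scope ereal_scope.

Definition mfactor (h : R) : R :=
  (Num.min (h `^ (- alpha + 1)) ((1 + `|ln h|) ^- 2))%R.

Definition far_plate (h n : R) : set (R * R * R) :=
  (omega0 `&` far P n) `*` `]0%R, h[.

Definition cut_rod (h : R) j (e : R) : set (R * R * R) :=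
  omegah omega P h j `*` `]0%R, (l j - e)%R[.

(* The weights are bounded on the truncated domains, which makes this quantity
   continuous with respect to v in L^2(Xi(h)). *)
Definition truncated_lhs h j (n e : R) (v : R * R * R -> R) : \bar R :=
  (mfactor h)%:E * sqL2 (far_plate h n) (fun x => rweight P x.1 * v x)%R +
  (h `^ (- alpha))%:E * sqL2 (cut_rod h j e) (fun x => (l j - x.2)^-1 * v x)%R.

Definition energy_of h (g : 'I_3 -> R * R * R -> R) : \bar R :=
  split_energy (perforated_plate omega0 omega P h) (rod omega P l h)
    (fun k => gam k * h `^ (- alpha))%R g.

Lemma leeD_sum3 (F : 'I_3 -> \bar R) : (forall i, 0 <= F i) ->
  F ax0 + F ax1 <= \sum_(i < 3) F i.
Proof.
move=> F0; rewrite (bigD1 ax0)// leeD2l// (bigD1 ax1)// leeDl// sume_ge0//.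
Qed.

Lemma mfactor_ge0 h : (0 <= mfactor h)%R.
Proof. by rewrite le_min powR_ge0 invr_ge0 sqr_ge0. Qed.

(** The order of the quantifiers is essential: C is chosen before h, n and e, whereas C' comes after
    them. The trace of v is kept because the approximations of u vanish on Gamma(h) only in the
    limit. *)
Lemma smooth_bound j : exists2 C : R, (0 <= C)%R &
  forall h n e : R, (0 < h <= h0)%R -> (0 <= n)%R -> (0 < e)%R ->
  exists2 C' : R, (0 <= C')%R & forall v : R * R * R -> R, smooth3 v ->
    truncated_lhs h j n e v <=
    C%:E * energy_of h (fun i => 'D_(e3 R i) v) +
    C'%:E * sqL2_Gamma omega P l h v.
Proof.
have [oj _ _ _] := dom j; have [oo _ _ _] := dom0.
have [C C0 HC] := plane_inequality dom0 P_omega0 oj (omega_origin j) h0_gt0.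
(* D times each energy coefficient is at least 1: the 1 serves the perforated plate, and the k-th
   summand serves the k-th rod because (h0 / h)^alpha >= 1. *)
pose D : R := (1 + \sum_(k < J) (gam k)^-1 * h0 `^ alpha)%R.
have Dk0 k : (0 <= (gam k)^-1 * h0 `^ alpha)%R.
  by rewrite mulr_ge0 ?powR_ge0// invr_ge0 ltW.
have D1 : (1 <= D)%R by rewrite lerDl sumr_ge0.
have D0 : (0 <= D)%R by exact: le_trans D1.
have gj0 : (0 <= (gam j)^-1)%R by rewrite invr_ge0 ltW.
have lj0 : (0 <= l j)%R by exact: ltW.
exists (C * (4 * l j * (gam j)^-1 + D) + 16 * (gam j)^-1)%R.
  by rewrite addr_ge0 ?mulr_ge0// addr_ge0// !mulr_ge0.
move=> h n e hh n0 e0; have /andP[h_gt0 hh0] := hh.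
have hs := h0_small hh.
have hl : (h <= l j)%R by case: hs => _ _ /(_ j) /ltW.
set m := mfactor h; have m0 : (0 <= m)%R by exact: mfactor_ge0.
have ha0 : (0 <= h `^ (- alpha))%R by exact: powR_ge0.
have h20 : (0 <= h ^- 2)%R by rewrite invr_ge0 sqr_ge0.
have hV0 : (0 <= h^-1)%R by rewrite invr_ge0 ltW.
have mh1 : (m * h^-1 <= h `^ (- alpha))%R.
  apply: (@le_trans _ _ (h `^ (- alpha + 1) * h^-1)%R).
    by rewrite ler_wpM2r// ge_min lexx.
  rewrite powRD; last by apply/implyP => _; rewrite gt_eqF.
  rewrite powRr1 ?(ltW h_gt0)// -mulrA mulfV ?gt_eqF//.
  by rewrite mulr1.
have mL : (m * (1 + `|ln h|) ^+ 2 <= 1)%R.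
  have L0 : (0 < (1 + `|ln h|) ^+ 2)%R by rewrite exprn_gt0// ltr_wpDr.
  by rewrite -ler_pdivlMr// mul1r ge_min lexx orbT.
(* c1 and c2 may grow as h or e tends to 0; they multiply the trace term only. *)
pose c1 : R := (m * C * h^-1 * 2)%R.
pose c2 : R := (h `^ (- alpha) * (8 * e^-1))%R.
have eV0 : (0 <= e^-1)%R by rewrite invr_ge0 ltW.
have c10 : (0 <= c1)%R by rewrite !mulr_ge0.
have c20 : (0 <= c2)%R by rewrite !mulr_ge0.
exists (c1 + c2)%R; first by rewrite addr_ge0.
move=> v sv; pose dv i := 'D_(e3 R i) v.
set E := energy_of h _; set Ga := sqL2_Gamma _ _ _ _ _.
have mA : measurable (omegah omega P h j : set (meas2 R)).
  exact: omegah_measurable.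
have m0' : measurable (omega0 : set (meas2 R)) by exact: open_measurable2.
pose Gj := \int[leb2 R]_(y in omegah omega P h j) (v (y, l j) ^+ 2)%:E.
have Gk0 k : 0 <= \int[leb2 R]_(y in omegah omega P h k) (v (y, l k) ^+ 2)%:E.
  by apply: integral_ge0 => y _; rewrite lee_fin sqr_ge0.
have GjGa : Gj <= Ga.
  by rewrite /Ga /sqL2_Gamma (bigD1 j)//= leeDl// sume_ge0.
have Gj0 : 0 <= Gj by exact: Gk0.
have Ga0 : 0 <= Ga by exact: le_trans GjGa.
have g0 k : (0 <= gam k * h `^ (- alpha))%R by rewrite mulr_ge0// ltW.
have E0 : 0 <= E by exact: split_energy_ge0.
pose Rj := sqL2 (rod omega P l h j) (dv ax2).
have Rj0 : 0 <= Rj by exact: sqL2_ge0.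
have RjE : (h `^ (- alpha))%:E * Rj <= (gam j)^-1%:E * E.
  have := @rod_le_split_energy R J (perforated_plate omega0 omega P h) (rod omega P l h)
    (fun k => gam k * h `^ (- alpha))%R g0 dv j ax2.
  move=> /(lee_wpmul2l (gj0 : 0 <= (gam j)^-1%:E)); rewrite muleA -EFinM.
  by rewrite mulrA mulVf ?gt_eqF// mul1r.
have rodE : rod omega P l h j = omegah omega P h j `*` `]0%R, (l j)[.
  by rewrite /rod itv_ooE.
have PlE : sqL2 (omega0 `*` `]0%R, h[) (dv ax0) +
    sqL2 (omega0 `*` `]0%R, h[) (dv ax1) <= D%:E * E.
  have -> : omega0 `*` `]0%R, h[ = plate omega0 h by rewrite /plate itv_ooE.
  have mdv i : measurable_fun setT (dv i : meas3 R -> R).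
    by apply: continuous_measurable3; exact: smooth3_continuous_derive.
  apply: (@le_trans _ _ (\sum_(i < 3) sqL2 (plate omega0 h) (dv i))).
    apply: (leeD_sum3 (F := fun i => sqL2 (plate omega0 h) (dv i))) => i.
    exact: sqL2_ge0.
  apply: (@le_trans _ _ (\sum_(i < 3) sqL2 (perforated_plate omega0 omega P h) (dv i) +
      \sum_(k < J) \sum_(i < 3) sqL2 (rod omega P l h k) (dv i))).
    rewrite exchange_big/= -big_split/=; apply: lee_sum => i _.
    apply: plate_cover => //.
      exact: sqr_EFin_measurable.
    by move=> x; rewrite lee_fin sqr_ge0.
  apply: sum_le_split_energy => // k.
  have hah : (1 <= h0 `^ alpha * h `^ (- alpha))%R.
    rewrite powRN ler_pdivlMr ?powR_gt0// mul1r.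
    by rewrite ge0_ler_powR// nnegrE ltW.
  apply: (@le_trans _ _ (((gam k)^-1 * h0 `^ alpha) * (gam k * h `^ (- alpha)))%R).
    rewrite mulrACA mulVf ?gt_eqF// mul1r//.
  rewrite ler_wpM2r// /D (bigD1 k)//= addrCA lerDl addr_ge0// sumr_ge0//.
have part1 : m%:E * sqL2 (far_plate h n) (fun x => rweight P x.1 * v x)%R <=
    c1%:E * Ga + (C * (4 * l j * (gam j)^-1 + D))%:E * E.
  have L0 : (0 <= (1 + `|ln h|) ^+ 2)%R by rewrite sqr_ge0.
  have := @plate_slices R v sv omega0 (far P n) (omegah omega P h j) (rweight P)
    h (l j) (h ^- 2) ((1 + `|ln h|) ^+ 2) C m0' (far_measurable P n) mA
    (rweight_measurable P) h_gt0 hl h20 L0 C0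
    (fun w d1 d2 C1w => HC h n w d1 d2 hh n0 C1w).
  move=> /(lee_wpmul2l (m0 : 0 <= m%:E))/le_trans; apply.
  rewrite -/Gj -rodE -/Rj; set Pl := _ (dv ax0) + _ in PlE *.
  have hE : (h ^- 2 * h = h^-1)%R.
    by rewrite expr2; field; rewrite gt_eqF.
  rewrite hE.
  have Pl0 : 0 <= Pl by rewrite adde_ge0 ?sqL2_ge0.
  have H0 : 0 <= 2%:E * Gj + (4 * l j)%:E * Rj.
    by rewrite adde_ge0// mule_ge0// lee_fin mulr_ge0.
  rewrite muleA -EFinM ge0_muleDr ?mule_ge0 ?lee_fin//.
  rewrite !muleA -!EFinM ge0_muleDr ?mule_ge0 ?lee_fin ?mulr_ge0//.
  rewrite !muleA -!EFinM -addeA; apply: leeD.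
    rewrite (_ : m * C * h^-1 * 2 = c1)%R//.
    by rewrite lee_wpmul2l ?lee_fin.
  rewrite mulrDr EFinD ge0_muleDl ?lee_fin ?mulr_ge0//; apply: leeD.
    apply: (@le_trans _ _ ((C * (4 * l j))%:E * ((h `^ (- alpha))%:E * Rj))).
      rewrite muleA -EFinM lee_wpmul2r// lee_fin.
      rewrite [leLHS](_ : _ = (C * (4 * l j)) * (m * h^-1))%R; last by ring.
      by rewrite ler_wpM2l// !mulr_ge0.
    rewrite [(C * (_ * (gam j)^-1))%R]mulrA [leRHS](_ : _ =
      (C * (4 * l j))%:E * ((gam j)^-1%:E * E)); last by rewrite muleA -EFinM.
    by rewrite lee_wpmul2l ?lee_fin ?mulr_ge0.
  apply: (@le_trans _ _ (C%:E * Pl)).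
    rewrite lee_wpmul2r// lee_fin mulrAC -[leRHS]mul1r ler_wpM2r//.
  by rewrite EFinM -muleA lee_wpmul2l ?lee_fin.
have part2 : (h `^ (- alpha))%:E *
    sqL2 (cut_rod h j e) (fun x => (l j - x.2)^-1 * v x)%R <=
    c2%:E * Ga + (16 * (gam j)^-1)%:E * E.
  have := rod_hardy sv mA e0 lj0.
  move=> /(lee_wpmul2l (ha0 : 0 <= (h `^ (- alpha))%:E))/le_trans; apply.
  rewrite -rodE -/Rj -/Gj ge0_muleDr ?mule_ge0 ?lee_fin ?mulr_ge0//.
  apply: leeD.
    by rewrite muleA -EFinM lee_wpmul2l ?lee_fin.
  by rewrite muleCA EFinM -muleA lee_wpmul2l ?lee_fin.
rewrite /truncated_lhs; apply: (le_trans (leeD part1 part2)).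
set K := (C * _)%R in part1 *; set L := (16 * _)%R in part2 *.
have K0 : (0 <= K)%R by rewrite mulr_ge0// addr_ge0// !mulr_ge0.
have L0 : (0 <= L)%R by rewrite mulr_ge0.
have -> : (K + L)%:E * E = K%:E * E + L%:E * E.
  by rewrite -ge0_muleDl ?lee_fin.
have -> : (c1 + c2)%:E * Ga = c1%:E * Ga + c2%:E * Ga.
  by rewrite -ge0_muleDl ?lee_fin.
by rewrite addeACA [leRHS]addeC.
Qed.

End smooth_bound.

(** * Passage to the limit *)

Section passage_to_limit.
Variables (R : realType) (J : nat).
Variables (omega0 : set (R * R)) (omega : 'I_J -> set (R * R)).
Variables (P : 'I_J -> R * R) (l gam : 'I_J -> R) (alpha h0 : R).
Hypothesis dom0 : smooth_contour_domain omega0.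
Hypothesis dom : forall j, smooth_contour_domain (omega j).
Hypothesis gam_gt0 : forall j, 0 < gam j.
Variables (h : R).
Hypothesis h_small : small_h omega0 omega P l h.
Local Open Scope ereal_scope.
Notation pla := (plate omega0 h).
Notation perf := (perforated_plate omega0 omega P h).
Notation rd := (rod omega P l h).
Notation XI := (Xi omega0 omega P l h).
Notation meas := (measurable : set (set (meas3 R))).

Let m0 : (0 <= mfactor alpha h)%R.
Proof. exact: mfactor_ge0. Qed.

Let ha0 : (0 <= h `^ (- alpha))%R.
Proof. exact: powR_ge0. Qed.

Let mXI : meas XI.
Proof. exact: Xi_measurable. Qed.

Lemma far_plate_measurable n : meas (far_plate omega0 P h n).
Proof.
apply: measurableX; last exact: measurable_itv.
apply: measurableI; last exact: far_measurable.
by apply: open_measurable2; case: dom0.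
Qed.

Lemma cut_rod_measurable j e : meas (cut_rod omega P l h j e).
Proof.
by apply: measurableX; [exact: omegah_measurable|exact: measurable_itv].
Qed.

Lemma far_plate_sub n : far_plate omega0 P h n `<=` pla.
Proof. by move=> [y z] [[oy _] /=]; rewrite in_itv. Qed.

Lemma cut_rod_sub j e : (0 <= e)%R -> cut_rod omega P l h j e `<=` rd j.
Proof.
move=> e0 [y z] [oy /=]; rewrite in_itv/= => /andP[z0 zl]; split => //=.
by rewrite z0 (lt_le_trans zl)// gerBl.
Qed.

Lemma rweight_fst_measurable (A : set (meas3 R)) :
  measurable_fun A (fun x : meas3 R => rweight P x.1).
Proof.
apply: measurable_funTS; apply: (measurableT_comp (rweight_measurable P)).
exact: measurable_fst.
Qed.

Lemma rod_weight_measurable j :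
  measurable_fun (rd j : set (meas3 R)) (fun x : meas3 R => ((l j - x.2)^-1)%R).
Proof.
apply: measurable_fun_inv; first exact: rod_measurable.
  by apply: measurable_funTS; apply: measurable_funB => //; exact: measurable_snd.
by move=> [y z] [_ /= /andP[_ zl]]; rewrite subr_ge0 ltW.
Qed.

(** On the truncated domains the weights are at most e^n and e^-1, so replacing u by v costs a
    multiple of the L^2 distance, besides the 2 of (a + b)^2 <= 2 a^2 + 2 b^2. *)
Lemma truncated_le_sub j (n e : R) (u v : meas3 R -> R) : (0 <= n)%R -> (0 < e)%R ->
  measurable_fun XI u -> measurable_fun XI v ->
  truncated_lhs omega0 omega P l alpha h j n e u <=
  2%:E * truncated_lhs omega0 omega P l alpha h j n e v +
  (2 * (mfactor alpha h * expR n ^+ 2 + h `^ (- alpha) * e^-1 ^+ 2))%:E *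
    sqL2 XI (v \- u)%R.
Proof.
move=> n0 e0 mu mv; have e1 : (0 <= e^-1)%R by rewrite invr_ge0 ltW.
have mvu : measurable_fun XI (v \- u)%R by exact: measurable_funB.
have part (A : set (meas3 R)) (W : meas3 R -> R) (M : R) : measurable A ->
    A `<=` XI -> measurable_fun A W -> (0 <= M)%R ->
    (forall x, A x -> 0 <= W x <= M)%R ->
    sqL2 A (fun x => W x * u x)%R <= 2%:E * sqL2 A (fun x => W x * v x)%R +
      (2 * M ^+ 2)%:E * sqL2 XI (v \- u)%R.
  move=> mA AX mW M0 WM.
  have muA : measurable_fun A u by exact: measurable_funS mu.
  have mvA : measurable_fun A v by exact: measurable_funS mv.
  have := sqL2_le_sub mA (measurable_funM mW muA) (measurable_funM mW mvA).
  move=> /le_trans; apply; rewrite leeD2l// EFinM -muleA lee_wpmul2l//.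
  rewrite (_ : sqL2 A _ = sqL2 A (fun x => W x * (v \- u) x)%R).
    exact: sqL2_weight_le.
  by apply: eq_integral => x _; rewrite /= mulrBr.
rewrite /truncated_lhs.
set U1 := sqL2 _ (fun x => _ * u x)%R; set U2 := sqL2 (cut_rod _ _ _ _ _ _) _.
set V1 := sqL2 _ (fun x => _ * v x)%R; set V2 := sqL2 (cut_rod _ _ _ _ _ _) _.
set S := sqL2 XI _.
have H1 : U1 <= 2%:E * V1 + (2 * expR n ^+ 2)%:E * S.
  apply: part.
  - exact: far_plate_measurable.
  - apply: (@subset_trans _ pla); last exact: plate_sub_Xi.
    exact: far_plate_sub.
  - exact: rweight_fst_measurable.
  - exact: expR_ge0.
  - move=> [y z] [[_ fy] _] /=; rewrite rweight_ge0/= -[expR n]invrK -expRN.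
    by apply: rweight_le_inv => //; exact: expR_gt0.
have H2 : U2 <= 2%:E * V2 + (2 * e^-1 ^+ 2)%:E * S.
  apply: part => //.
  - exact: cut_rod_measurable.
  - apply: (@subset_trans _ (rd j)); last exact: rod_sub_Xi.
    by apply: cut_rod_sub; exact: ltW.
  - have mr : meas (rd j) by exact: rod_measurable.
    exact: (measurable_funS mr (cut_rod_sub (ltW e0)) (rod_weight_measurable (j := j))).
  - move=> [y z] [_ /=]; rewrite in_itv/= => /andP[_ zl].
    have lz : (e <= l j - z)%R by lra.
    by rewrite invr_ge0 (le_trans (ltW e0))//= lef_pV2// posrE (lt_le_trans e0).
have S0 : 0 <= S by exact: sqL2_ge0.
have V10 : 0 <= V1 by exact: sqL2_ge0.
have V20 : 0 <= V2 by exact: sqL2_ge0.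
have e20 : (0 <= expR n ^+ 2)%R by exact: sqr_ge0.
have e2' : (0 <= e^-1 ^+ 2)%R by exact: sqr_ge0.
apply: (@le_trans _ _ ((mfactor alpha h)%:E * (2%:E * V1 + (2 * expR n ^+ 2)%:E * S) +
   (h `^ (- alpha))%:E * (2%:E * V2 + (2 * e^-1 ^+ 2)%:E * S))).
  by apply: leeD; apply: lee_wpmul2l; rewrite ?lee_fin.
set m := mfactor alpha h; set H := (h `^ (- alpha))%R.
set M := (2 * expR n ^+ 2)%R; set N := (2 * e^-1 ^+ 2)%R.
have M0 : (0 <= M)%R by rewrite mulr_ge0.
have N0 : (0 <= N)%R by rewrite mulr_ge0.
have -> : m%:E * (2%:E * V1 + M%:E * S) = 2%:E * (m%:E * V1) + (m * M)%:E * S.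
  by rewrite ge0_muleDr ?mule_ge0 ?lee_fin// muleCA [(_ * _)%:E]EFinM -muleA.
have -> : H%:E * (2%:E * V2 + N%:E * S) = 2%:E * (H%:E * V2) + (H * N)%:E * S.
  by rewrite ge0_muleDr ?mule_ge0 ?lee_fin// muleCA [(_ * _)%:E]EFinM -muleA.
have -> : 2%:E * (m%:E * V1 + H%:E * V2) = 2%:E * (m%:E * V1) + 2%:E * (H%:E * V2).
  by apply: ge0_muleDr; rewrite mule_ge0// lee_fin.
have -> : (2 * (m * expR n ^+ 2 + H * e^-1 ^+ 2))%:E * S =
    (m * M)%:E * S + (H * N)%:E * S.
  rewrite -ge0_muleDl ?lee_fin ?mulr_ge0// -EFinD; congr (_%:E * _).
  by rewrite /M /N; ring.
by rewrite addeACA.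
Qed.

End passage_to_limit.

Section chain.
Variable R : realType.
Local Open Scope ereal_scope.

(** T and E belong to u, Tv and Ev to a smooth approximation. Passing from u to v on the left and
    from v to u in the energy each costs a factor 2, whence 4 C; S, G and D are the terms that tend
    to 0. *)
Lemma chained_bounds (T Tv E Ev S G D : \bar R) (M C C' K : R) :
  (0 <= C)%R -> (0 <= C')%R -> (0 <= K)%R ->
  0 <= Ev -> 0 <= E -> 0 <= G -> 0 <= D ->
  T <= 2%:E * Tv + M%:E * S -> Tv <= C%:E * Ev + C'%:E * G ->
  Ev <= 2%:E * E + K%:E * D ->
  T <= (4 * C)%:E * E + (M%:E * S + ((2 * C')%:E * G + (2 * C * K)%:E * D)).
Proof.
move=> C0 C'0 K0 Ev0 E0 G0 D0 H1 H2 H3; apply: (le_trans H1).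
rewrite addeCA [leRHS]addeC; apply: leeD => //.
have -> : (4 * C)%:E * E + ((2 * C')%:E * G + (2 * C * K)%:E * D) =
    2%:E * (C%:E * (2%:E * E + K%:E * D) + C'%:E * G).
  have -> : C%:E * (2%:E * E + K%:E * D) = C%:E * (2%:E * E) + C%:E * (K%:E * D).
    by apply: ge0_muleDr; rewrite mule_ge0.
  rewrite ge0_muleDr ?adde_ge0 ?mule_ge0//.
  rewrite (ge0_muleDr 2%:E) ?mule_ge0//.
  rewrite !muleA -!EFinM -addeA; congr (_ + _).
    by congr (_%:E * _); ring.
  by rewrite addeC.
rewrite lee_wpmul2l//; apply: (le_trans H2); rewrite leeD2r//.
by rewrite lee_wpmul2l.
Qed.

End chain.

Section truncated_bound.
Variables (R : realType) (J : nat).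
Variables (omega0 : set (R * R)) (omega : 'I_J -> set (R * R)).
Variables (P : 'I_J -> R * R) (l gam : 'I_J -> R) (alpha h0 : R).
Hypothesis dom0 : smooth_contour_domain omega0.
Hypothesis dom : forall j, smooth_contour_domain (omega j).
Hypothesis omega_origin : forall j, omega j (0, 0).
Hypothesis P_omega0 : forall j, omega0 (P j).
Hypothesis l_gt0 : forall j, 0 < l j.
Hypothesis h0_gt0 : 0 < h0.
Hypothesis h0_small : forall h : R, 0 < h <= h0 -> small_h omega0 omega P l h.
Hypothesis alpha_ge0 : 0 <= alpha.
Hypothesis gam_gt0 : forall j, 0 < gam j.
Local Open Scope ereal_scope.

Lemma weak_partial_measurable (U : set (meas3 R)) (u : meas3 R -> R) i :
  inH1 U u -> measurable_fun U (weak_partial U i u : meas3 R -> R).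
Proof. by move=> [_ /(_ i)/(xgetPex (fun=> 0%R))[[]]]. Qed.

Lemma truncated_bound j : exists2 C : R, (0 <= C)%R &
  forall h n e : R, (0 < h <= h0)%R -> (0 <= n)%R -> (0 < e)%R ->
  forall u : R * R * R -> R, inH10 omega0 omega P l h u ->
    truncated_lhs omega0 omega P l alpha h j n e u <=
    C%:E * energy omega0 omega P l (fun k => gam k * h `^ (- alpha))%R h u.
Proof.
have [C C0 HC] := smooth_bound dom0 dom omega_origin P_omega0 l_gt0 h0_gt0
  h0_small alpha_ge0 gam_gt0 j.
exists (4 * C)%R; first by rewrite mulr_ge0.
move=> h n e hh n0 e0 u [H1u [v [[sv v0 dv0] vG]]].
have [C' C'0 HC'] := HC h n e hh n0 e0.
have hs := h0_small hh.
pose XI : set (meas3 R) := Xi omega0 omega P l h.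
pose w i : meas3 R -> R := weak_partial XI i u.
have mw i : measurable_fun XI (w i) by exact: weak_partial_measurable.
have mu : measurable_fun XI (u : meas3 R -> R) by case: H1u => [[]].
have mv k : measurable_fun XI (v k : meas3 R -> R).
  by apply: measurable_funTS; apply: continuous_measurable3; exact: smooth3_continuous.
have mdv k i : measurable_fun XI ('D_(e3 R i) (v k) : meas3 R -> R).
  apply: measurable_funTS; apply: continuous_measurable3.
  exact: smooth3_continuous_derive.
set c := fun k => _.
have c0 k : (0 <= c k)%R by rewrite mulr_ge0 ?powR_ge0// ltW.
set E := energy _ _ _ _ _ _ _.
have EE : E =
    split_energy (perforated_plate omega0 omega P h) (rod omega P l h) c w by [].
set M := (2 * (mfactor alpha h * expR n ^+ 2 + h `^ (- alpha) * e^-1 ^+ 2))%R.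
pose K := (2 * (1 + \sum_(k < J) c k))%R.
have K0 : (0 <= K)%R by rewrite mulr_ge0// addr_ge0// sumr_ge0.
pose s k := M%:E * sqL2 XI (v k \- u)%R +
  ((2 * C')%:E * sqL2_Gamma omega P l h (v k) +
   (2 * C * K)%:E * \sum_(i < 3) sqL2 XI ('D_(e3 R i) (v k) \- w i)%R).
(* For fixed h, n and e the coefficients in s are constants, and H^1 convergence and the zero trace
   make s tend to 0. *)
apply: (@lee_limit _ _ _ s).
  apply: cvg0_add; first exact: cvg0_mul.
  apply: cvg0_add; apply: cvg0_mul; last by apply: cvg0_sum => i; exact: dv0.
  rewrite (_ : (fun k => _) = fun k => sqL2_Gamma omega P l h (v k \- fun=> 0)%R)//.
  apply/funext => k; rewrite /sqL2_Gamma; apply: eq_bigr => i _.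
  by apply: eq_integral => y _; rewrite /= subr0.
move=> k.
apply: (@chained_bounds _ _ (truncated_lhs omega0 omega P l alpha h j n e (v k)) _
  (energy_of omega0 omega P l gam alpha h (fun i => 'D_(e3 R i) (v k)))) => //.
- exact: split_energy_ge0.
- by rewrite EE; exact: split_energy_ge0.
- by apply: sume_ge0 => i _; apply: integral_ge0 => y _; rewrite lee_fin sqr_ge0.
- by apply: sume_ge0 => i _; exact: sqL2_ge0.
- exact: (truncated_le_sub alpha dom0 dom j n0 e0 mu (mv k)).
- exact: HC'.
- rewrite EE; apply: split_energy_le_sub => //.
  + exact: perforated_plate_measurable.
  + by move=> i; exact: rod_measurable.
  + exact: Xi_measurable.
  + exact: perforated_sub_Xi.
  + by move=> i; exact: rod_sub_Xi.
Qed.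

End truncated_bound.

(** Monotone convergence. The sets F n have to reach only the points where f is nonzero: [far_plate]
    never contains the lines over the points P k. *)
Lemma sqL2_exhaustion (R : realType) (F : nat -> set (meas3 R)) (Y : set (meas3 R))
    (f : meas3 R -> R) : (forall n, measurable (F n)) ->
  {homo F : n m / (n <= m)%N >-> n `<=` m} -> measurable Y ->
  (forall n, F n `<=` Y) -> measurable_fun Y f ->
  (forall x, Y x -> f x != 0 -> exists n, F n x) ->
  (fun n => sqL2 (F n) f) @ \oo --> sqL2 Y f.
Proof.
move=> mF ndF mY FY mf fF.
have -> : sqL2 Y f = (\int[leb3 R]_(x in \bigcup_n F n) (f x ^+ 2)%:E)%E.
  rewrite /sqL2 integral_mkcond [RHS]integral_mkcond; apply: eq_integral => x _.
  rewrite /patch; case: (boolP (x \in Y)) => [/set_mem Yx|nYx]; last first.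
    case: ifPn => // /set_mem[n _ Fn]; case/negP: nYx.
    by apply/mem_set; exact: FY Fn.
  case: ifPn => // nFx; have [->|f0] := eqVneq (f x) 0; first by rewrite expr0n.
  have [n Fn] := fF x Yx f0.
  by case/negP: nFx; apply/mem_set; exists n.
apply: ge0_nondecreasing_set_cvg_integral => //.
- by move=> n m nm; apply/subsetPset; exact: ndF.
- by move=> n; apply: sqr_EFin_measurable; exact: (measurable_funS mY (FY n) mf).
- by move=> n x _; rewrite lee_fin sqr_ge0.
Qed.

Section main_estimate.
Variables (R : realType) (J : nat).
Variables (omega0 : set (R * R)) (omega : 'I_J -> set (R * R)).
Variables (P : 'I_J -> R * R) (l gam : 'I_J -> R) (alpha h0 : R).
Hypothesis dom0 : smooth_contour_domain omega0.
Hypothesis dom : forall j, smooth_contour_domain (omega j).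
Hypothesis omega_origin : forall j, omega j (0, 0).
Hypothesis P_omega0 : forall j, omega0 (P j).
Hypothesis l_gt0 : forall j, 0 < l j.
Hypothesis h0_gt0 : 0 < h0.
Hypothesis h0_small : forall h : R, 0 < h <= h0 -> small_h omega0 omega P l h.
Hypothesis alpha_ge0 : 0 <= alpha.
Hypothesis gam_gt0 : forall j, 0 < gam j.

(** Both cut-offs are removed along one sequence, n = k and e = 1 / (k + 1); the shift keeps e
    positive at k = 0, as [truncated_bound] requires. *)
Lemma truncated_cvg (h : R) j (u : meas3 R -> R) :
  measurable_fun (Xi omega0 omega P l h : set (meas3 R)) u ->
  (fun k : nat => truncated_lhs omega0 omega P l alpha h j k%:R k.+1%:R^-1 u)
    @ \oo -->
  ((mfactor alpha h)%:E * sqL2 (plate omega0 h) (fun x => rweight P x.1 * u x)%R +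
   (h `^ (- alpha))%:E * sqL2 (rod omega P l h j) (fun x => (l j - x.2)^-1 * u x)%R)%E.
Proof.
move=> mu; have mXI : measurable (Xi omega0 omega P l h : set (meas3 R)).
  exact: Xi_measurable.
apply: cvgeD.
- apply: ge0_adde_def; rewrite inE mule_ge0 ?lee_fin ?mfactor_ge0 ?powR_ge0//;
    exact: sqL2_ge0.
- apply: cvgeZl => //; apply: sqL2_exhaustion.
  + by move=> n; exact: far_plate_measurable.
  + move=> n m nm [y z] [[oy fy] zh]; split => //; split => //.
    by apply: le_trans fy; rewrite ler_expR lerN2 ler_nat.
  + exact: plate_measurable.
  + by move=> n; exact: far_plate_sub.
  + apply: measurable_funM; first exact: rweight_fst_measurable.
    exact: (measurable_funS mXI (@plate_sub_Xi _ _ _ omega P l h) mu).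
  + move=> [y z] [oy zh] /=; rewrite mulf_eq0 negb_or => /andP[w0 _].
    (* At the points P k themselves the weight is 0^-1 = 0. *)
    have r0 : 0 < rdist P y.
      rewrite lt_neqAle rdist_ge0 andbT; apply: contra w0 => /eqP r0.
      by rewrite /rweight -r0 invr0 mul0r.
    exists (Num.bound (- ln (rdist P y))); split; last by rewrite /= in_itv.
    split => //=; rewrite /far/= -[leRHS]lnK ?posrE// ler_expR lerNl.
    by rewrite ltW//; exact: unstable.ltr_bound.
- apply: cvgeZl => //; apply: sqL2_exhaustion.
  + by move=> n; exact: cut_rod_measurable.
  + move=> n m nm [y z] [oy]; rewrite /= !in_itv/= => /andP[z0 zl]; split => //=.
    rewrite in_itv/= z0 (lt_le_trans zl)// lerB// lef_pV2 ?posrE//.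
    by rewrite ler_nat ltnS.
  + exact: rod_measurable.
  + by move=> n; apply: cut_rod_sub.
  + apply: measurable_funM; first exact: rod_weight_measurable.
    exact: (measurable_funS mXI (@rod_sub_Xi _ _ omega0 omega P l h j) mu).
  + move=> [y z] [oy /= /andP[z0 zl]] _.
    have lz0 : 0 < l j - z by rewrite subr_gt0.
    exists (Num.bound (l j - z)^-1); split => //=; rewrite in_itv/= z0/=.
    rewrite ltrBrDl -ltrBrDr.
    rewrite -[ltRHS]invrK ltf_pV2 ?posrE ?invr_gt0//.
    by rewrite (lt_trans (unstable.ltr_bound _))// ltr_nat.
Qed.

Lemma junction_estimate j : exists2 C : R, 0 <= C &
  forall h : R, 0 < h <= h0 ->
  forall u : R * R * R -> R, inH10 omega0 omega P l h u ->
    ((mfactor alpha h)%:E *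
       sqL2 (plate omega0 h) (fun x => rweight P x.1 * u x)%R +
     (h `^ (- alpha))%:E *
       sqL2 (rod omega P l h j) (fun x => (l j - x.2)^-1 * u x)%R <=
     C%:E * energy omega0 omega P l (fun k => gam k * h `^ (- alpha))%R h u)%E.
Proof.
have [C C0 HC] := truncated_bound dom0 dom omega_origin P_omega0 l_gt0 h0_gt0
  h0_small alpha_ge0 gam_gt0 j.
exists C => // h hh u Hu.
have mu : measurable_fun (Xi omega0 omega P l h : set (meas3 R)) (u : meas3 R -> R).
  by case: Hu => -[[]].
apply: (cvge_le _ (truncated_cvg (h := h) (j := j) mu)).
apply: nearW => k; exact: HC.
Qed.

End main_estimate.

Theorem theorem9 (R : realType) (J : nat)
    (omega0 : set (R * R)) (omega : 'I_J -> set (R * R))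
    (P : 'I_J -> R * R) (l gam : 'I_J -> R) (alpha h0 : R)
    (J_ge1 : (1 <= J)%N)
    (omega0_dom : smooth_contour_domain omega0)
    (omega_dom : forall j, smooth_contour_domain (omega j))
    (omega_origin : forall j, omega j (0, 0))
    (P_distinct : injective P)
    (P_omega0 : forall j, omega0 (P j))
    (l_gt0 : forall j, 0 < l j)
    (h0_gt0 : 0 < h0)
    (h0_small : forall h : R, 0 < h <= h0 -> small_h omega0 omega P l h)
    (alpha_ge0 : 0 <= alpha)
    (gam_gt0 : forall j, 0 < gam j) :
  exists c : R,
  forall h : R, 0 < h <= h0 ->
  forall u : R * R * R -> R, inH10 omega0 omega P l h u ->
  forall j : 'I_J,
    ((Num.min (h `^ (- alpha + 1)) ((1 + `|ln h|) ^- 2))%:E *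
       sqL2 (plate omega0 h)
         (fun x => (rdist P x.1)^-1 * (1 + `|ln (rdist P x.1)|)^-1 * u x)%R
     + (h `^ (- alpha))%:E *
       sqL2 (rod omega P l h j) (fun x => (l j - x.2)^-1 * u x)%R
     <= c%:E *
        energy omega0 omega P l (fun k => gam k * h `^ (- alpha))%R h u)%E.
Proof.
have H j := cid2 (junction_estimate omega0_dom omega_dom omega_origin P_omega0
  l_gt0 h0_gt0 h0_small alpha_ge0 gam_gt0 j).
(* The constant must serve all rods at once: the sum of the finitely many nonnegative constants
   dominates each of them. *)
exists (\sum_j s2val (H j)) => h hh u Hu j.
apply: (le_trans (s2valP' (H j) h hh u Hu)); apply: lee_wpmul2r.
  by apply: split_energy_ge0 => k; rewrite mulr_ge0 ?powR_ge0// ltW.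
rewrite lee_fin (bigD1 j)//= lerDl sumr_ge0// => k _; exact: (s2valP (H k)).
Qed.
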